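(* Let $G=(V,E)$ be an unweighted undirected graph with $n=|V|$ and $m=|E|$. The construction described in the context (producing the subgraph $H$) can be implemented in \[O\!\left(\min\left(mn^{3/5}\log^{2/5}n,\ \frac{n^{11/5}}{\log^{1/5}n}\right)\right)\] time.
   Context: A set $S$ dominates a set $X$ of vertices if every vertex of $X$ is in $S$ or adjacent to a vertex of $S$; dominating sets are computed by the greedy algorithm (repeatedly select the vertex covering the largest number of currently undominated target vertices until all targets are dominated). The construction: initialize $G'=(V',E')=(V,E)$ and $H=(V,\emptyset)$. Step 1: while the vertex $v\in V'$ of largest degree satisfies $\deg_{G'}(v)\ge n^{3/5}/\log^{3/5}n$, add a BFS tree of $G'$ rooted at $v$ to $H$ and remove $v$ and all its neighbors from $G'$. Afterwards a vertex $v\in V'$ is heavy if $\deg_{G'}(v)\ge n^{2/5}\log^{3/5}n$ and light otherwise. Step 2: for each light $u\in V'$, add all edges of $G'$ incident to $u$ to $H$. Step 3: compute (greedily) $S_1\subseteq V'$ dominating all heavy vertices in $G'$, and for each heavy vertex add to $H$ an edge connecting it to some vertex of $S_1$. Step 4: for each $v\in S_1$, compute a BFS tree $T_v$ of $G'$ rooted at $v$ such that for every $u\in V'$ the tree path from $v$ to $u$ minimizes the total vertex degree (in $G'$) along the path; let $p_{v,u}$ be the parent of $u$ in $T_v$, set $f_{v,v}=\deg_{G'}(v)$ and $f_{v,u}=f_{v,p_{v,u}}+\deg_{G'}(u)$, and let $s_{v,u}$ be the sum of $G'$-degrees of vertices in the subtree of $T_v$ rooted at $u$. Step 5: build a bipartite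 graph $B=(L,R,C)$ with $L=V'$: for each $v\in S_1$ and $u\in V'$ with $f_{v,u}>n^{3/5}\log^{2/5}n$, $f_{v,p_{v,u}}\le n^{3/5}\log^{2/5}n$ and $s_{v,u}>3n^{3/5}\log^{2/5}n$, put a node $(v,u)$ in $R$ and join it in $C$ to every $x\in V'$ adjacent (in $G'$) to some vertex on the $v$--$u$ path in $T_v$. Step 6: compute (greedily) $S_2\subseteq L$ dominating all vertices of $R$ in $B$, and for each $x\in S_2$ add a BFS tree of $G'$ rooted at $x$ to $H$. Step 7: for each $v,u\in S_1$ with $f_{v,u}\le 5n^{3/5}\log^{2/5}n$, add the $v$--$u$ path in $T_v$ to $H$. *)

(* Defs.v *)
From mathcomp Require Import all_boot all_order all_algebra.
From mathcomp Require Import reals exp.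

Set Implicit Arguments.
Unset Strict Implicit.
Unset Printing Implicit Defensive.

Import Order.TTheory GRing.Theory Num.Theory.

(* An undirected graph on a finite type V of vertices is given
   by its set E of edges, an edge being a two-element set of vertices.  In the
   construction G' is always the subgraph of G induced by the surviving set A
   of vertices. *)

Section Graphs.
Variable V : finType.
Implicit Types (E H : {set {set V}}) (A : {set V}) (g : rel V) (u v x y : V).

Definition simple_graph E : Prop := forall B, B \in E -> #|B| = 2.

Definition adj E A : rel V :=
  [rel x y | [&& x \in A, y \in A & [set x; y] \in E]].

Definition nbrs E A x : {set V} := [set y | adj E A x y].

Definition deg E A x : nat := #|nbrs E A x|.

Definition shortest g v u (s : seq V) : Prop :=
  [/\ path g v s, last v s = u &
      forall s', path g v s' -> last v s' = u -> size s <= size s'].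

(* A rooted tree is a parent map; the root and the vertices outside the tree
   are sent to None. *)
Notation ptree := {ffun V -> option V}.

Definition child (p : ptree) : rel V := [rel x y | p y == Some x].

(* x is u or an ancestor of u: the vertices of the path from the root to u are
   exactly the x with anc p x u, and the subtree rooted at x consists of the u
   with anc p x u. *)
Definition anc (p : ptree) : rel V := connect (child p).

Definition tree_edges (p : ptree) : {set {set V}} :=
  [set B | [exists x, exists y, child p x y && (B == [set x; y])]].

Definition path_edges (p : ptree) u : {set {set V}} :=
  [set B | [exists x, exists y,
    [&& child p x y, anc p y u & B == [set x; y]]]].

Definition tree_path (p : ptree) v u (s : seq V) : Prop :=
  path (child p) v s /\ last v s = u.

(* The tree spans the connected component of its root v. *)
Definition bfs_tree g v (p : ptree) : Prop :=
  [/\ p v = None,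
      forall x y, child p x y -> g x y,
      forall u, ~~ connect g v u -> p u = None &
      forall u, connect g v u ->
        exists s, tree_path p v u s /\ shortest g v u s].

(* Tree paths of a BFS tree are shortest paths, so the total weight of the
   tree path to u is minimal among all shortest paths from v to u. *)
Definition min_bfs_tree g (w : V -> nat) v (p : ptree) : Prop :=
  bfs_tree g v p /\
  forall u s s', tree_path p v u s -> shortest g v u s' ->
    \sum_(x <- v :: s) w x <= \sum_(x <- v :: s') w x.

Definition subtree_weight (w : V -> nat) (p : ptree) u : nat :=
  \sum_(x | anc p u x) w x.

(* f is only determined on the vertices of the tree. *)
Definition path_weight (w : V -> nat) v (p : ptree) (f : V -> nat) : Prop :=
  f v = w v /\ forall u q, p u = Some q -> f u = f q + w u.

End Graphs.

Notation ptree V := {ffun V -> option V}.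

(* greedy cand dom U S: S is a possible set of candidates selected by the
   greedy algorithm, U being the set of targets not dominated yet and dom c
   the set of targets dominated by c.  Ties are broken arbitrarily. *)
Inductive greedy (C X : finType) (cand : {set C}) (dom : C -> {set X}) :
    {set X} -> {set C} -> Prop :=
| greedy_done : greedy cand dom set0 set0
| greedy_pick U c S :
    U != set0 -> c \in cand ->
    {in cand, forall c', #|dom c' :&: U| <= #|dom c :&: U|} ->
    greedy cand dom (U :\: dom c) S ->
    greedy cand dom U (c |: S).

(* Logarithms are to base 2, hence at least 1 as soon as n >= 2. *)
Section Thresholds.
Variable R : realType.
Local Open Scope ring_scope.

Definition lg (n : nat) : R := ln n%:R / ln 2.

Definition t_big (n : nat) : R := n%:R `^ (3 / 5) / lg n `^ (3 / 5).
Definition t_heavy (n : nat) : R := n%:R `^ (2 / 5) * lg n `^ (3 / 5).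
Definition t_path (n : nat) : R := n%:R `^ (3 / 5) * lg n `^ (2 / 5).

End Thresholds.

Section Construction.
Variables (R : realType) (V : finType) (E : {set {set V}}).
Implicit Types (A S : {set V}) (H : {set {set V}}).
Local Open Scope ring_scope.

Local Notation n := #|V|.

(* peel A A' H: the removal of large-degree vertices, started with surviving
   vertices A, may end with surviving vertices A', having added the edges H. *)
Inductive peel (A : {set V}) : {set V} -> {set {set V}} -> Prop :=
| peel_stop :
    {in A, forall v, (deg E A v)%:R < t_big R n} ->
    peel A A set0
| peel_step v (p : ptree V) A' H :
    v \in A -> {in A, forall x, (deg E A x <= deg E A v)%N} ->
    t_big R n <= (deg E A v)%:R ->
    bfs_tree (adj E A) v p ->
    peel (A :\: (v |: nbrs E A v)) A' H ->
    peel A A' (tree_edges p :|: H).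

Definition heavy A : {set V} :=
  [set v in A | t_heavy R n <= (deg E A v)%:R].

Definition light A : {set V} :=
  [set v in A | (deg E A v)%:R < t_heavy R n].

Definition light_edges A : {set {set V}} :=
  [set B | [exists u in light A, exists x, adj E A u x && (B == [set u; x])]].

(* The nodes (v, u) of the side R of the bipartite graph B. *)
Definition right_nodes A S (T : V -> ptree V) (f : V -> V -> nat)
    : {set V * V} :=
  [set r : V * V |
    let: (v, u) := r in
    [&& v \in S, u \in A, t_path R n < (f v u)%:R,
        (if T v u is Some q then (f v q)%:R <= t_path R n else false)
      & 3 * t_path R n < (subtree_weight (deg E A) (T v) u)%:R]].

(* The B-neighbours in A x (V x V) of the vertex x of the side L. *)
Definition left_nbrs A (T : V -> ptree V) (x : V) : {set V * V} :=
  [set r : V * V |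
    let: (v, u) := r in [exists y, anc (T v) y u && adj E A x y]].

(* construction H: some run of the construction on the graph (V, E) returns
   (V, H).  Each choice left open (ties, BFS trees, dominators) is arbitrary. *)
Definition construction (H : {set {set V}}) : Prop :=
  exists (A : {set V}) (H1 : {set {set V}}) (S1 : {set V}) (d : V -> V)
         (T : V -> ptree V) (f : V -> V -> nat) (S2 : {set V})
         (T2 : V -> ptree V),
  let g := adj E A in
  [/\ peel [set: V] A H1,
      (* A heavy vertex of S1 dominates itself and gets no edge. *)
      greedy A (fun c => c |: nbrs E A c) (heavy A) S1 /\
      {in heavy A :\: S1, forall h, d h \in S1 /\ g h (d h)},
      {in S1, forall v, min_bfs_tree g (deg E A) v (T v) /\
                        path_weight (deg E A) v (T v) (f v)},
      greedy A (left_nbrs A T) (right_nodes A S1 T f) S2 /\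
      {in S2, forall x, bfs_tree g x (T2 x)}
    & H = H1 :|: light_edges A
          :|: [set [set h; d h] | h in heavy A :\: S1]
          :|: \bigcup_(x in S2) tree_edges (T2 x)
          :|: \bigcup_(v in S1)
                \bigcup_(u in S1 | connect g v u &&
                                   ((f v u)%:R <= 5 * t_path R n))
                  path_edges (T v) u].

End Construction.

(* The machine: a deterministic word RAM with structured control flow.  A
   program uses finitely many registers and finitely many named arrays of
   words; the arrays can be interleaved in a single memory, so naming them
   costs a constant factor only.  Every operation, including an indexed array
   access, costs one unit, and results are reduced modulo W = 2 ^ (word
   length). *)

Inductive binop := Add | Sub | Mul | Lt | Eq.

Inductive expr :=
| Const of nat
| Reg of nat
| Get of nat & expr
| Bin of binop & expr & expr.

Inductive prog :=
| Skip
| Set_ of nat & expr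
| Put of nat & expr & expr
| Seq of prog & prog
| If of expr & prog & prog
| While of expr & prog.

Record state := State { regs : nat -> nat; arrs : nat -> nat -> nat }.

Definition upd (X : Type) (f : nat -> X) (a : nat) (x : X) : nat -> X :=
  fun b => if b == a then x else f b.

Definition binop_val (o : binop) (x y : nat) : nat :=
  match o with
  | Add => x + y
  | Sub => x - y
  | Mul => x * y
  | Lt => x < y
  | Eq => x == y
  end.

Fixpoint eval (W : nat) (s : state) (e : expr) : nat :=
  match e with
  | Const c => c %% W
  | Reg r => regs s r
  | Get a e1 => arrs s a (eval W s e1)
  | Bin o e1 e2 => binop_val o (eval W s e1) (eval W s e2) %% W
  end.

Fixpoint ecost (e : expr) : nat :=
  match e with
  | Const _ | Reg _ => 1
  | Get _ e1 => (ecost e1).+1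
  | Bin _ e1 e2 => (ecost e1 + ecost e2).+1
  end.

(* exec W p s t s': started in s, p halts in s' after t units of time. *)
Inductive exec (W : nat) : prog -> state -> nat -> state -> Prop :=
| exec_skip s : exec W Skip s 1 s
| exec_set r e s :
    exec W (Set_ r e) s (ecost e).+1
      (State (upd (regs s) r (eval W s e)) (arrs s))
| exec_put a i e s :
    exec W (Put a i e) s (ecost i + ecost e).+1
      (State (regs s)
        (upd (arrs s) a (upd (arrs s a) (eval W s i) (eval W s e))))
| exec_seq p q s t s1 t' s2 :
    exec W p s t s1 -> exec W q s1 t' s2 ->
    exec W (Seq p q) s (t + t') s2
| exec_if_true e p q s t s1 :
    eval W s e != 0 -> exec W p s t s1 ->
    exec W (If e p q) s ((ecost e).+1 + t) s1
| exec_if_false e p q s t s1 :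
    eval W s e = 0 -> exec W q s t s1 ->
    exec W (If e p q) s ((ecost e).+1 + t) s1
| exec_while_true e p s t s1 t' s2 :
    eval W s e != 0 -> exec W p s t s1 -> exec W (While e p) s1 t' s2 ->
    exec W (While e p) s ((ecost e).+1 + t + t') s2
| exec_while_false e p s :
    eval W s e = 0 ->
    exec W (While e p) s (ecost e).+1 s.

(* k times the number of bits of n, i.e. words of O(log n) bits. *)
Definition word_modulus (k n : nat) : nat := 2 ^ (k * (trunc_log 2 n).+1).

Definition edge_set n (es : seq ('I_n * 'I_n)) : {set {set 'I_n}} :=
  [set B | B \in [seq [set q.1; q.2] | q <- es]].

(* es lists each edge of E exactly once, in any order and orientation. *)
Definition edge_list n (E : {set {set 'I_n}}) (es : seq ('I_n * 'I_n)) : Prop :=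
  uniq [seq [set q.1; q.2] | q <- es] /\ edge_set es = E.

(* Input format: n, the number of edges and the thresholds in registers 0-6,
   the two endpoints of the i-th edge at index i of arrays 0 and 1; all other
   registers and array cells are 0.  The real thresholds are only ever compared
   with integers, so they are given rounded: x >= t iff x >= ceil t, and
   x > t iff x > floor t.  Supplying them expresses that a comparison with a
   threshold takes constant time; no word RAM evaluates the real logarithm. *)
Definition input_regs (R : realType) (n m : nat) : seq nat :=
  [:: n; m; absz (Num.ceil (t_big R n)); absz (Num.ceil (t_heavy R n));
      Num.truncn (t_path R n); Num.truncn (3 * t_path R n)%R;
      Num.truncn (5 * t_path R n)%R].

Definition init_state (R : realType) n (es : seq ('I_n * 'I_n)) : state :=
  State (nth 0 (input_regs R n (size es)))
        (fun a => match a with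
                  | 0 => nth 0 [seq nat_of_ord q.1 | q <- es]
                  | 1 => nth 0 [seq nat_of_ord q.2 | q <- es]
                  | _ => fun _ => 0
                  end).

(* Output format: the number of listed edges in register 0, the endpoints of
   the i-th one at index i of arrays 2 and 3; repetitions are allowed. *)
Definition outputs n (s : state) (H : {set {set 'I_n}}) : Prop :=
  exists es : seq ('I_n * 'I_n),
  [/\ regs s 0 = size es,
      forall i q, onth es i = Some q ->
        arrs s 2 i = q.1 /\ arrs s 3 i = q.2
    & edge_set es = H].

(* Main.v *)
Require Import Defs.
From mathcomp Require Import all_boot all_order all_algebra.
From mathcomp Require Import reals exp.
From mathcomp Require Import zify ring lra.

Set Implicit Arguments.
Unset Strict Implicit.
Unset Printing Implicit Defensive.

(* Put a = n^(1/5) and c = (lg n)^(1/5), so that 1 <= c <= a, t_big = a^3/c^3,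
   t_heavy = a^2 c^3 and t_path = a^3 c^2.  Peeling takes at most n / t_big
   rounds of O(m) steps, and O(n) steps per removed vertex.  Let L be the number
   of surviving arcs: L <= 2m and L <= n t_big = a^8/c^3.  A shortest path
   contains at most three neighbours of a vertex, so a node of R has at least
   t_path / 3 neighbours in B, and a heavy vertex has at least t_heavy
   dominators; the greedy algorithm yields |S1| <= 2 a^3 c^2 and
   |S2| <= 9 a^2 c^3.  For fixed v the nodes (v, u) of R have disjoint subtrees,
   of weight more than 3 t_path, while f_(v,u) <= t_path + deg u: their paths
   have total weight at most 2L, and 3 t_path |R| <= |S1| L.  So B is built in
   O(|S1| L) steps, the whole run O(m + a^3 c^2 L) besides the
   peeling.  As m may be much smaller than n, the program only loops over arcs
   and breadth-first queues, never over all vertices. *)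

(** * Parent maps *)

(** Time O(m) forbids initialising or searching anything of size n. Arrays start at zero, each
    search clears its marks along its own queue, and maxima are taken over the sources of arcs. This
    loses nothing: an isolated vertex is not heavy and dominates no target. A search is summarised
    by local conditions on the queue, the parents, the depths and f, from which shortest paths and
    minimal weights follow. Minimising f needs no priority queue: f can only be lowered at a vertex
    while the previous layer is being expanded, so it is final when the vertex is dequeued. The
    construction is a relation, so it is enough that the program follows one of its runs. The greedy
    picks must be exact maxima; hence a gain counter for each vertex, kept correct by dismantling
    the row of a target once it is dominated. Each row is dismantled once, which bounds that cost by
    the total size of the rows. The paths of step 7 overlap; their union is found by counting
    targets in subtrees, in one pass for each root. *)

Section Forest.
Variables (V : finType) (p : ptree V) (d : V -> nat).
Hypothesis dS : forall x y, p y = Some x -> d y = (d x).+1.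

(** The depth [d] drops by one from a vertex to its parent, so an induction may descend from the
    root. *)
Lemma forest_ind (P : V -> Prop) :
  (forall u, (forall q, p u = Some q -> P q) -> P u) -> forall u, P u.
Proof.
move=> IH u; move: {2}(d u) (leqnn (d u)) => k.
elim: k u => [|k IHk] u le_k; apply: IH => q pu; have := dS pu; first by lia.
by move=> E; apply: IHk; lia.
Qed.

Lemma anc_refl u : anc p u u.
Proof. exact: connect0. Qed.

Lemma anc_root u y : p u = None -> anc p y u = (y == u).
Proof.
move=> pu; apply/idP/eqP => [/connectP[s]|->]; last exact: anc_refl.
case: (lastP s) => [|s' z]; first by move=> _ ->.
by rewrite last_rcons rcons_path => /andP[_ /eqP +] uz; rewrite -uz pu.
Qed.

Lemma anc_parent u q y : p u = Some q -> anc p y u = (y == u) || anc p y q.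
Proof.
move=> pu; apply/idP/orP => [/connectP[s]|[/eqP->|yq]].
- case: (lastP s) => [|s' z]; first by move=> _ ->; left.
  rewrite last_rcons rcons_path => /andP[ps /eqP +] uz; rewrite -uz pu.
  by move=> [->]; right; apply/connectP; exists s'.
- exact: anc_refl.
- by apply: connect_trans yq (connect1 _); rewrite /child /= pu.
Qed.

Lemma anc_leq u y : anc p y u -> d y <= d u.
Proof.
elim/forest_ind: u => u IH; case pu: (p u) => [q|]; last first.
  by rewrite (anc_root _ pu) => /eqP->.
rewrite (anc_parent _ pu) => /orP[/eqP->//|/(IH _ pu)].
by rewrite (dS pu); lia.
Qed.

Lemma anc_total u x y : anc p x u -> anc p y u -> anc p x y || anc p y x.
Proof.
elim/forest_ind: u => u IH; case pu: (p u) => [q|]; last first.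
  by rewrite !(anc_root _ pu) => /eqP-> /eqP->; rewrite anc_refl.
rewrite !(anc_parent _ pu) => /orP[/eqP->|xq] /orP[/eqP->|yq].
- by rewrite anc_refl.
- by rewrite (anc_parent _ pu) yq !orbT.
- by rewrite (anc_parent x pu) xq !orbT.
- exact: IH pu xq yq.
Qed.

Lemma anc_depth_eq x y : anc p x y -> d x = d y -> x = y.
Proof.
case py: (p y) => [q|]; last by rewrite (anc_root _ py) => /eqP.
rewrite (anc_parent _ py) => /orP[/eqP//|/anc_leq].
by rewrite (dS py); lia.
Qed.

(** The ancestors of [u] form a chain on which the depth is strictly monotone, so each depth occurs
    once. The splitting of a subtree among children and the bound of three neighbours on a path both
    rest on this. *)
Lemma anc_inj u x y : anc p x u -> anc p y u -> d x = d y -> x = y.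
Proof.
move=> xu yu dxy; case/orP: (anc_total xu yu) => [|] /anc_depth_eq; first exact.
by move=> ->.
Qed.

(** A proper descendant lies below exactly one child: below some child by induction along its path,
    below no other because the children of [u] share a depth. *)
Lemma subtree_weight_rec w u :
  subtree_weight w p u =
  w u + \sum_(c | p c == Some u) subtree_weight w p c.
Proof.
rewrite /subtree_weight (bigD1 u) ?anc_refl //=; congr (_ + _).
rewrite (exchange_big_dep (fun x => anc p u x && (x != u))) /=.
  apply: eq_bigr => x /andP[ux xNu].
  (* The pick names the unique child above [x]; the default [u] never arises, as the search for such
     a child is shown below to succeed. *)
  rewrite (eq_bigl (pred1 (odflt u [pick c | (p c == Some u) && anc p c x]))).
    by rewrite big_pred1_eq.
  move=> c /=; case: pickP => [c0 /andP[/eqP pc0 c0x]|noc] /=.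
    apply/andP/eqP => [[/eqP pc cx]|->]; last by rewrite pc0 eqxx.
    by apply: anc_inj cx c0x _; rewrite (dS pc) (dS pc0).
  rewrite noc; apply/esym/negbTE; apply/eqP => cu.
  have : exists c', (p c' == Some u) && anc p c' x.
    elim/forest_ind: x ux xNu {c noc cu} => x IH ux xNu.
    case px: (p x) => [q|]; last by move: ux; rewrite (anc_root _ px) eq_sym (negbTE xNu).
    move: ux; rewrite (anc_parent _ px) eq_sym (negbTE xNu) /= => uq.
    have [uq'|uNq] := eqVneq q u; first by exists x; rewrite px uq' eqxx anc_refl.
    have [c /andP[pc cq]] := IH _ px uq uNq; exists c.
    by rewrite pc (anc_parent _ px) cq orbT.
  by case=> c'; rewrite noc.
move=> c x /eqP pc cx; apply/andP; split.
  by apply: connect_trans cx; apply: connect1; rewrite /child /= pc.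
apply/eqP => xu; move: cx; rewrite xu => /anc_leq.
by rewrite (dS pc); lia.
Qed.

(** Two ancestors of a vertex [x] are comparable, so at most one of them satisfies [P]: the subtrees
    are disjoint and [w x] is counted at most once. *)
Lemma antichain_sum (P : pred V) w :
  {in P &, forall u u', anc p u u' -> u = u'} ->
  \sum_(u | P u) subtree_weight w p u <= \sum_x w x.
Proof.
move=> antiP; rewrite /subtree_weight (exchange_big_dep predT) //=.
apply: leq_sum => x _; case: (pickP (fun u => P u && anc p u x)) => [u0 /andP[Pu0 u0x]|no].
  rewrite (bigD1 u0) ?Pu0 //= big_pred0 ?addn0 // => u.
  apply/negbTE; rewrite !negb_and negbK -!orbA.
  case Pu: (P u) => //=; case ux: (anc p u x) => //=.
  by case/orP: (anc_total ux u0x) => /antiP ->.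
by rewrite big_pred0.
Qed.

End Forest.

(** * Breadth-first search trees *)

(** Conditions on single vertices and edges that suffice for a breadth-first tree of minimal weight.
    The last clause of [cert_nbr] is a Bellman inequality restricted to edges from one layer to the
    next. The queue positions in [cert_par] make the reversed queue an order in which children
    precede their parents, as the subtree sums require. *)
Record bfs_cert (V : finType) (g : rel V) (w : V -> nat) (v : V) (q : seq V)
    (p : ptree V) (d f : V -> nat) : Prop := BfsCert {
  cert_uniq : uniq q;
  cert_root : [/\ v \in q, p v = None, d v = 0 & f v = w v];
  cert_out : forall y, y \notin q -> p y = None;
  cert_par : forall y, y \in q -> y != v -> exists x,
    [/\ p y = Some x, x \in q, g x y, d y = (d x).+1
      & f y = f x + w y /\ index x q < index y q];
  cert_nbr : forall x y, x \in q -> g x y ->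
    [/\ y \in q, d y <= (d x).+1 & d y = (d x).+1 -> f y <= f x + w y] }.

Section Certificate.
Variables (V : finType) (g : rel V) (w : V -> nat) (v : V) (q : seq V).
Variables (p : ptree V) (d f : V -> nat).
Hypothesis cert : bfs_cert g w v q p d f.

Lemma cert_parE x y : p y = Some x ->
  [/\ y \in q, y != v, x \in q, g x y & [/\ d y = (d x).+1, f y = f x + w y
      & index x q < index y q]].
Proof.
move=> py; have [vq pv _ _] := cert_root cert.
have yq : y \in q by apply: contraPT (py) => /(cert_out cert) ->.
have yv : y != v by apply: contraPneq py => ->; rewrite pv.
have [x' [+ x'q gxy dE [fE iE]]] := cert_par cert yq yv.
by rewrite py => -[xx']; subst x'; split.
Qed.

Lemma cert_depth x y : p y = Some x -> d y = (d x).+1.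
Proof. by case/cert_parE=> _ _ _ _ []. Qed.

Let find := forest_ind cert_depth.

Lemma cert_path u : u \in q ->
  exists s, [/\ tree_path p v u s, path g v s & size s = d u].
Proof.
elim/find: u => u IH uq; have [->|uv] := eqVneq u v.
  by exists [::]; case: (cert_root cert).
have [x [pu xq gxu dE _]] := cert_par cert uq uv.
have [s [[ps ls] gs sz]] := IH _ pu xq; exists (rcons s u).
by rewrite /tree_path !rcons_path last_rcons size_rcons ps gs ls sz dE /child /= pu eqxx.
Qed.

(** An edge raises the depth by at most one, so [d] is a lower bound for the distance from [v]; the
    tree path attains it. *)
Lemma cert_reach s : path g v s ->
  last v s \in q /\ d (last v s) <= size s.
Proof.
elim/last_ind: s => [_|s y IH] /=; first by case: (cert_root cert) => -> _ ->.
rewrite rcons_path last_rcons size_rcons => /andP[/IH[lq dl] gy].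
by have [yq dy _] := cert_nbr cert lq gy; split=> //; lia.
Qed.

Lemma cert_connect u : connect g v u = (u \in q).
Proof.
apply/connectP/idP => [[s gs ->]|/cert_path[s [[_ ls] gs _]]].
  by case: (cert_reach gs).
by exists s.
Qed.

Lemma cert_weight s : path (child p) v s ->
  \sum_(x <- v :: s) w x = f (last v s).
Proof.
elim/last_ind: s => [_|s y IH] /=.
  by rewrite big_seq1; case: (cert_root cert).
rewrite rcons_path last_rcons -rcons_cons big_rcons => /andP[/IH -> /eqP/cert_parE].
by case=> _ _ _ _ [_ -> _].
Qed.

(* On a shortest path the i-th vertex is at depth i, so that the local
   optimality of f propagates along the path. *)
Lemma cert_shortest s : path g v s -> d (last v s) = size s ->
  f (last v s) <= \sum_(x <- v :: s) w x.
Proof.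
elim/last_ind: s => [_ _|s y IH] /=.
  by rewrite big_seq1; case: (cert_root cert) => _ _ _ ->.
rewrite rcons_path last_rcons size_rcons -rcons_cons big_rcons => /andP[gs gy] dy.
have [lq dl] := cert_reach gs.
have [yq dy' fy] := cert_nbr cert lq gy.
have E : d (last v s) = size s by lia.
by rewrite E in fy; apply: leq_trans (fy dy) _; rewrite leq_add2r; apply: IH.
Qed.

Lemma cert_min_bfs_tree : min_bfs_tree g w v p.
Proof.
split; first split.
- by case: (cert_root cert).
- by move=> x y /eqP/cert_parE[].
- by move=> u; rewrite cert_connect; apply: (cert_out cert).
- move=> u; rewrite cert_connect => uq.
  have [s [tp gs sz]] := cert_path uq; exists s; split=> //; split=> //.
    by case: tp.
  by move=> s' gs' ls'; rewrite sz -ls'; case: (cert_reach gs').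
- move=> u s s' [ps ls] [gs' ls' mins'].
  rewrite cert_weight // ls -ls'; apply: cert_shortest => //.
  (* The competitor is a shortest path, hence no longer than the tree path, whose length is the
     depth: its size equals the depth of its end, as [cert_shortest] demands. *)
  have [uq du] := cert_reach gs'.
  have [s0 [[_ l0] gs0 sz0]] := cert_path uq.
  by have := mins' _ gs0 (etrans l0 ls'); lia.
Qed.

Lemma cert_path_weight : path_weight w v p f.
Proof.
by split=> [|u x /cert_parE[_ _ _ _ []]//]; case: (cert_root cert).
Qed.

Lemma cert_fE u : u \in q -> f u = \sum_(y | anc p y u) w y.
Proof.
elim/find: u => u IH uq; have [->|uv] := eqVneq u v.
  have [_ pv _ ->] := cert_root cert.
  by rewrite (eq_bigl (pred1 v)) ?big_pred1_eq // => y; rewrite (anc_root _ pv).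
have [x [pu xq _ dE [-> _]]] := cert_par cert uq uv.
rewrite (IH _ pu xq) [RHS](bigD1 u) ?anc_refl //= addnC; congr (_ + _).
apply: eq_bigl => y; rewrite (anc_parent _ pu).
have [->|//] := eqVneq y u; last by rewrite andbT.
by apply: negbTE; apply/negP => /(anc_leq cert_depth); rewrite dE; lia.
Qed.

Lemma cert_anc_mem u y : u \in q -> anc p y u -> y \in q.
Proof.
elim/find: u => u IH uq; case pu: (p u) => [x|]; last first.
  by rewrite (anc_root _ pu) => /eqP->.
rewrite (anc_parent _ pu) => /orP[/eqP->//|].
by apply: IH => //; case/cert_parE: pu.
Qed.

(* The tree path to u is a shortest path, so it contains at most three
   neighbours of any vertex. *)
Lemma cert_three u x : symmetric g -> u \in q ->
  #|[set y | anc p y u & g y x]| <= 3.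
Proof.
move=> gC uq; set S := [set y | _ & _].
have near y : y \in S -> d y \in [:: (d x).-1; d x; (d x).+1].
  rewrite inE => /andP[yu gyx]; have yq := cert_anc_mem uq yu.
  have [xq d1 _] := cert_nbr cert yq gyx.
  have [_ d2 _] := cert_nbr cert xq (etrans (gC _ _) gyx).
  by rewrite !inE; lia.
rewrite -[3]/(size [:: (d x).-1; d x; (d x).+1]) cardE -(size_map d).
apply: uniq_leq_size => [|_ /mapP[y + ->]]; last by rewrite mem_enum => /near.
rewrite map_inj_in_uniq ?enum_uniq // => y y'.
rewrite !mem_enum !inE => /andP[yu _] /andP[y'u _].
exact: (anc_inj cert_depth yu y'u).
Qed.

(** [f u] is the sum of the degrees along the tree path, which counts the pairs of a path vertex and
    a neighbour of it; each neighbour occurs in at most three pairs. *)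
Lemma cert_dominators u : symmetric g -> (forall y, w y = #|[set x | g y x]|) ->
  u \in q -> f u <= 3 * #|[set x | [exists y, anc p y u && g y x]]|.
Proof.
move=> gC wE uq; rewrite cert_fE //.
rewrite (eq_bigr (fun y => \sum_(x | g y x) 1)); last first.
  by move=> y _; rewrite wE sum1dep_card.
rewrite (exchange_big_dep (fun x => [exists y, anc p y u && g y x])) /=; last first.
  by move=> y x yu gyx; apply/existsP; exists y; rewrite yu.
rewrite mulnC -sum_nat_cond_const; apply: leq_sum => x _.
by rewrite sum1dep_card; apply: cert_three.
Qed.

End Certificate.

(** * The greedy algorithm *)

Section GreedySeq.
Variables (C X : finType) (cand : {set C}) (dom : C -> {set X}).

(** The picks in the order in which the program makes them. Asking that each pick dominate a new
    target, and not only that [U] be nonempty, makes the picks distinct, so that the length of the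
    list is both the number of rounds and the size of the selected set. *)
Inductive greedy_seq : {set X} -> seq C -> Prop :=
| greedy_seq_nil : greedy_seq set0 [::]
| greedy_seq_cons U c s :
    c \in cand -> dom c :&: U != set0 ->
    {in cand, forall c', #|dom c' :&: U| <= #|dom c :&: U|} ->
    greedy_seq (U :\: dom c) s ->
    greedy_seq U (c :: s).

Lemma greedy_seq_greedy U s : greedy_seq U s -> greedy cand dom U [set c in s].
Proof.
elim=> [|{}U c {}s cC dU max _ IH].
  by rewrite set_nil; apply: greedy_done.
rewrite set_cons; apply: greedy_pick => //.
by apply: contraNneq dU => ->; rewrite setI0.
Qed.

Lemma greedy_seq_meets U s : greedy_seq U s ->
  {in s, forall c, c \in cand /\ dom c :&: U != set0}.
Proof.
elim=> [//|{}U c {}s cC dU max _ IH] c'; rewrite inE => /predU1P[->//|/IH[c'C]].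
case/set0Pn=> x; rewrite !inE => /and3P[xc' _ xU]; split=> //.
by apply/set0Pn; exists x; rewrite !inE xc'.
Qed.

Lemma greedy_seq_uniq U s : greedy_seq U s -> uniq s.
Proof.
elim=> [//|{}U c {}s cC dU max gs IH]; rewrite /= IH andbT.
apply/negP => /(greedy_seq_meets gs)[_] /set0Pn[x].
by rewrite !inE => /and3P[-> ].
Qed.

Lemma greedy_seq_covers U s : greedy_seq U s ->
  {in U, forall x, exists2 c, c \in s & x \in dom c}.
Proof.
elim=> [x|{}U c {}s cC dU max gs IH x xU]; first by rewrite inE.
have [xc|xNc] := boolP (x \in dom c); first by exists c; rewrite ?mem_head.
have [|c' c's xc'] := IH x; first by rewrite !inE xNc.
by exists c'; rewrite // inE c's orbT.
Qed.

(* Double counting: some candidate dominates at least the average. *)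
Lemma greedy_share (U : {set X}) k (c : C) : {in U, forall x, k <= #|[set c in cand | x \in dom c]|} ->
  {in cand, forall c', #|dom c' :&: U| <= #|dom c :&: U|} ->
  #|U| * k <= #|cand| * #|dom c :&: U|.
Proof.
move=> many max; rewrite -!sum_nat_const.
apply: (@leq_trans (\sum_(x in U) \sum_(c in cand | x \in dom c) 1)).
  by apply: leq_sum => x /many; rewrite sum1dep_card.
rewrite (exchange_big_dep (mem cand)) /=; last by move=> x c' _ /andP[].
apply: leq_sum => c' c'C; apply: leq_trans (max _ c'C).
rewrite -sum1_card; apply: eq_leq; apply: eq_bigl => x.
by rewrite !inE c'C andbC.
Qed.

End GreedySeq.

(** * Reasoning about word RAM programs *)

(** Syntactic write sets. For a concrete program, absence of a register or array from them is
    decided by computation, so that frame conditions are proved by [isT]. *)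
Fixpoint wregs (p : prog) : seq nat :=
  match p with
  | Skip | Put _ _ _ => [::]
  | Set_ r _ => [:: r]
  | Seq p q | If _ p q => wregs p ++ wregs q
  | While _ p => wregs p
  end.

Fixpoint warrs (p : prog) : seq nat :=
  match p with
  | Skip | Set_ _ _ => [::]
  | Put a _ _ => [:: a]
  | Seq p q | If _ p q => warrs p ++ warrs q
  | While _ p => warrs p
  end.

Definition frame (p : prog) (s s' : state) : Prop :=
  (forall r, r \notin wregs p -> regs s' r = regs s r) /\
  (forall a, a \notin warrs p -> arrs s' a = arrs s a).

Lemma frame_trans p s1 s2 s3 : frame p s1 s2 -> frame p s2 s3 -> frame p s1 s3.
Proof.
move=> [r12 a12] [r23 a23].
by split=> x xp; [rewrite r23 ?r12|rewrite a23 ?a12].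
Qed.

Lemma frame_sub p q s s' : {subset wregs p <= wregs q} ->
  {subset warrs p <= warrs q} -> frame p s s' -> frame q s s'.
Proof.
move=> rs as_ [fr fa].
by split=> x xq; [apply: fr; apply: contra (rs x) xq|apply: fa; apply: contra (as_ x) xq].
Qed.

(* The value of an expression when no operation overflows. *)
Fixpoint val_of (s : state) (e : expr) : nat :=
  match e with
  | Const c => c
  | Reg r => regs s r
  | Get a e1 => arrs s a (val_of s e1)
  | Bin o e1 e2 => binop_val o (val_of s e1) (val_of s e2)
  end.

Definition truth (s : state) (e : expr) : bool :=
  match e with
  | Bin Lt e1 e2 => val_of s e1 < val_of s e2
  | Bin Eq e1 e2 => val_of s e1 == val_of s e2
  | _ => val_of s e != 0
  end.

(* Only meaningful for loop-free programs. *)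
Fixpoint cost (p : prog) : nat :=
  match p with
  | Skip => 1
  | Set_ _ e => (ecost e).+1
  | Put _ i e => (ecost i + ecost e).+1
  | Seq p q => cost p + cost q
  | If e p q => (ecost e).+1 + maxn (cost p) (cost q)
  | While _ _ => 0
  end.

Definition For (r hi : nat) (p : prog) : prog :=
  Seq (Set_ r (Const 0))
      (While (Bin Lt (Reg r) (Reg hi))
             (Seq p (Set_ r (Bin Add (Reg r) (Const 1))))).

Section Machine.
Variable W : nat.
Hypothesis W_gt1 : 1 < W.

Lemma exec_frame p s t s' : exec W p s t s' -> frame p s s'.
Proof.
elim=> {p s t s'} //.
- by move=> r e s; split=> //= r'; rewrite inE /upd => /negbTE->.
- by move=> a i e s; split=> //= a'; rewrite inE /upd => /negbTE->.
- move=> p q s t s1 t' s2 _ f1 _ f2; apply: (frame_trans (s2 := s1)).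
    by apply: frame_sub f1 => x /= xp; rewrite mem_cat xp.
  by apply: frame_sub f2 => x /= xp; rewrite mem_cat xp orbT.
- by move=> e p q s t s1 _ _ f; apply: frame_sub f => x /= xp; rewrite mem_cat xp.
- by move=> e p q s t s1 _ _ f; apply: frame_sub f => x /= xp; rewrite mem_cat xp orbT.
- by move=> e p s t s1 t' s2 _ _ f1 _; apply: frame_trans.
Qed.

(** Conditions under which reduction modulo [W] changes nothing. Constants are limited to 0 and 1,
    the only ones in the programs, which are stable for every [W > 1]; a truncated subtraction is
    small once its first argument is; a comparison yields a bit. *)
Fixpoint safe (s : state) (e : expr) : Prop :=
  match e with
  | Const c => c < 2
  | Reg _ => True
  | Get _ e1 => safe s e1
  | Bin Add e1 e2 => [/\ safe s e1, safe s e2 & val_of s e1 + val_of s e2 < W]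
  | Bin Mul e1 e2 => [/\ safe s e1, safe s e2 & val_of s e1 * val_of s e2 < W]
  | Bin Defs.Sub e1 e2 => [/\ safe s e1, safe s e2 & val_of s e1 < W]
  | Bin Lt e1 e2 | Bin Eq e1 e2 => safe s e1 /\ safe s e2
  end.

Lemma eval_safe s e : safe s e -> eval W s e = val_of s e.
Proof.
elim: e => [c|r|a e IH|o e1 IH1 e2 IH2] //=.
- by move=> c2; rewrite modn_small //; lia.
- by move=> /IH->.
- case: o => /=; try by case=> /IH1-> /IH2-> ?; rewrite modn_small.
  + by case=> /IH1-> /IH2-> ?; rewrite modn_small //; lia.
  + by case=> /IH1-> /IH2->; rewrite modn_small //; case: ltnP; lia.
  + by case=> /IH1-> /IH2->; rewrite modn_small //; case: eqP; lia.
Qed.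

Lemma truthE s e : safe s e -> (eval W s e != 0) = truth s e.
Proof.
move/eval_safe->; case: e => // -[] //= e1 e2; first by case: (_ < _).
by case: (val_of _ _ == _).
Qed.

Definition wpb (p : prog) (s : state) (T : nat) (Q : state -> Prop) : Prop :=
  exists t s', [/\ exec W p s t s', t <= T & Q s'].

Lemma wpb_conseq p s T T' (Q Q' : state -> Prop) : wpb p s T Q -> T <= T' ->
  (forall s', frame p s s' -> Q s' -> Q' s') -> wpb p s T' Q'.
Proof.
case=> t [s' [ex tT Qs']] TT' QQ'; exists t, s'; split=> //.
  exact: leq_trans TT'.
by apply: QQ' => //; apply: exec_frame ex.
Qed.

Lemma wpb_seq p q s T1 T2 T Q : wpb p s T1 (fun s' => wpb q s' T2 Q) ->
  T1 + T2 <= T -> wpb (Seq p q) s T Q.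
Proof.
case=> t [s1 [ex1 tT1 [t' [s2 [ex2 tT2 Qs2]]]]] TT.
exists (t + t'), s2; split=> //; first exact: exec_seq ex1 ex2.
by apply: leq_trans TT; apply: leq_add.
Qed.

(** Symbolic execution of loop-free code, read without overflow, collecting the [safe] conditions on
    the way. A loop gets [False]: it has to go through one of the invariant rules. *)
Fixpoint vc (p : prog) (s : state) (Q : state -> Prop) : Prop :=
  match p with
  | Skip => Q s
  | Set_ r e => safe s e /\ Q (State (upd (regs s) r (val_of s e)) (arrs s))
  | Put a i e =>
      [/\ safe s i, safe s e
        & Q (State (regs s)
               (upd (arrs s) a (upd (arrs s a) (val_of s i) (val_of s e))))]
  | Seq p q => vc p s (fun s' => vc q s' Q)
  | If e p q =>
      [/\ safe s e, truth s e -> vc p s Q & ~~ truth s e -> vc q s Q]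
  | While _ _ => False
  end.

Lemma vc_mono p s (Q Q' : state -> Prop) :
  (forall s', Q s' -> Q' s') -> vc p s Q -> vc p s Q'.
Proof.
elim: p s Q Q' => [|r e|a i e|p IHp q IHq|e p IHp q IHq|e p IHp] s Q Q' QQ' //=.
- exact: QQ'.
- by case=> ? /QQ'.
- by case=> ? ? /QQ'.
- by apply: IHp => s'; apply: IHq.
- by case=> se vp vq; split=> // [/vp|/vq]; [apply: IHp|apply: IHq].
Qed.

Lemma vc_wpb p s T Q : vc p s Q -> cost p <= T -> wpb p s T Q.
Proof.
move=> vcp; suff: wpb p s (cost p) Q by move=> h cT; apply: (wpb_conseq h cT).
elim: p s Q vcp => [|r e|a i e|p IHp q IHq|e p IHp q IHq|e p IHp] s Q //=.
- by move=> Qs; exists 1, s; split=> //; constructor.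
- move=> [se Qs]; rewrite -(eval_safe se) in Qs.
  by eexists _, _; split; [apply: exec_set| |exact: Qs].
- move=> [si se Qs]; rewrite -(eval_safe si) -(eval_safe se) in Qs.
  by eexists _, _; split; [apply: exec_put| |exact: Qs].
- move=> vcp; apply: wpb_seq (leqnn _).
  by apply: IHp; apply: vc_mono vcp => s' /IHq.
- move=> [se vp vq]; case tr: (truth s e); rewrite tr in vp vq.
    have [t [s' [ex tT Qs']]] := IHp _ _ (vp isT).
    exists ((ecost e).+1 + t), s'; split=> //; last by lia.
    by apply: exec_if_true => //; rewrite truthE.
  have [t [s' [ex tT Qs']]] := IHq _ _ (vq isT).
  exists ((ecost e).+1 + t), s'; split=> //; last by lia.
  by apply: exec_if_false => //; apply/eqP; rewrite -[_ == _]negbK truthE ?tr.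
Qed.

(* phi is a potential: it pays for the iterations still to come. *)
Lemma wpb_while e p s phi T (I : nat -> state -> Prop) (Q : state -> Prop) :
  (forall phi s', frame (While e p) s s' -> I phi s' -> safe s' e) ->
  (forall phi s', frame (While e p) s s' -> I phi s' -> truth s' e ->
     exists T, wpb p s' T (fun s'' =>
       exists phi', (ecost e).+1 + T + phi' <= phi /\ I phi' s'')) ->
  (forall phi s', frame (While e p) s s' -> I phi s' -> ~~ truth s' e ->
     (ecost e).+1 <= phi /\ Q s') ->
  I phi s -> phi <= T -> wpb (While e p) s T Q.
Proof.
move=> Isafe Istep Iend Is phiT.
suff H s' : frame (While e p) s s' -> I phi s' -> wpb (While e p) s' phi Q.
  by apply: (wpb_conseq (H s _ Is) phiT).
elim/ltn_ind: phi s' {Is T phiT} => phi IH s' fr Is.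
case tr: (truth s' e); last first.
  have [c Qs] := Iend _ _ fr Is (negbT tr); exists (ecost e).+1, s'; split=> //.
  apply: exec_while_false; apply/eqP.
  by rewrite -[_ == _]negbK truthE ?tr //; apply: Isafe fr Is.
have [T1 [t1 [s1 [ex1 tT1 [phi1 [c Is1]]]]]] := Istep _ _ fr Is tr.
have fr1 : frame (While e p) s s1 by apply: frame_trans fr (exec_frame ex1).
have [|t2 [s2 [ex2 tT2 Qs2]]] := IH phi1 _ _ fr1 Is1; first by lia.
exists ((ecost e).+1 + t1 + t2), s2; split=> //; last by lia.
by apply: exec_while_true ex1 ex2; rewrite truthE //; apply: Isafe fr Is.
Qed.

(** Each iteration has its own budget [c i], so that costs can be summed over the data processed.
    The invariant is stated for the state in which the counter already has its next value. The 8 per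
    iteration pay the test and the increment, 4 each; the last 8 cover the initial assignment and
    the failing test. *)
Lemma wpb_for r hi p s N (c : nat -> nat) T (I : nat -> state -> Prop)
    (Q : state -> Prop) :
  [&& r \notin wregs p, hi \notin wregs p & r != hi] ->
  regs s hi = N -> N < W ->
  I 0 (State (upd (regs s) r 0) (arrs s)) ->
  (forall i s', i < N -> frame (For r hi p) s s' -> regs s' r = i -> I i s' ->
     wpb p s' (c i) (fun s'' =>
       I i.+1 (State (upd (regs s'') r i.+1) (arrs s'')))) ->
  \sum_(i < N) (c i + 8) + 8 <= T ->
  (forall s', frame (For r hi p) s s' -> I N s' -> Q s') ->
  wpb (For r hi p) s T Q.
Proof.
move=> /and3P[rp hip rhi] sN NW I0 Istep cT IQ.
pose body := Seq p (Set_ r (Bin Add (Reg r) (Const 1))).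
(* The potential is the cost of the iterations from [i] on, plus 4 for the failing test. *)
pose J phi s' := exists2 i, i <= N & [/\ frame (For r hi p) s s', regs s' r = i,
   regs s' hi = N, I i s' & phi = \sum_(i <= k < N) (c k + 8) + 4].
suff main : wpb (For r hi p) s T (fun s' => frame (For r hi p) s s' /\ I N s').
  by case: main => t [s' [ex tT [fr Is']]]; exists t, s'; split=> //; apply: IQ.
apply: (@wpb_seq _ _ _ 2 (\sum_(0 <= k < N) (c k + 8) + 4)); last first.
  by rewrite big_mkord; lia.
apply: vc_wpb => //=; split=> //.
have fr0 : frame (For r hi p) s (State (upd (regs s) r 0) (arrs s)).
  by split=> // r' /=; rewrite inE negb_or /upd => /andP[/negbTE->].
apply: (@wpb_while _ _ _ _ _ J) (leqnn _) => //.
- move=> phi s1 _ [i iN [fr ri hN Ii ->]] /=; rewrite ri hN => iN'.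
  exists (c i + 4).
  have [t [s2 [ex tc I2]]] := Istep i s1 iN' fr ri Ii.
  have fr2 := exec_frame ex.
  have ri2 : regs s2 r = i by rewrite fr2.1.
  have hi2 : regs s2 hi = N by rewrite fr2.1.
  exists (t + 4), (State (upd (regs s2) r i.+1) (arrs s2)); split.
  + apply: exec_seq ex _.
    have -> : i.+1 = eval W s2 (Bin Add (Reg r) (Const 1)).
      by rewrite eval_safe /= ri2 ?addn1 //; split=> //; lia.
    exact: exec_set.
  + by lia.
  + exists (\sum_(i.+1 <= k < N) (c k + 8) + 4); split.
      by rewrite [in leqRHS]big_ltn //; lia.
    exists i.+1 => //; split=> //=; rewrite /upd ?eqxx //; last first.
      by rewrite eq_sym (negbTE rhi).
    apply: frame_trans fr _; split=> [r'|a] /=.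
      rewrite inE mem_cat !inE !negb_or => /and3P[/negbTE-> r'p _].
      by rewrite fr2.1.
    by rewrite cats0 => ap; rewrite fr2.2.
- move=> phi s1 _ [i iN [fr ri hN Ii ->]] /=; rewrite ri hN -leqNgt => Ni.
  have {iN Ni} iE : i = N by lia.
  by rewrite iE in Ii *; split=> //; lia.
- exists 0 => //; split=> //=; rewrite /upd ?eqxx //.
  by rewrite eq_sym (negbTE rhi).
Qed.

End Machine.

(** * Tactics for symbolic execution *)

Ltac upds :=
  cbn [regs arrs];
  repeat match goal with
  | |- context [@upd ?X ?f ?a ?x ?b] =>
      let v := eval vm_compute in (b == a) in
      match v with
      | true => change (@upd X f a x b) with x
      | false => change (@upd X f a x b) with (f b)
      end
  end; cbn [regs arrs].

Infix ";;" := Seq (at level 65, right associativity).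
Infix "+e" := (Bin Add) (at level 50, left associativity).
Infix "-e" := (Bin Defs.Sub) (at level 50, left associativity).
Infix "*e" := (Bin Mul) (at level 40, left associativity).
Infix "<e" := (Bin Lt) (at level 60).
Infix "=e" := (Bin Eq) (at level 60).

Ltac simp_state :=
  upds;
  repeat (match goal with
  | f : frame _ _ ?s |- context [regs ?s ?k] => rewrite (proj1 f k isT)
  | f : frame _ _ ?s |- context [arrs ?s ?a] => rewrite (proj2 f a isT)
  | e : regs ?s ?k = _ |- context [regs ?s ?k] => rewrite e
  end; upds).

Ltac split_vc :=
  repeat lazymatch goal with
  | |- True => exact I
  | |- is_true (0 < 2) => exact isT
  | |- is_true (1 < 2) => exact isT
  | |- _ /\ _ => split
  | |- and3 _ _ _ => split
  | |- is_true _ -> _ => let c := fresh "c" in intro c; rewrite ?negbK ?eqb0 ?negbK in c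
  end.

Definition emit (e1 e2 : expr) : prog :=
  Put 2 (Reg 7) e1 ;; Put 3 (Reg 7) e2 ;; Set_ 7 (Reg 7 +e Const 1).

Ltac vcs W1 :=
  apply: (vc_wpb W1);
  [cbn [emit vc safe val_of truth binop_val]; simp_state | by []].

Ltac wpb_step a b := apply: (@wpb_seq _ _ _ _ a b); last by lia.

Ltac wpb_loop W1 N c I :=
  apply: (@wpb_for _ W1 _ _ _ _ N (fun=> c) _ I) => //;
  lazymatch goal with
  | |- is_true (leq _ _) => rewrite ?big_const_ord ?iter_addn_0; try by lia
  | _ => cbv beta
  end.

Ltac vcg W1 := vcs W1; split_vc.

(** * Arc lists and adjacency arrays *)

Definition adjl (V : eqType) (l : seq (V * V)) (x : V) : seq V :=
  [seq q.2 | q <- l & q.1 == x].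

Section AdjLists.
Variable V : eqType.
Implicit Types (l : seq (V * V)) (x y : V).

Lemma mem_adjl l x y : (y \in adjl l x) = ((x, y) \in l).
Proof.
apply/mapP/idP => [[[a b] + ->]|xyl]; first by rewrite mem_filter => /andP[/eqP/= ->].
by exists (x, y); rewrite ?mem_filter ?eqxx.
Qed.

Lemma uniq_adjl l x : uniq l -> uniq (adjl l x).
Proof.
move=> ul; rewrite map_inj_in_uniq ?filter_uniq // => -[a b] [a' b'].
by rewrite !mem_filter => /andP[/eqP/= -> _] /andP[/eqP/= -> _] ->.
Qed.

Lemma adjl_rcons l q x :
  adjl (rcons l q) x = if q.1 == x then rcons (adjl l x) q.2 else adjl l x.
Proof.
by rewrite /adjl filter_rcons; case: ifP; rewrite ?map_rcons.
Qed.

Lemma adjl_nil l x : x \notin unzip1 l -> adjl l x = [::].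
Proof.
move=> xl; apply/eqP; rewrite -size_eq0 size_map size_filter eqn0Ngt -has_count.
by apply: contra xl => /hasP[q ql /eqP<-]; apply: map_f.
Qed.

End AdjLists.

Lemma sum_size_adjl (V : finType) (l : seq (V * V)) :
  \sum_x size (adjl l x) = size l.
Proof.
elim/last_ind: l => [|l q IH]; first by rewrite big1.
rewrite size_rcons -IH (bigD1 q.1) //= [in RHS](bigD1 q.1) //= adjl_rcons eqxx size_rcons.
by rewrite addSn; congr (_ + _).+1; apply: eq_bigr => x xq; rewrite adjl_rcons eq_sym (negbTE xq).
Qed.

Section Data.
Variables (n : nat) (x0 : 'I_n).
Local Notation V := 'I_n.
Implicit Types (l : seq (V * V)) (x y : V) (a b : nat -> nat).

Definition holds a (q : seq V) : Prop :=
  forall i, i < size q -> a i = nth x0 q i.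

Definition arcs_rep a b l : Prop := forall i, i < size l ->
  a i = (nth (x0, x0) l i).1 /\ b i = (nth (x0, x0) l i).2.

Definition adj_rep (deg_ adj_ : nat -> nat) l : Prop := forall x,
  deg_ x = size (adjl l x) /\
  forall i, i < size (adjl l x) -> adj_ (x * n + i) = nth x0 (adjl l x) i.

Lemma idx_eq (i j k h : nat) : i < n -> k < n ->
  (j * n + i == h * n + k) = (j == h) && (i == k).
Proof.
move=> ni nk; apply/eqP/andP => [E|[/eqP-> /eqP->]] //.
have := congr1 (divn^~ n) E; rewrite !divnMDl ?divn_small //; lia.
Qed.

Lemma size_uniq_ord (q : seq V) : uniq q -> size q <= n.
Proof. by move=> uq; rewrite -[leqRHS]card_ord -(card_uniqP uq) max_card. Qed.

Lemma size_uniq_pairs l : uniq l -> size l <= n * n.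
Proof.
by move=> uq; rewrite -[X in X * _]card_ord -[X in _ * X]card_ord -card_prod
  -(card_uniqP uq) max_card.
Qed.

Lemma holds_rcons a q y : holds a q -> holds (upd a (size q) (y : nat)) (rcons q y).
Proof.
move=> aq i; rewrite size_rcons ltnS nth_rcons /upd; case: ltngtP => // iq _.
exact: aq.
Qed.

Lemma arcs_rep_rcons a b l x y : arcs_rep a b l ->
  arcs_rep (upd a (size l) (x : nat)) (upd b (size l) (y : nat)) (rcons l (x, y)).
Proof.
move=> al i; rewrite size_rcons ltnS nth_rcons /upd; case: ltngtP => // il _.
exact: al.
Qed.

(** Row [x] occupies the [n] cells from [x * n] on. The arcs being distinct, a row never exceeds [n]
    vertices, so the appended cell is still inside it and no other row is overwritten. *)
Lemma adj_rep_rcons deg_ adj_ l x y : uniq (rcons l (x, y)) ->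
  adj_rep deg_ adj_ l ->
  adj_rep (upd deg_ x (deg_ x + 1)) (upd adj_ (x * n + deg_ x) (y : nat))
    (rcons l (x, y)).
Proof.
move=> ul al z; have [dz az] := al z; have [dx _] := al x.
have := size_uniq_ord (uniq_adjl z ul).
have sx := size_uniq_ord (uniq_adjl x ul).
rewrite !adjl_rcons /= eqxx size_rcons in sx *.
rewrite /upd -val_eqE /= [_ == val x]eq_sym; case: eqP => [xz sz|/eqP xz sz].
  have {}xz : x = z by apply: val_inj.
  subst z; split=> [|i]; first by rewrite size_rcons dx addn1.
  rewrite size_rcons => si; rewrite dx idx_eq ?eqxx ?nth_rcons /=; try lia.
  by case: ltngtP => ?; [rewrite az|lia|].
split=> // i si; rewrite dx idx_eq //; last exact: leq_trans sz.
by rewrite eq_sym (negbTE xz) az.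
Qed.

End Data.

(** * The program *)

(* Registers 0-6 are the input, but register 1 becomes the number of surviving
   arcs; 7 counts the output edges.  Arrays 0/1: arcs; 2/3: output; 4: removed
   vertices; 5/6: degrees, adjacency lists (from x * n on); 7-9: depth + 1
   (0 if unseen), parent + 1 (0 for the root), f; 10: queue; 11/12: subtree sums
   of degrees and of targets of step 7; 13: heavy vertices; 14: vertices joined
   to S1; 20-23: the possible dominators of each greedy target (a row: length,
   items, marks) and the number of undominated rows containing each vertex;
   24/25: selected vertices, as a list and as marks. *)

Definition build : prog :=
  For 10 1 (Put 5 (Get 0 (Reg 10)) (Const 0)) ;;
  Set_ 13 (Const 0) ;;
  For 10 1 (
    Set_ 11 (Get 0 (Reg 10)) ;; Set_ 12 (Get 1 (Reg 10)) ;;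
    If (Get 4 (Reg 11)) Skip (If (Get 4 (Reg 12)) Skip (
      Put 0 (Reg 13) (Reg 11) ;; Put 1 (Reg 13) (Reg 12) ;;
      Set_ 13 (Reg 13 +e Const 1) ;;
      Put 6 (Reg 11 *e Reg 0 +e Get 5 (Reg 11)) (Reg 12) ;;
      Put 5 (Reg 11) (Get 5 (Reg 11) +e Const 1)))) ;;
  Set_ 1 (Reg 13).

Lemma row_le n k m : k < m -> k * n + n <= m * n.
Proof. by move=> km; rewrite addnC -mulSn leq_mul2r km orbT. Qed.

Section Programs.
Variables (n W : nat) (x0 : 'I_n).
Hypotheses (n_gt1 : 1 < n) (W_big : 16 * (n * n * n) <= W).
Local Notation V := 'I_n.
Implicit Types (l : seq (V * V)) (x y : V) (A : {set V}).
Local Notation wpb := (wpb W).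
Local Notation arcs_rep := (arcs_rep x0).
Local Notation adj_rep := (adj_rep x0).

(** The inequalities from which overflow is excluded: the widest addresses are those of the table
    with up to [n * n] rows of [n] cells. *)
Lemma sizes : [/\ n * 2 <= n * n, n * n * 2 <= n * n * n & 16 * (n * n * n) <= W].
Proof. by split=> //; rewrite ?leq_mul2l ?n_gt1 ?orbT. Qed.

Lemma W_gt1 : 1 < W.
Proof. by have [] := sizes; lia. Qed.

(** Degrees are reset only at the sources of the old arcs, which keeps the cost linear in the arcs;
    all other cells of array 5 have to be 0 beforehand. *)
Lemma build_ok s l0 A :
  uniq l0 -> regs s 0 = n -> regs s 1 = size l0 ->
  arcs_rep (arrs s 0) (arrs s 1) l0 ->
  (forall x, arrs s 4 x = (x \notin A)) ->
  (forall x, x \notin unzip1 l0 -> arrs s 5 x = 0) ->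
  wpb build s (60 * size l0 + 60) (fun s' =>
    let l := [seq q <- l0 | (q.1 \in A) && (q.2 \in A)] in
    [/\ regs s' 1 = size l, arcs_rep (arrs s' 0) (arrs s' 1) l
      & adj_rep (arrs s' 5) (arrs s' 6) l]).
Proof.
move=> ul0 s0 s1 sarc sdead sdeg; rewrite /build.
have [n1 n2 n3] := sizes; have l0n := size_uniq_pairs ul0.
wpb_step (15 * size l0 + 8) (45 * size l0 + 30).
(* After [i] resets, a stale degree can survive only at the source of a later arc. *)
pose I1 i s' := forall x, x \notin drop i (unzip1 l0) -> arrs s' 5 x = 0.
wpb_loop W_gt1 (size l0) 5 I1.
- by move=> x; rewrite drop0; apply: sdeg.
- move=> i s' il fr ri Ii; vcg W_gt1.
  rewrite /I1 => x; simp_state.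
  rewrite (sarc _ il).1 /upd; case: eqP => // xNi xi; apply: Ii.
  rewrite (drop_nth x0) ?size_map // inE negb_or xi andbT.
  by rewrite (nth_map (x0, x0)) //; apply/eqP => E; apply: xNi; rewrite E.
move=> s' fr; rewrite /I1 drop_oversize ?size_map // => deg0.
wpb_step 2 (45 * size l0 + 28).
vcg W_gt1.
wpb_step (45 * size l0 + 20) 8.
pose keep (q : V * V) := (q.1 \in A) && (q.2 \in A).
pose ll i := [seq q <- take i l0 | keep q].
(* The arcs are filtered in place: the write position [size (ll i)] never passes [i], so the arcs
   from [i] on are still the original ones. *)
pose I2 i s' := [/\ regs s' 13 = size (ll i),
     forall k, i <= k < size l0 -> arrs s' 0 k = (nth (x0, x0) l0 k).1 /\
                                  arrs s' 1 k = (nth (x0, x0) l0 k).2,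
     arcs_rep (arrs s' 0) (arrs s' 1) (ll i)
   & adj_rep (arrs s' 5) (arrs s' 6) (ll i)].
wpb_loop W_gt1 (size l0) 37 I2.
- by simp_state.
- rewrite /I2 /ll take0; simp_state; split=> // x.
  by split=> //; apply: deg0.
- move=> i s2 il fr2 ri [r13 rest arcs_ adjs].
  have lli : ll i.+1 = if keep (nth (x0, x0) l0 i) then rcons (ll i) (nth (x0, x0) l0 i) else ll i.
    by rewrite /ll (take_nth (x0, x0)) // filter_rcons.
  have szl : size (ll i) <= i.
    by rewrite /ll; apply: leq_trans (size_subseq (filter_subseq _ _)) _; rewrite size_take il.
  have [|ei1 ei2] := rest i; first by rewrite leqnn.
  have rest' k : i < k < size l0 -> arrs s2 0 k = (nth (x0, x0) l0 k).1 /\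
                                   arrs s2 1 k = (nth (x0, x0) l0 k).2.
    by move=> ?; apply: rest; lia.
  case nthE: (nth (x0, x0) l0 i) => [a b] in ei1 ei2 lli *.
  have ull : uniq (if keep (a, b) then rcons (ll i) (a, b) else ll i).
    by rewrite -lli filter_uniq ?take_uniq.
  have [da _] := adjs a.
  have nda : arrs s2 5 a <= n.
    by rewrite da; apply: size_uniq_ord (uniq_adjl a (filter_uniq keep (take_uniq i ul0))).
  have an : a * n + n <= n * n by apply: row_le.
  vcs W_gt1; rewrite ei1 ei2 /= !sdead; split_vc; try by lia.
  + by rewrite /I2 lli /keep /= (negbTE c); simp_state.
  + by rewrite /I2 lli /keep /= (negbTE c0) andbF; simp_state.
  + rewrite /I2 lli /keep /= c c0 in ull *; simp_state.
    split.
    * by rewrite size_rcons addn1.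
    * by move=> k ik; rewrite /upd; case: eqP => [|_]; [lia|apply: rest'].
    * exact: arcs_rep_rcons.
    * exact: adj_rep_rcons.
move=> s2 fr2; rewrite /I2 /ll take_size => -[r13 _ arcs_ adjs].
by vcg W_gt1.
Qed.
End Programs.

(** * Correctness of breadth-first search *)

Lemma index_eq (T : eqType) (s : seq T) x y :
  x \in s -> index x s = index y s -> x = y.
Proof.
move=> xs E; have ys : y \in s by rewrite -index_mem -E index_mem.
by rewrite -[LHS](nth_index x xs) E nth_index.
Qed.

Section BfsInvariant.
Variables (n : nat) (x0 : 'I_n) (l : seq ('I_n * 'I_n)) (v : 'I_n).
Local Notation V := 'I_n.
Implicit Types (q : seq V) (x y z : V) (h k i j : nat) (D P F : nat -> nat).

Let g : rel V := fun x y => (x, y) \in l.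
Let w x := size (adjl l x).

Lemma upd_ord (a : nat -> nat) (x y : V) (c : nat) :
  upd a x c y = if y == x then c else a y.
Proof. by []. Qed.

Definition scanned q h k : rel V := fun x y =>
  (index x q < h) || ((index x q == h) && (index y (adjl l x) < k)).

(** [P] and [D] hold parent and depth plus one, 0 standing for no parent and for unseen. Position
    [h] is being expanded and its first [k] neighbours are done. By [inv_mono] and [inv_near] the
    queue from [h] on spans at most two layers. [inv_depth] and [inv_weight] bound the stored words,
    against overflow. *)
Record bfs_inv q h k D P F : Prop := BfsInv {
  inv_uniq : uniq q;
  inv_root : [/\ index v q = 0, v \in q, P v = 0, D v = 1 & F v = w v];
  inv_disc : forall y, (0 < D y) = (y \in q);
  inv_par : forall y, y \in q -> y != v -> exists x,
    [/\ P y = x.+1, x \in q, g x y, D y = (D x).+1 & [/\ F y = F x + w y,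
        index x q <= h & index x q < index y q]];
  inv_nbr : forall x y, x \in q -> g x y -> scanned q h k x y ->
    [/\ y \in q, D y <= (D x).+1 & D y = (D x).+1 -> F y <= F x + w y];
  inv_mono : forall x y, y \in q -> index x q <= index y q -> D x <= D y;
  inv_near : forall x y, index x q = h -> x \in q -> y \in q -> D y <= (D x).+1;
  inv_depth : forall y, y \in q -> D y <= (index y q).+1;
  inv_weight : forall y, y \in q -> F y <= n * D y }.

Hypothesis l_uniq : uniq l.

Lemma w_le x : w x <= n.
Proof. exact: size_uniq_ord (uniq_adjl x l_uniq). Qed.

Lemma bfs_inv_init D P F : (forall y, D y = 0) ->
  bfs_inv [:: v] 0 0 (upd D v 1) (upd P v 0) (upd F v (w v)).
Proof.
move=> D0; split=> //; rewrite ?/upd ?eqxx //.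
- by rewrite inE /= eqxx.
- by move=> y; rewrite inE -val_eqE /=; case: eqP; rewrite ?D0.
- by move=> y; rewrite inE => /eqP-> /eqP.
- by move=> x y; rewrite !inE => /eqP-> _; rewrite /scanned /= eqxx.
- by move=> x y; rewrite !inE => /eqP-> _; rewrite eqxx; case: ifP; rewrite ?D0.
- by move=> x y _; rewrite !inE => /eqP-> /eqP->; rewrite eqxx.
- by move=> y; rewrite inE => /eqP->; rewrite eqxx.
- by move=> y; rewrite inE => /eqP->; rewrite eqxx muln1 w_le.
Qed.

Section Step.
Variables (q : seq V) (h k : nat) (D P F : nat -> nat) (x y : V).
Hypotheses (inv : bfs_inv q h k D P F) (xq : x \in q) (xh : index x q = h).
Hypotheses (kx : k < size (adjl l x)) (yE : y = nth x0 (adjl l x) k).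

Let gxy : g x y.
Proof. by rewrite /g -mem_adjl yE mem_nth. Qed.

Let scannedS z t : g z t -> scanned q h k.+1 z t ->
  scanned q h k z t \/ z = x /\ t = y.
Proof.
move=> gzt /orP[zh|/andP[zh tk]]; first by left; rewrite /scanned zh.
have zx : z = x.
  have zq : z \in q by rewrite -index_mem (eqP zh) -xh index_mem.
  by apply: (index_eq zq); rewrite (eqP zh).
move: tk; rewrite ltnS leq_eqVlt => /orP[/eqP tk|tk]; last first.
  by left; rewrite /scanned zh tk orbT.
right; split=> //; rewrite yE -tk zx nth_index // mem_adjl.
by rewrite zx in gzt.
Qed.

Lemma bfs_inv_new : D y = 0 ->
  bfs_inv (rcons q y) h k.+1 (upd D y (D x + 1)) (upd P y (x + 1))
    (upd F y (F x + w y)).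
Proof.
move=> Dy; case: (inv) => uq [iv vq Pv Dv Fv] disc par nbr mono near depth weight.
have yNq : y \notin q by rewrite -disc Dy.
have old z : z \in q -> (z == y) = false by move=> zq; apply: contraNF yNq => /eqP<-.
have idx z : z \in q -> index z (rcons q y) = index z q.
  by move=> zq; rewrite -cats1 index_cat zq.
have idy : index y (rcons q y) = size q.
  by rewrite -cats1 index_cat (negbTE yNq) /= eqxx addn0.
have idlt z : z \in q -> index z q < size q by rewrite index_mem.
have Dx : 0 < D x by rewrite disc.
split.
- by rewrite rcons_uniq yNq.
- by rewrite !upd_ord old // idx // mem_rcons inE vq orbT.
- by move=> z; rewrite upd_ord mem_rcons inE; case: eqP => //= _; rewrite addn1.
- move=> z; rewrite mem_rcons inE => /predU1P[-> _|zq zv].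
    exists x; rewrite !upd_ord eqxx old // mem_rcons inE xq orbT !addn1; split=> //.
    by rewrite idx // idy xh; split=> //; rewrite -xh idlt.
  have [z' [Pz z'q gz Dz [Fz z'h z'z]]] := par z zq zv; exists z'.
  by rewrite !upd_ord !old // mem_rcons inE z'q orbT !idx.
- move=> z t; rewrite mem_rcons inE => /predU1P[-> gyt|zq gzt].
    by rewrite /scanned idy; have := idlt _ xq; rewrite xh; lia.
  rewrite /scanned idx // -/(scanned q h k.+1 z t) => sc.
  have [{}sc|[-> ->]] := scannedS gzt sc.
    have [tq Dt Ft] := nbr z t zq gzt sc.
    by rewrite !upd_ord !old // mem_rcons inE tq orbT.
  by rewrite !upd_ord eqxx old // mem_rcons inE eqxx addn1; split.
- move=> z t; rewrite mem_rcons inE !upd_ord => /predU1P[-> _|tq zt].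
    rewrite eqxx; case: eqP => // zy; case: (boolP (z \in q)) => [zq|].
      by rewrite addn1; apply: near.
    by rewrite -disc; case: (D z).
  rewrite (old t) //; case: (z =P y) zt => [->|_]; first by rewrite idy idx //; have := idlt _ tq; lia.
  have [zq|zNq] := boolP (z \in q); first by rewrite !idx //; apply: mono.
  by move: zNq; rewrite -disc -leqNgt leqn0 => /eqP->.
- move=> z t zh; rewrite mem_rcons inE => /predU1P[zy|zq].
    by move: zh (idlt _ xq); rewrite zy idy xh => ->; rewrite ltnn.
  rewrite idx // in zh; rewrite !upd_ord (old z) // mem_rcons inE.
  have -> : z = x by apply: (index_eq zq); rewrite zh.
  by case: (t =P y) => [_ _|_ /= tq]; [rewrite addn1|apply: near].
- move=> z; rewrite mem_rcons inE upd_ord => /predU1P[->|zq].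
    by rewrite eqxx idy; have := depth _ xq; have := idlt _ xq; lia.
  by rewrite old // idx //; apply: depth.
- move=> z; rewrite mem_rcons inE !upd_ord => /predU1P[->|zq].
    by rewrite eqxx mulnDr muln1 leq_add ?weight ?w_le.
  by rewrite old //; apply: weight.
Qed.

Lemma bfs_inv_old : 0 < D y -> ~~ ((D y == D x + 1) && (F x + w y < F y)) ->
  bfs_inv q h k.+1 D P F.
Proof.
move=> Dy nob; case: (inv) => uq rt disc par nbr mono near depth weight.
split=> // z t zq gzt sc; have [{}sc|[-> ->]] := scannedS gzt sc; first exact: nbr.
have yq : y \in q by rewrite -disc.
by have := near _ _ xh xq yq; split=> //; lia.
Qed.

(** The improved vertex is one layer beyond the vertex being expanded, so by [inv_mono] it sits
    after position [h]. No scanned arc leaves it and it is not yet a parent, hence lowering its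
    value breaks none of the conditions already established. *)
Lemma bfs_inv_better : D y = D x + 1 -> F x + w y < F y ->
  bfs_inv q h k.+1 D (upd P y (x + 1)) (upd F y (F x + w y)).
Proof.
move=> Dy Fy; case: (inv) => uq [iv vq Pv Dv Fv] disc par nbr mono near depth weight.
have yq : y \in q by rewrite -disc Dy addn1.
have late z : index z q <= h -> (z == y) = false.
  by rewrite -xh => zx; apply/eqP => E; have := mono _ _ xq zx; rewrite E Dy; lia.
have xy : (x == y) = false by rewrite late ?xh.
split=> //.
- by rewrite !upd_ord late ?iv.
- move=> z zq zv; rewrite !upd_ord; case: eqP => [->|_].
    exists x; rewrite upd_ord addn1 xy; split=> //; first by rewrite Dy addn1.
    split; rewrite ?xh //.
    by rewrite -xh ltnNge; apply: contraFN xy => xy'; apply: contraTT (mono _ _ xq xy'); rewrite Dy; lia.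
  have [z' [Pz z'q gz Dz [Fz z'h z'z]]] := par z zq zv; exists z'.
  by rewrite upd_ord late.
- move=> z t zq gzt sc.
  have zh : index z q <= h by move: sc; rewrite /scanned; lia.
  rewrite !upd_ord (late z) //; have [{}sc|[-> ->]] := scannedS gzt sc.
    have [tq Dt Ft] := nbr z t zq gzt sc; split=> //.
    by case: eqP => [ty|//]; subst t => /Ft; lia.
  by rewrite eqxx; split=> //; lia.
- move=> z zq; rewrite upd_ord; case: eqP => [->|_]; last exact: weight.
  by apply: leq_trans (weight _ yq); lia.
Qed.

End Step.

Lemma bfs_inv_next q h D P F x : x \in q -> index x q = h ->
  bfs_inv q h (size (adjl l x)) D P F -> bfs_inv q h.+1 0 D P F.
Proof.
move=> xq xh [uq rt disc par nbr mono near depth weight]; split=> //.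
- move=> y yq yv; have [z [Py zq gzy Dy [Fy zh zy]]] := par y yq yv.
  by exists z; split=> //; split=> //; lia.
- move=> z t zq gzt; rewrite /scanned ltn0 andbF orbF ltnS leq_eqVlt => zh.
  apply: nbr => //; rewrite /scanned; case/orP: zh => [zh|->//].
  have -> : x = z by apply: (index_eq xq); rewrite (eqP zh).
  by rewrite zh index_mem mem_adjl [_ \in l]gzt orbT.
- move=> z t zh zq tq; apply: leq_trans (near _ _ xh xq tq) _.
  by rewrite ltnS; apply: mono; rewrite ?xh ?zh.
Qed.

Definition tree_of (P : nat -> nat) q : ptree V :=
  [ffun y => if (y \in q) && (0 < P y) then Some (insubd x0 (P y).-1) else None].

(** With [h] at the end of the queue, every arc leaving a queued vertex counts as scanned, so
    [inv_nbr] applies to all of them. *)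
Lemma bfs_inv_cert q k D P F : bfs_inv q (size q) k D P F ->
  bfs_cert g w v q (tree_of P q) (fun y => (D y).-1) F.
Proof.
case=> uq [iv vq Pv Dv Fv] disc par nbr mono near depth weight.
split=> //.
- by split=> //; rewrite ?Dv // ffunE Pv ltnn andbF.
- by move=> y /negbTE yq; rewrite ffunE yq.
- move=> y yq yv; have [x [Py xq gxy Dy [Fy _ xy]]] := par y yq yv.
  exists x; split=> //; last first.
    by rewrite Dy /= prednK // disc.
  by rewrite ffunE yq Py /= valKd.
- move=> x y xq gxy; have [|yq Dy Fy] := nbr x y xq gxy.
    by rewrite /scanned index_mem xq.
  have Dx : 0 < D x by rewrite disc.
  split=> //; first by lia.
  have Dy0 : 0 < D y by rewrite disc.
  by move=> E; apply: Fy; lia.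
Qed.

Lemma tree_ofE q k D P F y : bfs_inv q (size q) k D P F -> y \in q ->
  P y = if tree_of P q y is Some x then x.+1 else 0.
Proof.
case=> _ [_ _ Pv _ _] _ par _ _ _ _ _ yq; rewrite ffunE yq /=.
have [->|yv] := eqVneq y v; first by rewrite Pv.
by have [x [-> _ _ _ _]] := par y yq yv; rewrite /= valKd.
Qed.

End BfsInvariant.

(** * Programs that scan the arcs and search the graph *)

Definition scanmax (a : nat) : prog :=
  Set_ 8 (Const 0) ;; Set_ 9 (Const 0) ;;
  For 10 1 (
    Set_ 11 (Get 0 (Reg 10)) ;;
    If (Reg 8 <e Get a (Reg 11))
       (Set_ 8 (Get a (Reg 11)) ;; Set_ 9 (Reg 11)) Skip).

Definition scan_nbr : prog :=
  Set_ 19 (Get 6 (Reg 17 +e Reg 18)) ;;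
  If (Get 7 (Reg 19) =e Const 0)
    (Put 7 (Reg 19) (Get 7 (Reg 16) +e Const 1) ;;
     Put 8 (Reg 19) (Reg 16 +e Const 1) ;;
     Put 9 (Reg 19) (Get 9 (Reg 16) +e Get 5 (Reg 19)) ;;
     Put 10 (Reg 15) (Reg 19) ;;
     Set_ 15 (Reg 15 +e Const 1))
    (If (Get 7 (Reg 19) =e Get 7 (Reg 16) +e Const 1)
       (If (Get 9 (Reg 16) +e Get 5 (Reg 19) <e Get 9 (Reg 19))
          (Put 8 (Reg 19) (Reg 16 +e Const 1) ;;
           Put 9 (Reg 19) (Get 9 (Reg 16) +e Get 5 (Reg 19))) Skip) Skip).

Definition bfs : prog :=
  (Put 7 (Reg 9) (Const 1) ;; Put 8 (Reg 9) (Const 0) ;;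
   Put 9 (Reg 9) (Get 5 (Reg 9)) ;; Put 10 (Const 0) (Reg 9) ;;
   Set_ 14 (Const 0) ;; Set_ 15 (Const 1)) ;;
  While (Reg 14 <e Reg 15)
    ((Set_ 16 (Get 10 (Reg 14)) ;; Set_ 17 (Reg 16 *e Reg 0) ;;
      Set_ 20 (Get 5 (Reg 16))) ;;
     For 18 20 scan_nbr ;;
     Set_ 14 (Reg 14 +e Const 1)).

(** The pass over the queue also clears the depth of every vertex seen, so that the next search
    finds array 7 at zero without a pass over all vertices. *)
Definition tree_out : prog :=
  For 18 15 (
    Set_ 19 (Get 10 (Reg 18)) ;; Put 7 (Reg 19) (Const 0) ;;
    If (Get 8 (Reg 19)) (emit (Get 8 (Reg 19) -e Const 1) (Reg 19)) Skip).

Definition light_out : prog :=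
  For 10 1 (
    Set_ 11 (Get 0 (Reg 10)) ;;
    If (Get 5 (Reg 11) <e Reg 3) (emit (Reg 11) (Get 1 (Reg 10))) Skip).

Section Traversals.
Variables (n W : nat) (x0 : 'I_n).
Hypotheses (n_gt1 : 1 < n) (W_big : 16 * (n * n * n) <= W).
Local Notation V := 'I_n.
Implicit Types (x y v : V) (q : seq V) (o : seq (V * V)).
Local Notation wpb := (wpb W).
Local Notation holds := (holds x0).
Local Notation arcs_rep := (arcs_rep x0).
Local Notation adj_rep := (adj_rep x0).
Let W1 := W_gt1 n_gt1 W_big.
Let ss := sizes n_gt1 W_big.

Variable l : seq (V * V).
Hypotheses (l_uniq : uniq l) (l_sym : forall x y, ((x, y) \in l) = ((y, x) \in l)).

Definition gstate (s : state) : Prop :=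
  [/\ regs s 0 = n, regs s 1 = size l, arcs_rep (arrs s 0) (arrs s 1) l
    & adj_rep (arrs s 5) (arrs s 6) l].

Lemma gstate_frame p s s' : frame p s s' ->
  ~~ has (mem [:: 0; 1]) (wregs p) && ~~ has (mem [:: 0; 1; 5; 6]) (warrs p) ->
  gstate s -> gstate s'.
Proof.
move=> [fr fa] /andP[/hasPn rp /hasPn ap] [s0 s1 sa sd].
have r k : k \in [:: 0; 1] -> regs s' k = regs s k.
  by move=> k01; apply: fr; apply: contraL k01 => /rp.
have a k : k \in [:: 0; 1; 5; 6] -> arrs s' k = arrs s k.
  by move=> k01; apply: fa; apply: contraL k01 => /ap.
by split; rewrite ?r ?a.
Qed.

Let g : rel V := fun x y => (x, y) \in l.
Let w x := size (adjl l x).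

Let lW : size l < W.
Proof. by have [] := ss; have := size_uniq_pairs l_uniq; lia. Qed.

Lemma arc_at s i : gstate s -> i < size l -> exists x y,
  [/\ (x, y) \in l, nth (x0, x0) l i = (x, y), arrs s 0 i = x & arrs s 1 i = y].
Proof.
move=> [_ _ sa _] il; have [a0 a1] := sa i il.
case E: (nth (x0, x0) l i) a0 a1 => [x y] /= a0 a1; exists x, y; split=> //.
by rewrite -E mem_nth.
Qed.

(** The maximum is taken over sources of arcs, in time independent of [n]. A final 0 in register 8
    signals that no source has a positive entry; register 9 then names nothing. *)
Lemma scanmax_ok a s : gstate s ->
  wpb (scanmax a) s (30 * size l + 30) (fun s' =>
    (forall x, x \in unzip1 l -> arrs s a x <= regs s' 8) /\
    (0 < regs s' 8 -> exists x,
      [/\ x \in unzip1 l, regs s' 9 = x & regs s' 8 = arrs s a x])).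
Proof.
move=> gs; have [s0 s1 sa _] := gs; rewrite /scanmax.
wpb_step 2 (30 * size l + 26).
vcg W1.
wpb_step 2 (30 * size l + 24).
vcg W1.
pose I i s' := (forall x, x \in take i (unzip1 l) -> arrs s a x <= regs s' 8) /\
    (0 < regs s' 8 -> exists x,
      [/\ x \in unzip1 l, regs s' 9 = x & regs s' 8 = arrs s a x]).
wpb_loop W1 (size l) 22 I.
- by rewrite /I take0; split=> //; simp_state.
- move=> i s' il fr ri [max8 max9].
  have [x [y [xyl nxy ax ay]]] := arc_at gs il.
  have ux : x \in unzip1 l by apply/mapP; exists (x, y).
  have tk z : z \in take i.+1 (unzip1 l) -> z \in take i (unzip1 l) \/ z = x.
    rewrite (take_nth x0) ?size_map // mem_rcons inE (nth_map (x0, x0)) // nxy /=.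
    by case/predU1P; [right|left].
  vcs W1; rewrite ax; split_vc.
    rewrite /I; simp_state; split=> [z /tk[/max8|->//]|_]; first by lia.
    by exists x; split.
  rewrite /I; simp_state; split=> // z /tk[/max8//|->].
  by rewrite leqNgt.
- by move=> s' fr; rewrite /I take_oversize ?size_map.
Qed.

Definition outrep s o : Prop := regs s 7 = size o /\ arcs_rep (arrs s 2) (arrs s 3) o.

Lemma outrep_rcons r a b o x y : r = size o -> arcs_rep a b o ->
  r + 1 = size (rcons o (x, y)) /\
  arcs_rep (upd a r (x : nat)) (upd b r (y : nat)) (rcons o (x, y)).
Proof.
by move=> -> ab; split; [rewrite size_rcons addn1|apply: arcs_rep_rcons].
Qed.

Lemma light_ok s o : gstate s -> outrep s o -> size o + size l < W ->
  wpb light_out s (40 * size l + 10) (fun s' =>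
    outrep s' (o ++ [seq q <- l | size (adjl l q.1) < regs s 3])).
Proof.
move=> gs [s7 so] oW; have [s0 s1 sa sd] := gs; rewrite /light_out.
pose ll i := o ++ [seq q <- take i l | size (adjl l q.1) < regs s 3].
wpb_loop W1 (size l) 32 (fun i s' => outrep s' (ll i)).
- by rewrite /outrep /ll take0 cats0; simp_state.
- move=> i s' il fr ri [s'7 s'o].
  have [x [y [xyl nxy ax ay]]] := arc_at gs il.
  have [dx _] := sd x.
  have szl : size (ll i) <= size o + i.
    by rewrite size_cat leq_add2l; apply: leq_trans (size_subseq (filter_subseq _ _)) _; rewrite size_take il.
  have lli : ll i.+1 = if size (adjl l x) < regs s 3 then rcons (ll i) (x, y) else ll i.
    by rewrite /ll (take_nth (x0, x0)) // filter_rcons nxy /=; case: ifP; rewrite ?rcons_cat.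
  vcs W1; rewrite ax ay dx; split_vc; try by lia.
    by rewrite lli c /outrep; simp_state; apply: outrep_rcons.
  by rewrite lli (negbTE c) /outrep; simp_state.
- by move=> s' fr; rewrite /ll take_size.
Qed.

(** A vertex other than the root has its parent as a neighbour. Positive degrees make the queue no
    longer than the arc list, which turns costs per queue entry into costs per arc. *)
Lemma cert_pos v q p d f : bfs_cert g w v q p d f -> 0 < w v ->
  forall y, y \in q -> 0 < w y.
Proof.
move=> cert wv y yq; have [->//|yv] := eqVneq y v.
have [x [_ _ gxy _ _]] := cert_par cert yq yv.
have : x \in adjl l y by rewrite mem_adjl -l_sym.
by rewrite /w; case: (adjl l y).
Qed.

Lemma size_le_sum q : uniq q -> (forall y, y \in q -> 0 < w y) -> size q <= size l.
Proof.
move=> uq pos; rewrite -sum_size_adjl (bigID (mem q)) /= -big_uniq //=.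
apply: leq_trans (leq_addr _ _); rewrite -sum1_size big_seq [leqRHS]big_seq.
exact: leq_sum.
Qed.

Record bfs_result s v q p d : Prop := BfsResult {
  res_cert : bfs_cert g w v q p d (arrs s 9);
  res_queue : holds (arrs s 10) q;
  res_tail : regs s 15 = size q;
  res_seen : forall y, y \notin q -> arrs s 7 y = 0;
  res_par : forall y, y \in q -> arrs s 8 y = if p y is Some x then x.+1 else 0;
  res_size : size q <= size l;
  res_weight : forall y, y \in q -> arrs s 9 y <= n * n }.

Lemma bfs_ok s v : gstate s -> (forall y, arrs s 7 y = 0) -> regs s 9 = v ->
  0 < w v ->
  wpb bfs s (130 * size l + 40) (fun s' => exists q p d, bfs_result s' v q p d).
Proof.
move=> gs D0 s9 wv; have [s0 s1 sa sd] := gs; rewrite /bfs.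
have [n1 n2 n3] := ss.
wpb_step 20 (130 * size l + 20).
have [dv _] := sd v.
vcs W1; rewrite dv; split_vc.
set s1' := State _ _.
have gs1 : gstate s1' by rewrite /gstate /s1'; upds.
(* A vertex pays 130 times its degree when it is dequeued. The degree is at least 1, so this covers
   the fixed cost of the expansion as well. *)
pose left_ q h := \sum_(x | x \notin take h q) w x.
pose I phi s' := exists q h, [/\ phi = 130 * left_ q h + 10, regs s' 14 = h,
  regs s' 15 = size q, h <= size q
  & [/\ holds (arrs s' 10) q & bfs_inv l v q h 0 (arrs s' 7) (arrs s' 8) (arrs s' 9)]].
apply: (@wpb_while _ W1 _ _ _ (130 * left_ [:: v] 0 + 10) _ I) => //.
- move=> phi s' fr [q [h [-> r14 r15 hq [hold inv]]]].
  have {}gs := gstate_frame fr isT gs1; have [s'0 s'1 s'a s'd] := gs; clear fr.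
  move=> /= tr; rewrite r14 r15 in tr.
  pose x := nth x0 q h; have xq : x \in q by rewrite mem_nth.
  have uq := inv_uniq inv.
  have xh : index x q = h by rewrite index_uniq.
  have qn : size q <= n by apply: size_uniq_ord.
  have [dx _] := s'd x.
  have wx : 0 < w x.
    have [->//|xv] := eqVneq x v.
    have [z [_ _ zx _ _]] := inv_par inv xq xv.
    have : z \in adjl l x by rewrite mem_adjl -l_sym.
    by rewrite /w; case: (adjl l x).
  have lE : left_ q h = w x + left_ q h.+1.
    rewrite /left_ (bigD1 x) /=; last first.
      by apply/negP => /index_ltn; rewrite xh ltnn.
    congr (_ + _); apply: eq_bigl => y; rewrite (take_nth x0) // mem_rcons inE negb_or.
    by rewrite andbC.
  have xlt := ltn_ord x; have xn := row_le n xlt.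
  have wn : w x <= n by apply: size_uniq_ord; apply: uniq_adjl.
  exists (10 + ((60 * w x + 8) + 4)); apply: (@wpb_seq _ _ _ _ 10) => //.
  vcs W1; rewrite (hold h) // -/x dx; split_vc; try by lia.
  set s2 := State _ _.
  have gs2 : gstate s2 by rewrite /gstate /s2; upds.
  apply: (@wpb_seq _ _ _ _ (60 * w x + 8) 4) => //.
  (* Whatever is appended, the queue up to the vertex being expanded stays fixed, and the potential
     after this expansion depends on that prefix only. *)
  pose K k s3 := exists q', [/\ regs s3 15 = size q', x \in q', index x q' = h,
     holds (arrs s3 10) q'
   & bfs_inv l v q' h k (arrs s3 7) (arrs s3 8) (arrs s3 9) /\
     take h.+1 q' = take h.+1 q].
  wpb_loop W1 (w x) 52 K.
  + by exists q; rewrite /s2; upds; split.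
  + move=> k s3 kx fr3 ri [q' [r15' xq' xh' hold' [inv' tq]]].
    have {}gs3 := gstate_frame fr3 isT gs2; have [s30 s31 s3a s3d] := gs3.
    have r16 : regs s3 16 = x by rewrite (proj1 fr3 16 isT) /s2; upds.
    have r17 : regs s3 17 = x * n by rewrite (proj1 fr3 17 isT) /s2; upds.
    pose y := nth x0 (adjl l x) k.
    have ay : arrs s3 6 (x * n + k) = y by have [_ ->] := s3d x.
    have [dy _] := s3d y.
    have wy : size (adjl l y) <= n by apply: size_uniq_ord; apply: uniq_adjl.
    have uq' := inv_uniq inv'; have qn' := size_uniq_ord uq'.
    have Dx : arrs s3 7 x <= n.
      by apply: leq_trans (inv_depth inv' xq') _; rewrite -index_mem in xq'; lia.
    have Fx : arrs s3 9 x <= n * n.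
      by apply: leq_trans (inv_weight inv' xq') _; rewrite leq_mul2l Dx orbT.
    clear fr3; rewrite /scan_nbr; vcs W1; rewrite ay dy; split_vc; try by lia.
    * exists (rcons q' y); simp_state; rewrite size_rcons addn1; split=> //.
      - by rewrite mem_rcons inE xq' orbT.
      - by rewrite -cats1 index_cat xq'.
      - exact: holds_rcons.
      - split; last first.
          by rewrite -tq -cats1 takel_cat // -xh' index_mem.
        by apply: (bfs_inv_new l_uniq inv' xq' xh' kx (erefl y)); apply/eqP.
    * exists q'; simp_state; split=> //; split=> //.
      by apply: (bfs_inv_better l_uniq inv' xq' xh' kx (erefl y)) => //; apply/eqP.
    * exists q'; simp_state; split=> //; split=> //.
      by apply: (bfs_inv_old l_uniq inv' xq' xh' kx (erefl y)); rewrite ?lt0n // negb_and c1 orbT.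
    * exists q'; simp_state; split=> //; split=> //.
      by apply: (bfs_inv_old l_uniq inv' xq' xh' kx (erefl y)); rewrite ?lt0n // negb_and c0.
  + move=> s3 fr3 [q' [r15' xq' xh' hold' [inv' tq]]].
    have r14' : regs s3 14 = h by rewrite (proj1 fr3 14 isT) /s2; upds.
    clear fr3; vcg W1; first by lia.
    have hq' : h.+1 <= size q' by rewrite -xh' index_mem.
    exists (130 * left_ q h.+1 + 10); split.
      by rewrite lE /=; lia.
    exists q', h.+1; simp_state; split=> //; rewrite ?addn1 //.
      by rewrite /left_ tq.
    by split=> //; apply: (bfs_inv_next l_uniq xq' xh' inv').
- move=> phi s' fr [q [h [-> r14 r15 hq [hold inv]]]].
  have {}gs := gstate_frame fr isT gs1; have [s'0 s'1 s'a s'd] := gs; clear fr.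
  rewrite /= r14 r15 -leqNgt => qh; split; first by lia.
  have hE : h = size q by lia.
  rewrite hE in inv.
  have cert := bfs_inv_cert x0 l_uniq inv.
  exists q, (tree_of x0 (arrs s' 8) q), (fun y => (arrs s' 7 y).-1).
  split=> //.
  + move=> y yq; apply/eqP; rewrite -leqn0 leqNgt.
    by rewrite (inv_disc inv).
  + by move=> y; apply: (tree_ofE x0 inv).
  + exact: size_le_sum (inv_uniq inv) (cert_pos cert wv).
  + move=> y yq; apply: leq_trans (inv_weight inv yq) _; rewrite leq_mul2l.
    apply/orP; right; apply: leq_trans (inv_depth inv yq) _.
    by apply: leq_trans (size_uniq_ord (inv_uniq inv)); rewrite index_mem.
- exists [:: v], 0; rewrite /s1'; upds; split=> //; split=> //.
    by case=> //= _; rewrite /upd eqxx.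
  exact: (bfs_inv_init v l_uniq).
- rewrite /left_ -sum_size_adjl /= (eq_bigl predT) //; lia.
Qed.
End Traversals.

(** * Arc lists of induced subgraphs and their edge sets *)

Definition arcs_of n E (A : {set 'I_n}) (l : seq ('I_n * 'I_n)) : Prop :=
  uniq l /\ forall x y, ((x, y) \in l) = adj E A x y.

Section ArcsOf.
Variables (n : nat) (E : {set {set 'I_n}}) (A : {set 'I_n}) (l : seq ('I_n * 'I_n)).
Hypothesis lE : arcs_of E A l.

Lemma arcs_sym x y : ((x, y) \in l) = ((y, x) \in l).
Proof. by rewrite !lE.2 /adj /= setUC andbCA. Qed.

Lemma arcs_degE x : size (adjl l x) = deg E A x.
Proof.
rewrite /deg -(card_uniqP (uniq_adjl x lE.1)); apply: eq_card => y.
by rewrite inE mem_adjl lE.2.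
Qed.

(** Functional extensionality makes the arc list and the relation of the construction
    interchangeable under rewriting, so that certificates carry over. *)
Lemma arcs_relE : (fun x y => (x, y) \in l) = adj E A :> rel 'I_n.
Proof.
by apply: boolp.funext => x; apply: boolp.funext => y; rewrite lE.2.
Qed.

Lemma arcs_weightE : (fun x => size (adjl l x)) = deg E A :> ('I_n -> nat).
Proof. by apply: boolp.funext => x; rewrite arcs_degE. Qed.

Lemma arcs_of_filter (A' : {set 'I_n}) : A' \subset A ->
  arcs_of E A' [seq q <- l | (q.1 \in A') && (q.2 \in A')].
Proof.
move=> /subsetP A'A; split=> [|x y]; first by rewrite filter_uniq ?lE.1.
rewrite mem_filter lE.2 /adj /=.
by case: (boolP (x \in A')) => //= /A'A ->; case: (boolP (y \in A')) => //= /A'A ->.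
Qed.

Lemma arcs_mem_src x : (x \in unzip1 l) = (0 < deg E A x).
Proof.
rewrite -arcs_degE; apply/mapP/idP => [[[a b] ab ->]|].
  by have : b \in adjl l a by [rewrite mem_adjl]; case: (adjl l a).
case xl: (adjl l x) => [|y s] // _; exists (x, y) => //.
by rewrite -mem_adjl xl mem_head.
Qed.

End ArcsOf.

Definition tree_list n (p : ptree 'I_n) (q : seq 'I_n) : seq ('I_n * 'I_n) :=
  pmap (fun y => if p y is Some x then Some (x, y) else None) q.

Lemma mem_edge_set n (o : seq ('I_n * 'I_n)) B :
  (B \in edge_set o) = (B \in [seq [set q.1; q.2] | q <- o]).
Proof. by rewrite inE. Qed.

Lemma edge_set_nil n : edge_set [::] = set0 :> {set {set 'I_n}}.
Proof. by apply/setP => B; rewrite !inE. Qed.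

Lemma edge_set_cat n (o1 o2 : seq ('I_n * 'I_n)) :
  edge_set (o1 ++ o2) = edge_set o1 :|: edge_set o2.
Proof. by apply/setP => B; rewrite in_setU !mem_edge_set map_cat mem_cat. Qed.

Lemma mem_tree_list n (p : ptree 'I_n) q x y :
  ((x, y) \in tree_list p q) = (y \in q) && (p y == Some x).
Proof.
rewrite mem_pmap; apply/mapP/andP => [[z zq]|[yq /eqP py]].
  by case pz: (p z) => [t|//] [-> ->]; rewrite pz.
by exists y; rewrite ?py.
Qed.

Lemma edge_set_tree_list n (p : ptree 'I_n) (q : seq 'I_n) :
  (forall y, y \notin q -> p y = None) -> edge_set (tree_list p q) = tree_edges p.
Proof.
move=> out; apply/setP => B; rewrite mem_edge_set inE; apply/mapP/existsP.
  move=> [[x y]]; rewrite mem_tree_list => /andP[_ pyx] ->.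
  by exists x; apply/existsP; exists y; rewrite /child /= pyx eqxx.
move=> [x /existsP[y /andP[pyx /eqP->]]]; exists (x, y) => //.
by rewrite mem_tree_list [_ == _]pyx andbT; apply: contraTT pyx => /out; rewrite /child /= => ->.
Qed.

Lemma size_tree_list n (p : ptree 'I_n) q : size (tree_list p q) <= size q.
Proof. by rewrite size_pmap count_size. Qed.

Lemma outrep_frame n (x0 : 'I_n) o p s s' : frame p s s' ->
  (7 \notin wregs p) && (2 \notin warrs p) && (3 \notin warrs p) ->
  outrep x0 s o -> outrep x0 s' o.
Proof. by move=> [fr fa] /andP[/andP[r7 a2] a3]; rewrite /outrep fr // !fa. Qed.

(** * Peeling off the vertices of large degree *)

Definition refresh : prog := build ;; scanmax 5.

Definition kill : prog :=
  (Put 4 (Reg 9) (Const 1) ;; Set_ 17 (Reg 9 *e Reg 0) ;;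
   Set_ 20 (Get 5 (Reg 9))) ;;
  For 18 20 (Put 4 (Get 6 (Reg 17 +e Reg 18)) (Const 1)).

(** The machine compares strictly, so the successor in the loop test expresses that the largest
    degree reaches the threshold. *)
Definition peel_prog : prog :=
  refresh ;;
  While (Reg 2 <e Reg 8 +e Const 1) (bfs ;; tree_out ;; kill ;; refresh).

Section Peeling.
Variables (n W : nat) (x0 : 'I_n).
Hypotheses (n_gt1 : 1 < n) (W_big : 16 * (n * n * n) <= W).
Local Notation V := 'I_n.
Implicit Types (x y v : V) (q : seq V) (o l : seq (V * V)) (A : {set V}).
Local Notation wpb := (wpb W).
Local Notation gstate := (gstate x0).
Local Notation outrep := (outrep x0).
Local Notation bfs_result := (bfs_result x0).
Let W1 := W_gt1 n_gt1 W_big.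
Let ss := sizes n_gt1 W_big.

Lemma tree_out_ok l s v q p d o : bfs_result l s v q p d ->
  outrep s o -> size o + n < W ->
  wpb tree_out s (50 * size l + 10) (fun s' =>
    (forall y, arrs s' 7 y = 0) /\ outrep s' (o ++ tree_list p q)).
Proof.
move=> res [s7 so] oW; rewrite /tree_out.
have qn := size_uniq_ord (cert_uniq (res_cert res)).
pose ll i := o ++ tree_list p (take i q).
pose I i s' := (forall y, y \notin drop i q -> arrs s' 7 y = 0) /\ outrep s' (ll i).
wpb_loop W1 (size q) 40 I.
- exact: res_tail res.
- rewrite /I /outrep /ll take0 cats0 drop0; simp_state; split=> //.
  exact: res_seen res.
- move=> i s' iq fr ri [s'D [s'7 s'o]].
  pose y := nth x0 q i; have yq : y \in q by rewrite mem_nth.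
  have ay : arrs s 10 i = y by apply: (res_queue res).
  have py := res_par res yq.
  have szl : size (ll i) <= size o + i.
    rewrite size_cat leq_add2l; apply: leq_trans (size_tree_list _ _) _.
    by rewrite size_take iq.
  have lli : ll i.+1 = ll i ++ (if p y is Some x then [:: (x, y)] else [::]).
    rewrite /ll (take_nth x0) // -cats1 /tree_list pmap_cat /= -/y catA.
    by case: (p y).
  have s'D' z : z \notin drop i.+1 q -> upd (arrs s' 7) y 0 z = 0.
    rewrite upd_ord => zi; case: eqP => // /eqP zy; apply: s'D.
    by rewrite (drop_nth x0) // inE negb_or zy.
  have yn := ltn_ord y.
  case pyE: (p y) py lli => [x|] py lli.
    have xn := ltn_ord x.
    vcs W1; rewrite ay py; split_vc => //; try by have [] := ss; lia.
    rewrite subn1 /= /I lli cats1 /outrep; simp_state; split=> //.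
    exact: outrep_rcons.
  vcs W1; rewrite ay py; split_vc => //.
  by rewrite /I lli cats0 /outrep; simp_state.
- by have := res_size res; lia.
- by move=> s' fr; rewrite /I /ll take_size drop_size => -[D0 oo]; split=> // y; apply: D0.
Qed.

Lemma kill_ok l s v A : gstate l s -> uniq l -> regs s 9 = v ->
  (forall x, arrs s 4 x = (x \notin A)) ->
  wpb kill s (20 * size (adjl l v) + 20) (fun s' =>
    forall x, arrs s' 4 x = (x \notin A :\: [set z | (z == v) || (z \in adjl l v)])).
Proof.
move=> gs lu s9 dead; have [s0 s1 sa sd] := gs; have [dv av] := sd v.
have vn := ltn_ord v; have vr := row_le n vn; have [n1 n2 n3] := ss.
have dvn : size (adjl l v) <= n by apply: size_uniq_ord (uniq_adjl v lu).
rewrite /kill; wpb_step 12 (20 * size (adjl l v) + 8).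
vcs W1; rewrite dv; split_vc; try by lia.
set s2 := State _ _.
pose I i s' := forall x,
  arrs s' 4 x = (x \notin A :\: [set z | (z == v) || (z \in take i (adjl l v))]).
wpb_loop W1 (size (adjl l v)) 6 I.
- rewrite /I take0 /s2; upds => x; rewrite upd_ord dead !inE orbF negb_and negbK.
  by case: eqP.
- move=> i s' il fr ri Ii.
  pose y := nth x0 (adjl l v) i.
  have r17 : regs s' 17 = v * n by rewrite (proj1 fr 17 isT) /s2; upds.
  have ay : arrs s' 6 (v * n + i) = y by rewrite (proj2 fr 6 isT) /s2; upds; apply: av.
  clear fr; vcs W1; rewrite ay; split_vc; try by lia.
  rewrite /I; simp_state => x; rewrite upd_ord Ii (take_nth x0) // !inE mem_rcons inE -/y.
  by rewrite !negb_and !negbK; case: (x =P y) => //=; rewrite orbT.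
- by move=> s' fr; rewrite /I take_size.
Qed.

Definition scan_facts l s : Prop :=
  (forall x, size (adjl l x) <= regs s 8) /\
  (0 < regs s 8 -> exists x, regs s 9 = x /\ regs s 8 = size (adjl l x)).

Lemma refresh_ok E A A' l s : regs s 0 = n -> regs s 1 = size l ->
  arcs_rep x0 (arrs s 0) (arrs s 1) l ->
  (forall x, x \notin unzip1 l -> arrs s 5 x = 0) ->
  arcs_of E A l -> A' \subset A ->
  (forall x, arrs s 4 x = (x \notin A')) ->
  wpb refresh s (90 * size l + 90) (fun s' => exists l',
    [/\ gstate l' s', arcs_of E A' l', size l' <= size l & scan_facts l' s']).
Proof.
move=> s0 s1 sa sd lE A'A dead; rewrite /refresh.
set l' := [seq q <- l | (q.1 \in A') && (q.2 \in A')].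
have l'E : arcs_of E A' l' by apply: arcs_of_filter lE _ A'A.
have l'l : size l' <= size l by apply: size_subseq (filter_subseq _ _).
wpb_step (60 * size l + 60) (30 * size l + 30).
apply: (wpb_conseq (build_ok n_gt1 W_big lE.1 s0 s1 sa dead sd)) => //.
move=> s2 fr [r1 a01 a56].
have gs2 : gstate l' s2 by split=> //; rewrite (proj1 fr 0 isT).
apply: (wpb_conseq (scanmax_ok n_gt1 W_big l'E.1 5 gs2)); first by rewrite leq_add2r leq_mul2l.
move=> s3 fr3 [max8 max9]; have gs3 : gstate l' s3 by apply: gstate_frame fr3 isT gs2.
have [_ _ _ sd2] := gs2.
exists l'; split=> //; split=> [x|/max9[x [_ r9 r8]]]; last first.
  by exists x; rewrite r8; have [-> _] := sd2 x.
have [/max8|/adjl_nil-> //] := boolP (x \in unzip1 l').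
by have [-> _] := sd2 x.
Qed.

Lemma peel_ok (R : realType) E l0 s : arcs_of E [set: V] l0 ->
  regs s 0 = n -> regs s 1 = size l0 -> arcs_rep x0 (arrs s 0) (arrs s 1) l0 ->
  (forall x, arrs s 4 x = 0) -> (forall x, arrs s 5 x = 0) ->
  (forall x, arrs s 7 x = 0) -> outrep s [::] -> 0 < regs s 2 ->
  (forall d, (t_big R n <= d%:R)%R = (regs s 2 <= d)) ->
  wpb peel_prog s
    (minn (n %/ regs s 2 * (500 * size l0)) (500 * (n * n)) + 90 * size l0 + 100)
    (fun s' => exists A H l o,
      [/\ peel R E [set: V] A H, gstate l s', arcs_of E A l, size l <= size l0
        & [/\ forall x, arrs s' 7 x = 0, outrep s' o, edge_set o = H & size o <= n * n]]).
Proof.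
move=> l0E s0 s1 sa s4 s5 s7 so tb0 tbE; rewrite /peel_prog.
have [n1 n2 n3] := ss; set tb := regs s 2 in tb0 tbE *.
pose phiA (A : {set V}) := minn (#|A| %/ tb * (500 * size l0)) (500 * (n * #|A|)) + 10.
apply: (@wpb_seq _ _ _ _ (90 * size l0 + 90) (phiA [set: V])); last first.
  by rewrite /phiA cardsT card_ord; lia.
apply: (wpb_conseq (refresh_ok s0 s1 sa _ l0E (subxx _) _)) => //; first by move=> x; rewrite s4 inE.
move=> s2 fr2 [l2 [gs2 l2E l2l0 sc2]].
pose I phi s' := exists A l o, [/\ phi = phiA A, gstate l s', arcs_of E A l,
   size l <= size l0 & [/\ scan_facts l s', forall x, arrs s' 4 x = (x \notin A),
   forall x, arrs s' 7 x = 0, outrep s' o & [/\ regs s' 2 = tb,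
   size o + n * #|A| <= n * n
   & forall A' H, peel R E A A' H -> peel R E [set: V] A' (edge_set o :|: H)]]].
have r8n A l s' : arcs_of E A l -> scan_facts l s' -> regs s' 8 <= n.
  move=> lE [_ sc]; case: (posnP (regs s' 8)) => [->//|/sc[x [_ ->]]].
  exact: size_uniq_ord (uniq_adjl x lE.1).
apply: (@wpb_while _ W1 _ _ _ (phiA [set: V]) _ I) => //.
- move=> phi s' _ [A [l [o [_ gs lE _ [sc _ _ _ [r2 _ _]]]]]] /=.
  by have := r8n A l s' lE sc; split=> //; split=> //; lia.
- move=> phi s' _ [A [l [o [-> gs lE ll0 [sc dead D0 oo [r2 on cont]]]]]] /=.
  rewrite r2 addn1 ltnS => tb8.
  have [max8 /(_ (leq_trans tb0 tb8))[v [r9 r8]]] := sc.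
  have wv : 0 < size (adjl l v) by rewrite -r8; apply: leq_trans tb8.
  have vl : size (adjl l v) <= size l by rewrite -[leqRHS]sum_size_adjl (bigD1 v) //= leq_addr.
  (* The degree of [v] is maximal, so a scan of all arcs costs at most [n] for each neighbour
     removed with [v]. *)
  have ln : size l <= n * size (adjl l v).
    have -> : n * size (adjl l v) = \sum_(x : V) size (adjl l v).
      by rewrite sum_nat_const card_ord.
    rewrite -[leqLHS]sum_size_adjl.
    by apply: leq_sum => x _; rewrite -r8.
  pose A' := A :\: (v |: nbrs E A v).
  have A'E : A :\: [set z | (z == v) || (z \in adjl l v)] = A'.
    by apply/setP => z; rewrite !inE mem_adjl lE.2.
  have cA' : #|A'| + size (adjl l v) <= #|A|.
    rewrite -[leqRHS](cardsID (v |: nbrs E A v)) addnC leq_add2r (arcs_degE lE).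
    apply: subset_leq_card; apply/subsetP => z; rewrite !inE => zv.
    by rewrite zv orbT; case/and3P: zv => _ ->.
  have vA : v \in A.
    have : v \in unzip1 l by rewrite (arcs_mem_src lE) -(arcs_degE lE).
    by case/mapP=> [[a b]]; rewrite lE.2 => /and3P[aA _ _ ->].
  exists (450 * size l).
  wpb_step (130 * size l + 40) (160 * size l + 120).
  apply: (wpb_conseq (bfs_ok n_gt1 W_big lE.1 (arcs_sym lE) gs D0 r9 wv)) => //.
  move=> s3 fr3 [q [p [d res]]].
  have gs3 : gstate l s3 by apply: gstate_frame fr3 isT gs.
  have oo3 : outrep s3 o by apply: outrep_frame fr3 isT oo.
  wpb_step (50 * size l + 10) (110 * size l + 110).
  apply: (wpb_conseq (tree_out_ok res oo3 _)) => //; first by lia.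
  move=> s4' fr4 [D04 oo4].
  have gs4 : gstate l s4' by apply: gstate_frame fr4 isT gs3.
  have r94 : regs s4' 9 = v.
    by rewrite (proj1 fr4 9 isT) (proj1 fr3 9 isT).
  have dead4 x : arrs s4' 4 x = (x \notin A).
    by rewrite (proj2 fr4 4 isT) (proj2 fr3 4 isT).
  wpb_step (20 * size l + 20) (90 * size l + 90).
  apply: (wpb_conseq (kill_ok gs4 lE.1 r94 dead4)) => //; first by lia.
  rewrite A'E => s5' fr5 dead5.
  have [g50 g51 g5a g5d] : gstate l s5' by apply: gstate_frame fr5 isT gs4.
  have deg5 x : x \notin unzip1 l -> arrs s5' 5 x = 0.
    by move=> xl; have [-> _] := g5d x; rewrite adjl_nil.
  apply: (wpb_conseq (refresh_ok g50 g51 g5a deg5 lE (subsetDl _ _) dead5)) => //.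
  move=> s6 fr6 [l' [gs6 l'E l'l sc6]].
  exists (phiA A'); split.
    have cM : #|A'| %/ tb * (500 * size l0) + 500 * size l0 <= #|A| %/ tb * (500 * size l0).
      rewrite -mulSnr leq_mul2r; apply/orP; right.
      have -> : (#|A'| %/ tb).+1 = (#|A'| + tb) %/ tb by rewrite divnDr ?divnn ?tb0 ?addn1.
      by apply: leq_div2r; lia.
    have cN : n * #|A'| + n * size (adjl l v) <= n * #|A| by rewrite -mulnDr leq_mul2l cA' orbT.
    by rewrite /phiA; lia.
  exists A', l', (o ++ tree_list p q); split=> //.
    exact: leq_trans l'l ll0.
  split=> //.
  - by move=> x; rewrite (proj2 fr6 4 isT).
  - by move=> x; rewrite (proj2 fr6 7 isT) (proj2 fr5 7 isT).
  - by apply: (outrep_frame fr6 isT); apply: (outrep_frame fr5 isT).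
  split=> //.
  - by rewrite (proj1 fr6 2 isT) (proj1 fr5 2 isT) (proj1 fr4 2 isT) (proj1 fr3 2 isT).
  - have qn := size_uniq_ord (cert_uniq (res_cert res)).
    have tq := size_tree_list p q; rewrite size_cat.
    have cN : n * #|A'| + n * size (adjl l v) <= n * #|A| by rewrite -mulnDr leq_mul2l cA' orbT.
    have : n <= n * size (adjl l v) by rewrite leq_pmulr.
    by lia.
  - move=> A2 H2 peel2; rewrite edge_set_cat -setUA; apply: cont.
    have cert := res_cert res; rewrite edge_set_tree_list; last exact: cert_out cert.
    have [bt _] := cert_min_bfs_tree cert.
    apply: (@peel_step _ _ _ _ v) => //.
    + by move=> x _; rewrite -!(arcs_degE lE) -r8.
    + by rewrite card_ord tbE -(arcs_degE lE) -r8.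
    + by move: bt; rewrite (arcs_relE lE).
- move=> phi s' _ [A [l [o [-> gs lE ll0 [sc dead D0 oo [r2 on cont]]]]]] /=.
  rewrite r2 addn1 ltnS -ltnNge => tb8; split.
    exact: leq_trans (leq_addl _ _).
  exists A, (edge_set o), l, o; split=> //; last by split=> //; lia.
  rewrite -[edge_set o]setU0; apply: cont; apply: peel_stop => x _.
  rewrite Order.TotalTheory.ltNge card_ord tbE -(arcs_degE lE) -ltnNge.
  exact: leq_ltn_trans (sc.1 x) tb8.
- exists [set: V], l2, [::]; split=> //; split=> //.
  + by move=> x; rewrite (proj2 fr2 4 isT) s4 inE.
  + by move=> x; rewrite (proj2 fr2 7 isT).
  + by apply: outrep_frame fr2 isT so.
  split=> //.
  + by rewrite (proj1 fr2 2 isT).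
  + by rewrite cardsT card_ord.
  + move=> A' H pl; by rewrite edge_set_nil set0U.
Qed.

End Peeling.

(** * Families of rows and the greedy loop *)

Definition ins : prog :=
  Set_ 23 (Reg 21 *e Reg 0 +e Reg 22) ;;
  If (Get 22 (Reg 23)) Skip
    (Put 22 (Reg 23) (Const 1) ;;
     Put 21 (Reg 21 *e Reg 0 +e Get 20 (Reg 21)) (Reg 22) ;;
     Put 20 (Reg 21) (Get 20 (Reg 21) +e Const 1) ;;
     Put 23 (Reg 22) (Get 23 (Reg 22) +e Const 1)).

Definition add_nbrs : prog :=
  (Set_ 17 (Reg 16 *e Reg 0) ;; Set_ 20 (Get 5 (Reg 16))) ;;
  For 18 20 (Set_ 22 (Get 6 (Reg 17 +e Reg 18)) ;; ins).

(** Dismantles the row of a target that the new pick dominates: the vertices in it lose their mark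
    and one unit of gain. After a complete greedy run all lengths, marks and counters are 0 again,
    ready for the next run. *)
Definition clear_if : prog :=
  Set_ 17 (Reg 26 *e Reg 0) ;;
  If (Get 22 (Reg 17 +e Reg 9))
    (Set_ 20 (Get 20 (Reg 26)) ;;
     For 18 20 (
       Set_ 22 (Get 21 (Reg 17 +e Reg 18)) ;;
       Put 22 (Reg 17 +e Reg 22) (Const 0) ;;
       Put 23 (Reg 22) (Get 23 (Reg 22) -e Const 1)) ;;
     Put 20 (Reg 26) (Const 0))
    Skip.

Definition greedy_body : prog :=
  scanmax 23 ;;
  If (Reg 8)
    ((Put 24 (Reg 24) (Reg 9) ;; Set_ 24 (Reg 24 +e Const 1) ;;
      Put 25 (Reg 9) (Const 1)) ;;
     For 26 21 clear_if)
    (Set_ 25 (Const 0)).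

Definition greedy_prog : prog :=
  (Set_ 24 (Const 0) ;; Set_ 25 (Const 1)) ;; While (Reg 25) greedy_body.

Lemma wpb_if W (W1 : 1 < W) e p q s T T' (Q : state -> Prop) : safe W s e ->
  (truth s e -> wpb W p s T Q) -> (~~ truth s e -> wpb W q s T Q) ->
  (ecost e).+1 + T <= T' -> wpb W (If e p q) s T' Q.
Proof.
move=> se wp wq TT; case tr: (truth s e).
  have [t [s' [ex tT Qs']]] := wp tr; exists ((ecost e).+1 + t), s'; split=> //; last by lia.
  by apply: exec_if_true => //; rewrite truthE.
have [t [s' [ex tT Qs']]] := wq (negbT tr).
exists ((ecost e).+1 + t), s'; split=> //; last by lia.
by apply: exec_if_false => //; apply/eqP; rewrite -[_ == _]negbK truthE ?tr.
Qed.

Lemma upd_eq (X : Type) (f : nat -> X) a b : upd f a b a = b.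
Proof. by rewrite /upd eqxx. Qed.

Lemma upd_neq (X : Type) (f : nat -> X) a b c : c != a -> upd f a b c = f c.
Proof. by rewrite /upd => /negbTE->. Qed.

Lemma wpb_while_step W (W1 : 1 < W) e p s T1 T2 T (Q : state -> Prop) :
  safe W s e -> truth s e -> wpb W p s T1 (fun s' => wpb W (While e p) s' T2 Q) ->
  (ecost e).+1 + T1 + T2 <= T -> wpb W (While e p) s T Q.
Proof.
move=> se tr [t1 [s1 [ex1 tT1 [t2 [s2 [ex2 tT2 Qs2]]]]]] TT.
exists ((ecost e).+1 + t1 + t2), s2; split=> //; last by lia.
by apply: exec_while_true ex1 ex2; rewrite truthE.
Qed.

Lemma wpb_while_end W (W1 : 1 < W) e p s T (Q : state -> Prop) :
  safe W s e -> ~~ truth s e -> (ecost e).+1 <= T -> Q s -> wpb W (While e p) s T Q.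
Proof.
move=> se tr eT Qs; exists (ecost e).+1, s; split=> //.
by apply: exec_while_false; apply/eqP; rewrite -[_ == _]negbK truthE.
Qed.

Section Rows.
Variables (n W : nat) (x0 : 'I_n).
Hypotheses (n_gt1 : 1 < n) (W_big : 16 * (n * n * n) <= W).
Local Notation V := 'I_n.
Implicit Types (x y v : V) (q : seq V) (o l : seq (V * V)) (A : {set V}).
Implicit Types (row live : nat -> seq V).
Local Notation wpb := (wpb W).
Local Notation gstate := (gstate x0).
Local Notation holds := (holds x0).
Let W1 := W_gt1 n_gt1 W_big.
Let ss := sizes n_gt1 W_big.

Definition items_rep (len item : nat -> nat) row : Prop := forall r,
  [/\ uniq (row r), len r = size (row r)
    & forall i, i < size (row r) -> item (r * n + i) = nth x0 (row r) i].

(** Kept apart from [items_rep] because the two disagree while a row is being dismantled: its list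
    of items is still whole when part of its marks are gone. *)
Definition live_rep (mark cnt : nat -> nat) (m : nat) live : Prop :=
  (forall r x, mark (r * n + x) = (x \in live r)) /\
  (forall x, cnt x = \sum_(r < m) (x \in live r)).

(** Serves insertion and deletion alike: the old and the new row may differ only at [x], and the
    counter of [x] trades the old membership bit for the new one. *)
Lemma live_rep_upd mark cnt m live r x (c : seq V) : r < m ->
  (forall z, z != x -> (z \in c) = (z \in live r)) ->
  live_rep mark cnt m live ->
  live_rep (upd mark (r * n + x) (x \in c))
    (upd cnt x (cnt x - (x \in live r) + (x \in c))) m (upd live r c).
Proof.
move=> rm same [mk ct]; split=> [r' z|z].
  rewrite /upd idx_eq ?ltn_ord //; case: (r' =P r) => [->|_] /=; last exact: mk.
  case: (z =P x) => [->|/eqP zx]; first by rewrite eqxx.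
  by rewrite -val_eqE /= in zx; rewrite (negbTE zx) same // mk.
rewrite upd_ord (bigD1 (Ordinal rm)) //= upd_eq.
rewrite (eq_bigr (fun i : 'I_m => (z \in live i) : nat)); last first.
  by move=> i; rewrite -val_eqE /= => ir; rewrite upd_neq.
have := ct z; rewrite (bigD1 (Ordinal rm)) //=.
case: (z =P x) => [->|/eqP zx] ->; last by rewrite same.
by rewrite addKn addnC.
Qed.

Definition rstate (s : state) (m : nat) row : Prop :=
  items_rep (arrs s 20) (arrs s 21) row /\
  live_rep (arrs s 22) (arrs s 23) m row.

Lemma rstate_ext s m row row' : row =1 row' -> rstate s m row -> rstate s m row'.
Proof.
move=> same [items [mk ct]]; split=> [r|]; first by rewrite -same.
by split=> [r x|x]; rewrite -?same // ct; apply: eq_bigr => i _; rewrite same.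
Qed.

Lemma live_cnt_le mark cnt m live x : live_rep mark cnt m live -> cnt x <= m.
Proof.
case=> _ ->; apply: leq_trans (leq_sum _ (fun i _ => leq_b1 _)) _.
by rewrite sum_nat_const card_ord muln1.
Qed.

Lemma items_rep_rcons len item row r x : x \notin row r -> items_rep len item row ->
  items_rep (upd len r (len r + 1)) (upd item (r * n + len r) (x : nat))
    (upd row r (rcons (row r) x)).
Proof.
move=> xr rep r'; have [ur lr ir] := rep r.
have ur' : uniq (rcons (row r) x) by rewrite rcons_uniq xr.
have szr := size_uniq_ord ur'; rewrite size_rcons in szr.
have [u' l' i'] := rep r'; have sz' := size_uniq_ord u'.
rewrite /upd; case: (r' =P r) => [->|/eqP r'r].
  split=> // [|i]; first by rewrite size_rcons lr addn1.
  rewrite size_rcons nth_rcons => ir'; rewrite lr idx_eq ?eqxx //=; last exact: leq_trans szr.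
  move: ir'; rewrite ltnS leq_eqVlt => /predU1P[->|ii]; first by rewrite eqxx ltnn.
  by rewrite (ltn_eqF ii) ii ir.
split=> // i ii; rewrite lr idx_eq ?(negbTE r'r) //=; first exact: i'.
exact: leq_trans sz'.
Qed.

Lemma ins_ok s m row r x : regs s 0 = n -> m <= n * n -> r < m ->
  regs s 21 = r -> regs s 22 = x -> rstate s m row ->
  wpb ins s 50 (fun s' => exists2 c,
    rstate s' m (upd row r c) & forall z, (z \in c) = (z \in row r) || (z == x)).
Proof.
move=> s0 mn rm s21 s22 [items live]; have [mk ct] := live.
have [n1 n2 n3] := ss; have rn := row_le n rm; have xn := ltn_ord x.
have mn' : m * n <= n * n * n by rewrite leq_mul2r mn orbT.
have [ur lr _] := items r; have szr := size_uniq_ord ur.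
have cx := live_cnt_le x live.
rewrite /ins; vcs W1; rewrite mk lr; split_vc; try by lia.
  exists (row r); last first.
    by move=> z; case: eqP => [->|]; rewrite ?c ?orbF.
  apply: (@rstate_ext _ _ row) => [r'|]; first by rewrite /upd; case: eqP => [->|].
  by rewrite /rstate; upds.
exists (rcons (row r) x); last first.
  by move=> z; rewrite mem_rcons inE orbC.
rewrite /rstate; upds; split.
  by rewrite -lr; apply: items_rep_rcons.
have same z : z != x -> (z \in rcons (row r) x) = (z \in row r).
  by move=> zx; rewrite mem_rcons inE (negbTE zx).
by have := live_rep_upd rm same live; rewrite mem_rcons mem_head (negbTE c) subn0.
Qed.

Lemma add_nbrs_ok l s m row r y : gstate l s -> uniq l -> m <= n * n -> r < m ->
  regs s 21 = r -> regs s 16 = y -> rstate s m row ->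
  wpb add_nbrs s (70 * size (adjl l y) + 20) (fun s' => exists2 c,
    rstate s' m (upd row r c) & forall z, (z \in c) = (z \in row r) || ((y, z) \in l)).
Proof.
move=> gs lu mn rm s21 s16 rs; have [s0 s1 sa sd] := gs; have [dy ay] := sd y.
have [n1 n2 n3] := ss; have yn := ltn_ord y; have yr := row_le n yn.
have dyn : size (adjl l y) <= n by apply: size_uniq_ord (uniq_adjl y lu).
rewrite /add_nbrs; wpb_step 10 (70 * size (adjl l y) + 10).
vcs W1; rewrite dy; split_vc; try by lia.
set s2 := State _ _.
pose I i s' := exists2 c,
    rstate s' m (upd row r c) & forall z, (z \in c) = (z \in row r) || (z \in take i (adjl l y)).
wpb_loop W1 (size (adjl l y)) 60 I.
- exists (row r); last by move=> z; rewrite take0 orbF.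
  apply: (@rstate_ext _ _ row) => [r'|]; first by rewrite /upd; case: eqP => [->|].
  by rewrite /rstate; upds.
- move=> i s' il fr ri [c rs' cE].
  have r17 : regs s' 17 = y * n by rewrite (proj1 fr 17 isT) /s2; upds.
  have r0 : regs s' 0 = n by rewrite (proj1 fr 0 isT) /s2; upds.
  have r21 : regs s' 21 = r by rewrite (proj1 fr 21 isT) /s2; upds.
  have ay' : arrs s' 6 (y * n + i) = nth x0 (adjl l y) i.
    by rewrite (proj2 fr 6 isT) /s2; upds; apply: ay.
  wpb_step 6 50.
  clear fr; vcs W1; rewrite ay'; split_vc; try by lia.
  apply: wpb_conseq; first apply: (@ins_ok _ m (upd row r c) r (nth x0 (adjl l y) i)) => //.
  - exact: leqnn.
  move=> s3 fr3 [c' rs3 c'E]; exists c'.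
    apply: (@rstate_ext _ _ (upd (upd row r c) r c')) => [r'|].
      by rewrite /upd; case: eqP.
    by rewrite /rstate; upds.
  move=> z; rewrite c'E /upd eqxx cE (take_nth x0) // mem_rcons inE -orbA.
  by congr (_ || _); rewrite orbC.
- move=> s' fr [c rs' cE]; exists c => // z.
  by rewrite cE take_size mem_adjl.
Qed.

Lemma clear_if_ok s m row r x : regs s 0 = n -> m <= n * n -> r < m ->
  regs s 26 = r -> regs s 9 = x -> rstate s m row ->
  wpb clear_if s (50 * (if x \in row r then size (row r) else 0) + 40) (fun s' =>
    rstate s' m (if x \in row r then upd row r [::] else row)).
Proof.
move=> s0 mn rm s26 s9 [items live]; have [mk ct] := live.
have [n1 n2 n3] := ss; have rn := row_le n rm; have xn := ltn_ord x.
have mn' : m * n <= n * n * n by rewrite leq_mul2r mn orbT.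
have [ur lr ir] := items r; have szr := size_uniq_ord ur.
rewrite /clear_if.
wpb_step 4 (50 * (if x \in row r then size (row r) else 0) + 36).
vcg W1; try by lia.
apply: (@wpb_if _ W1 _ _ _ _ (50 * (if x \in row r then size (row r) else 0) + 31)).
- by cbn [safe val_of binop_val]; simp_state; split_vc; lia.
- cbn [truth val_of binop_val]; simp_state; rewrite mk eqb0 negbK => xr; rewrite xr.
  set sz := size (row r) in lr ir szr *.
  wpb_step 3 (50 * sz + 20).
  vcg W1; rewrite lr; set s2 := State _ _.
  wpb_step (50 * sz + 10) 3.
  pose I i s' := items_rep (arrs s' 20) (arrs s' 21) row /\
     live_rep (arrs s' 22) (arrs s' 23) m (upd row r (drop i (row r))).
  wpb_loop W1 sz 18 I.
  + rewrite /I /s2; upds; rewrite drop0; split=> //.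
    have same r' : upd row r (row r) r' = row r' by rewrite /upd; case: eqP => [->|].
    by split=> [r' z|z]; rewrite ?same // ct; apply: eq_bigr => i _; rewrite same.
  + move=> i s' il fr ri [items' live'].
    pose y := nth x0 (row r) i; have yn := ltn_ord y.
    have r17 : regs s' 17 = r * n by rewrite (proj1 fr 17 isT) /s2; upds.
    have [_ _ ir'] := items' r.
    have dE : drop i (row r) = y :: drop i.+1 (row r) by rewrite (drop_nth x0).
    have yNd : y \notin drop i.+1 (row r).
      by have := drop_uniq i ur; rewrite dE => /andP[].
    have same z : z != y ->
        (z \in drop i.+1 (row r)) = (z \in upd row r (drop i (row r)) r).
      by move=> zy; rewrite upd_eq dE inE (negbTE zy).
    have cy := live_cnt_le y live'.
    have {same live'} := live_rep_upd rm same live'.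
    rewrite (negbTE yNd) upd_eq dE mem_head addn0 => live'.
    clear fr; vcs W1; rewrite ir' // -/y; split_vc; try by lia.
    rewrite /I; upds; split=> //.
    case: live' => mk' ct'; have same r' : upd row r (drop i.+1 (row r)) r' =
      upd (upd row r (y :: drop i.+1 (row r))) r (drop i.+1 (row r)) r'.
      by rewrite /upd; case: eqP.
    split=> [r' z|z]; rewrite ?same // ct'; apply: eq_bigr => j _.
    by rewrite same.
  + move=> s' fr [items' live'].
    have r26 : regs s' 26 = r by rewrite (proj1 fr 26 isT) /s2; upds.
    clear fr; vcg W1; rewrite /rstate; upds; rewrite drop_size in live'; split=> // r'.
    have [u' l' i'] := items' r'; rewrite /upd; case: eqP => [//|_].
    by split.
- cbn [truth val_of binop_val]; simp_state; rewrite mk eqb0 negbK => xr; rewrite (negbTE xr).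
  by vcg W1; rewrite /rstate; upds.
- by rewrite /=; lia.
Qed.

Lemma clear_all_ok s m row x : regs s 0 = n -> m <= n * n -> regs s 21 = m ->
  (forall r, m <= r -> row r = [::]) ->
  regs s 9 = x -> rstate s m row ->
  wpb (For 26 21 clear_if) s
    (50 * \sum_(r < m) (if x \in row r then size (row r) else 0) + 48 * m + 8)
    (fun s' => rstate s' m (fun r => if x \in row r then [::] else row r)).
Proof.
move=> s0 mn s21 big s9 rs.
pose I i s' := rstate s' m (fun r => if (r < i) && (x \in row r) then [::] else row r).
apply: (@wpb_for _ W1 _ _ _ _ m
  (fun r => 50 * (if x \in row r then size (row r) else 0) + 40) _ I) => //.
- by have [] := ss; lia.
- move=> r s' rm fr ri Ir.
  have r0 : regs s' 0 = n by rewrite (proj1 fr 0 isT).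
  have r9 : regs s' 9 = x by rewrite (proj1 fr 9 isT).
  have /= clr := clear_if_ok r0 mn rm ri r9 Ir.
  rewrite ltnn /= in clr.
  apply: (wpb_conseq clr) => // s2 fr2 rs2; rewrite /I.
  apply: (@rstate_ext (State _ (arrs s2))); last by rewrite /rstate; upds; exact: rs2.
  move=> r'; rewrite ltnS leq_eqVlt; case: (boolP (x \in row r)) => xr.
    by rewrite /upd; case: eqP => [->|_] //=; rewrite xr.
  by case: eqP => [->|_] //=; rewrite (negbTE xr) andbF.
- rewrite (eq_bigr (fun i : 'I_m => 50 * (if x \in row i then size (row i) else 0) + 48)).
    by rewrite big_split /= -big_distrr /= sum_nat_const card_ord; lia.
  by move=> i _; lia.
- move=> s' fr; apply: rstate_ext => r; case: ltnP => //= mr.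
  by rewrite big //; case: ifP.
Qed.

Variables (X : finType) (t0 : X) (dom : V -> {set X}) (tg : seq X).
Implicit Types U : {set X}.
Hypotheses (tg_uniq : uniq tg) (tg_small : size tg <= n * n).

Definition rows_for (U : {set X}) row : Prop :=
  (forall r x, r < size tg ->
    (x \in row r) = (nth t0 tg r \in dom x) && (nth t0 tg r \in U)) /\
  (forall r, size tg <= r -> row r = [::]).

(** Rows of dominated targets are empty, so the number of rows containing [x] is the gain that the
    greedy rule maximises; the counter array holds exactly this number. *)
Lemma rows_for_card U row x : {subset U <= tg} -> rows_for U row ->
  \sum_(r < size tg) (x \in row r) = #|dom x :&: U|.
Proof.
move=> Utg [rE _].
rewrite (eq_bigr (fun r : 'I_(size tg) =>
   if nth t0 tg r \in dom x :&: U then 1 else 0)); last first.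
  by move=> r _; rewrite rE // inE; case: (_ && _).
rewrite -(big_mkord xpredT (fun r => if nth t0 tg r \in dom x :&: U then 1 else 0)).
rewrite -(big_nth t0 xpredT (fun t => if t \in dom x :&: U then 1 else 0)) /=.
rewrite big_uniq //= -big_mkcondr /= sum1_card; apply: eq_card => t.
by rewrite unfold_in; case: (boolP (t \in dom x :&: U)) => [|_]; rewrite ?andbF // inE andbT => /andP[_ /Utg].
Qed.

Variables (E : {set {set V}}) (A : {set V}) (l : seq (V * V)).
Hypothesis lE : arcs_of E A l.
(** A vertex without arcs has gain 0, so the maximum found among the sources of arcs is the maximum
    over all candidates. *)
Hypothesis dom_src : forall x t, t \in tg -> t \in dom x -> x \in unzip1 l.
Hypothesis dom_some : forall t, t \in tg -> exists x, t \in dom x.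

Let src_A x : x \in unzip1 l -> x \in A.
Proof. by case/mapP=> -[a b] + ->; rewrite lE.2 => /and3P[]. Qed.

(** The picks are quantified before the run because the time bound refers to their number. A round
    costs a scan of the arcs and of the rows, and one more round discovers that no gain is left. The
    50 per row entry pays for dismantling, spread over the rounds. *)
Lemma greedy_loop_ok U row s (sl : seq V) : {subset U <= tg} ->
  gstate l s -> regs s 21 = size tg -> regs s 25 = 1 ->
  regs s 24 = size sl -> holds (arrs s 24) sl -> size sl + #|U| <= size tg ->
  rows_for U row -> rstate s (size tg) row ->
  exists sl', greedy_seq A dom U sl' /\
    wpb (While (Reg 25) greedy_body) s
      (100 * (size l + size tg + 2) * (size sl').+1 + 50 * \sum_(r < size tg) size (row r))
      (fun s' => [/\ regs s' 24 = size (sl ++ sl'), holds (arrs s' 24) (sl ++ sl'),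
        forall x, arrs s' 25 x = if x \in sl' then 1 else arrs s 25 x
      & rstate s' (size tg) (fun=> [::])]).
Proof.
move: {2}#|U| (erefl #|U|) => k; elim/ltn_ind: k U row s sl => k IH U row s sl Uk.
move=> Utg gs s21 s25 s24 hsl slU rU rs; have [s0 _ _ _] := gs.
have [n1 n2 n3] := ss; have mn := tg_small; set m := size tg in mn s21 slU rs *.
have cnt x : arrs s 23 x = #|dom x :&: U|.
  by have [_ [_ ->]] := rs; apply: rows_for_card.
have [t1 [s1 [ex1 tT1 [max8 max9]]]] := scanmax_ok n_gt1 W_big lE.1 23 gs.
have fr1 := exec_frame ex1.
have rowE r x : r < m -> (x \in row r) = (nth t0 tg r \in dom x) && (nth t0 tg r \in U).
  by case: rU => rE _; apply: rE.
case: (posnP (regs s1 8)) => r8.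
  have U0 : U = set0.
    apply/eqP/set0Pn => -[t tU]; have [x tx] := dom_some (Utg _ tU).
    have := max8 x (dom_src (Utg _ tU) tx); rewrite r8 leqn0 cnt cards_eq0.
    by apply/negP/set0Pn; exists t; rewrite inE tx.
  exists [::]; split; first by rewrite U0; constructor.
  apply: (@wpb_while_step _ W1 _ _ _ (30 * size l + 40) 2) => //=; try by [rewrite s25|lia].
  wpb_step (30 * size l + 30) 10.
  exists t1, s1; split=> //.
  apply: (@wpb_if _ W1 _ _ _ _ 2) => //=; first by rewrite r8.
  move=> _; vcg W1; apply: (wpb_while_end W1) => //=.
  rewrite cats0; upds; rewrite /rstate; upds; rewrite !(proj2 fr1 _ isT) (proj1 fr1 24 isT).
  split=> //; apply: (@rstate_ext s m row) => // r.
  case: (ltnP r m) => [rm|mr]; last by case: rU => _ ->.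
  by case rE: (row r) => [//|x c]; have := rowE r x rm; rewrite rE mem_head U0 inE andbF.
have [c [cu r9 r8E]] := max9 r8.
have cA := src_A cu.
pose U' := U :\: dom c; pose row' r := if c \in row r then [::] else row r.
have cU : 0 < #|dom c :&: U| by rewrite -cnt -r8E.
have cardU : #|U'| + #|dom c :&: U| = #|U|.
  by rewrite setIC addnC cardsID.
pose marked := \sum_(r < m) (if c \in row r then size (row r) else 0).
have pick : wpb (If (Reg 8) ((Put 24 (Reg 24) (Reg 9) ;; Set_ 24 (Reg 24 +e Const 1) ;;
      Put 25 (Reg 9) (Const 1)) ;; For 26 21 clear_if) (Set_ 25 (Const 0))) s1
   (50 * marked + 48 * m + 40) (fun s3 => [/\ gstate l s3, regs s3 21 = m, regs s3 25 = 1,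
     regs s3 24 = size (rcons sl c) & [/\ holds (arrs s3 24) (rcons sl c),
     forall x, arrs s3 25 x = if x == c then 1 else arrs s 25 x & rstate s3 m row']]).
  apply: (@wpb_if _ W1 _ _ _ _ (50 * marked + 48 * m + 30)) => //=; last by lia.
    move=> _; wpb_step 15 (50 * marked + 48 * m + 8).
    vcg W1; first by lia.
    set s2 := State _ _.
    have s20 : regs s2 0 = n by rewrite /s2; upds; rewrite (proj1 fr1 0 isT).
    have s221 : regs s2 21 = m by rewrite /s2; upds; rewrite (proj1 fr1 21 isT).
    have s29 : regs s2 9 = c by rewrite /s2; upds.
    have rs2 : rstate s2 m row by rewrite /rstate /s2; upds; rewrite !(proj2 fr1 _ isT).
    have gs2 : gstate l s2.
      by apply: gstate_frame fr1 isT gs.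
    have big r : m <= r -> row r = [::] by case: rU => _; apply.
    apply: (wpb_conseq (clear_all_ok s20 mn s221 big s29 rs2)) => // s3 fr3 rs3.
    split; first (by apply: gstate_frame fr3 isT gs2);
      rewrite ?(proj1 fr3 21 isT) ?(proj1 fr3 25 isT) ?(proj1 fr3 24 isT) ?(proj2 fr3 24 isT) ?(proj2 fr3 25 isT) /s2; upds.
    - exact: s221.
    - by rewrite (proj1 fr1 25 isT).
    - by rewrite size_rcons addn1.
    split=> //; first exact: holds_rcons.
  by rewrite -lt0n r8.
have {pick} [t2 [s3 [ex2 tT2 [gs3 s321 s325 s324 [h3 m3 rs3]]]]] := pick.
have rU' : rows_for U' row'.
  split=> [r x rm|r mr]; last by have [_ big] := rU; rewrite /row' (big r mr); case: (c \in _).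
  rewrite /row' rowE // !inE; case: (boolP (nth t0 tg r \in dom c)) => /= rc.
    by rewrite andbF; case: ifP => // rU0; rewrite rowE // rU0 andbF.
  by rewrite rowE.
have U'tg : {subset U' <= tg} by move=> t; rewrite inE => /andP[_ /Utg].
have U'k : #|U'| < k by lia.
have szU' : size (rcons sl c) + #|U'| <= m by rewrite size_rcons; lia.
have [sl' [gsl' wsl']] := IH _ U'k U' row' s3 (rcons sl c) erefl U'tg gs3 s321 s325 s324 h3 szU' rU' rs3.
exists (c :: sl'); split.
  constructor=> //; first by rewrite -card_gt0.
  move=> c' c'A; rewrite -[X in _ <= X]cnt -r8E -cnt.
  have [/max8//|c'u] := boolP (c' \in unzip1 l).
  rewrite cnt; suff -> : dom c' :&: U = set0 by rewrite cards0.
  apply/setP => t; rewrite !inE; apply/negP => /andP[tc' /Utg ttg].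
  by rewrite (dom_src ttg tc') in c'u.
(* The rows containing [c] are paid for in this round and are empty in [row']; the rest of the sum
   is left to the remaining rounds. *)
have split_sum : \sum_(r < m) size (row r) = marked + \sum_(r < m) size (row' r).
  by rewrite -big_split /=; apply: eq_bigr => r _; rewrite /row'; case: ifP; rewrite ?addn0.
pose TI := 100 * (size l + m + 2) * (size sl').+1 + 50 * \sum_(r < m) size (row' r).
apply: (@wpb_while_step _ W1 _ _ _ (30 * size l + 30 + (50 * marked + 48 * m + 40)) TI) => //=.
- by rewrite s25.
- exists (t1 + t2), s3; split; [exact: exec_seq ex1 ex2|by lia|].
  apply: (wpb_conseq wsl') => // s4 fr4 [r24 h24 m25 rs4].
  rewrite cat_rcons in r24 h24; split=> // x.
  by rewrite m25 m3 inE orbC; case: (x \in sl').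
- rewrite split_sum /TI (mulnS _ (size sl').+1).
  move: (_ * (size sl').+1) (\sum_(r < m) size (row' r)) => a b; lia.
Qed.

Lemma greedy_ok row s : gstate l s -> regs s 21 = size tg ->
  rows_for [set t in tg] row -> rstate s (size tg) row ->
  exists sl, greedy_seq A dom [set t in tg] sl /\
    wpb greedy_prog s
      (100 * (size l + size tg + 2) * (size sl).+1 + 50 * \sum_(r < size tg) size (row r) + 10)
      (fun s' => [/\ regs s' 24 = size sl, holds (arrs s' 24) sl,
        forall x, arrs s' 25 x = if x \in sl then 1 else arrs s 25 x
      & rstate s' (size tg) (fun=> [::])]).
Proof.
move=> gs s21 rU rs; rewrite /greedy_prog.
pose s2 := State (upd (upd (regs s) 24 0) 25 1) (arrs s).
have gs2 : gstate l s2 by rewrite /gstate /s2; upds.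
have [|||||sl [gsl wsl]] := @greedy_loop_ok [set t in tg] row s2 [::] _ gs2 s21 _ _ _ _ rU rs => //.
- by move=> t; rewrite inE.
- rewrite /= add0n -(card_uniqP tg_uniq); apply: subset_leq_card.
  by apply/subsetP => t; rewrite inE.
exists sl; split=> //.
wpb_step 10 (100 * (size l + size tg + 2) * (size sl).+1 + 50 * \sum_(r < size tg) size (row r)).
vcg W1; exact: wsl.
Qed.

End Rows.

(** * Dominating the heavy vertices *)

Definition heavy_rows : prog :=
  Set_ 27 (Const 0) ;;
  For 10 1 (
    Set_ 11 (Get 0 (Reg 10)) ;;
    If (Get 5 (Reg 11) <e Reg 3) Skip
      (If (Get 13 (Reg 11)) Skip
         ((Set_ 21 (Reg 27) ;; Set_ 22 (Reg 11) ;; Set_ 27 (Reg 27 +e Const 1) ;;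
           Put 13 (Reg 11) (Reg 27)) ;; ins) ;;
       (Set_ 21 (Get 13 (Reg 11) -e Const 1) ;; Set_ 22 (Get 1 (Reg 10))) ;; ins)) ;;
  Set_ 21 (Reg 27).

Definition dominate : prog :=
  For 10 1 (
    Set_ 11 (Get 0 (Reg 10)) ;; Set_ 12 (Get 1 (Reg 10)) ;;
    If (Get 5 (Reg 11) <e Reg 3) Skip
      (If (Get 25 (Reg 11)) Skip
        (If (Get 25 (Reg 12))
          (If (Get 14 (Reg 11)) Skip
             (Put 14 (Reg 11) (Const 1) ;; emit (Reg 11) (Reg 12)))
          Skip))).

Section Heavy.
Variables (n W : nat) (x0 : 'I_n).
Hypotheses (n_gt1 : 1 < n) (W_big : 16 * (n * n * n) <= W).
Local Notation V := 'I_n.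
Implicit Types (x y v : V) (l o : seq (V * V)) (row : nat -> seq V).
Local Notation wpb := (wpb W).
Local Notation gstate := (gstate x0).
Local Notation rstate := (rstate x0).
Local Notation outrep := (outrep x0).
Let W1 := W_gt1 n_gt1 W_big.
Let ss := sizes n_gt1 W_big.

(** Counters are sums over the first [m] rows. The rows are built before their number is known,
    under the bound [n * n]; the empty ones are cut off before the greedy loop. *)
Lemma rstate_resize s m m' row : (forall r, minn m m' <= r -> row r = [::]) ->
  rstate s m row -> rstate s m' row.
Proof.
move=> nil [items [mk ct]]; split=> //; split=> // x.
have aux a b : a <= b -> (forall r, a <= r -> row r = [::]) ->
    \sum_(r < b) (x \in row r) = \sum_(r < a) (x \in row r) :> nat.
  move=> ab nilr; rewrite -!(big_mkord xpredT (fun r => nat_of_bool (x \in row r))).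
  rewrite (@big_cat_nat _ _ _ a) //= -[RHS]addn0; congr (_ + _).
  by rewrite big_nat_cond big1 // => r /andP[/andP[ar _] _]; rewrite nilr.
rewrite ct; case: (leqP m m') => mm'.
  by rewrite (aux m) // => r mr; apply: nil; rewrite geq_min mr.
by rewrite (aux m' m) ?(ltnW mm') // => r mr; apply: nil; rewrite geq_min mr orbT.
Qed.

Variable l : seq (V * V).
Hypothesis l_uniq : uniq l.

Definition heavy_inv th (pre : seq (V * V)) (tg : seq V) row (s : state) : Prop :=
  [/\ uniq tg, forall x, (x \in tg) = (th <= size (adjl l x)) && (x \in unzip1 pre),
    regs s 27 = size tg,
    forall x, arrs s 13 x = if x \in tg then (index x tg).+1 else 0
  & [/\ rstate s (n * n) row,
       forall r x, r < size tg ->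
         (x \in row r) = (x == nth x0 tg r) || ((nth x0 tg r, x) \in pre)
     & forall r, size tg <= r -> row r = [::]]].

(** A heavy vertex receives a row at its first arc and enters that row itself, since it dominates
    itself; array 13 stores the row number plus one. *)
Lemma heavy_rows_ok s : gstate l s -> (forall x, arrs s 13 x = 0) ->
  rstate s (n * n) (fun=> [::]) ->
  wpb heavy_rows s (180 * size l + 20) (fun s' => exists tg row,
    [/\ regs s' 21 = size tg, uniq tg,
       forall x, (x \in tg) = (regs s 3 <= size (adjl l x)) && (x \in unzip1 l)
     & [/\ rstate s' (size tg) row,
       forall r x, r < size tg ->
         (x \in row r) = (x == nth x0 tg r) || ((nth x0 tg r, x) \in l)
     & forall r, size tg <= r -> row r = [::]]]).
Proof.
move=> gs hv rs; have [s0 s1 sa sd] := gs; have [n1 n2 n3] := ss.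
rewrite /heavy_rows; set th := regs s 3.
wpb_step 2 (180 * size l + 10).
vcg W1; set s2 := State _ _.
wpb_step (180 * size l + 8) 2.
pose I i s' := exists tg row, heavy_inv th (take i l) tg row s'.
have szl := size_uniq_pairs l_uniq.
wpb_loop W1 (size l) 160 I.
- exists [::], (fun=> [::]); rewrite /heavy_inv /s2 take0; upds.
  by split=> // x; rewrite in_nil andbF.
- move=> i s' il fr ri [tg [row [utg tgE r27 a13 [rs' rowE nil]]]].
  have [x [y [xyl nxy ax ay]]] := arc_at gs il; have [dx _] := sd x.
  have tgn := size_uniq_ord utg.
  have takeS : take i.+1 l = rcons (take i l) (x, y) by rewrite (take_nth (x0, x0)) // nxy.
  have r0 : regs s' 0 = n by rewrite (proj1 fr 0 isT).
  have r3 : regs s' 3 = th by rewrite (proj1 fr 3 isT).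
  have a5 : arrs s' 5 x = size (adjl l x) by rewrite (proj2 fr 5 isT).
  have a0 : arrs s' 0 i = x by rewrite (proj2 fr 0 isT).
  have a1 : arrs s' 1 i = y by rewrite (proj2 fr 1 isT).
  clear fr.
  apply: (@wpb_seq _ _ _ _ 3 157) => //; vcs W1; rewrite a0; split_vc.
  set s3 := State _ _.
  apply: (@wpb_if _ W1 _ _ _ _ 150) => //; rewrite /s3 /=; upds; rewrite a5 r3.
    move=> light; vcg W1; exists tg, row; rewrite takeS.
    have xtg : x \notin tg by rewrite tgE leqNgt light.
    split=> // [z|].
      rewrite tgE /unzip1 map_rcons mem_rcons inE /=.
      by case: (z =P x) => [->|//]; rewrite leqNgt light.
    split=> // r z rtg.
    rewrite rowE // mem_rcons inE xpair_eqE.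
    case: (_ =P x) => //= rx.
    by move: xtg; rewrite -rx mem_nth.
  rewrite -leqNgt => hx.
  wpb_step 80 70.
  (* The common end of two branches: once [x] has a row, old or just created, the other endpoint [y]
     of the arc is inserted into it. *)
  have mid tg' row' s4 : uniq tg' -> x \in tg' -> regs s4 0 = n ->
     regs s4 11 = x -> regs s4 10 = i -> arrs s4 1 = arrs s' 1 ->
     (forall z : V, (z \in tg') = (th <= size (adjl l z)) && (z \in unzip1 (take i.+1 l))) ->
     regs s4 27 = size tg' ->
     (forall z : V, arrs s4 13 z = if z \in tg' then (index z tg').+1 else 0) ->
     rstate s4 (n * n) row' ->
     (forall r (z : V), r < size tg' ->
         (z \in row' r) = (z == nth x0 tg' r) || ((nth x0 tg' r, z) \in take i l)) ->
     (forall r, size tg' <= r -> row' r = [::]) ->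
     wpb ((Set_ 21 (Get 13 (Reg 11) -e Const 1) ;; Set_ 22 (Get 1 (Reg 10))) ;; ins) s4 70
       (fun s'' => I i.+1 (State (upd (regs s'') 10 i.+1) (arrs s''))).
    move=> utg' xtg' s40 s411 s410 a41 tg'E s427 a413 rs4 row'E nil'.
    wpb_step 10 50.
    have itg : index x tg' < size tg' by rewrite index_mem.
    have ixn : (index x tg').+1 <= n by apply: leq_trans itg (size_uniq_ord utg').
    vcs W1; rewrite a413 xtg' a41 a1 subn1; split_vc; first by lia.
    set s5 := State _ _.
    apply: wpb_conseq; first apply: (@ins_ok n W x0 n_gt1 W_big s5 (n * n) row' (index x tg') y) => //.
    - by lia.
    - exact: leqnn.
    move=> s6 fr6 [c rs6 cE]; exists tg', (upd row' (index x tg') c).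
    have r27' : regs s6 27 = size tg' by rewrite (proj1 fr6 27 isT).
    rewrite takeS; split=> //; upds; rewrite ?(proj2 fr6 13 isT) //.
      by move=> z; rewrite tg'E takeS.
    split=> // [r z rtg|r rtg].
      rewrite mem_rcons inE xpair_eqE; case: (r =P index x tg') => [->|/eqP rx].
        rewrite upd_eq cE row'E // nth_index // eqxx /=.
        by rewrite -orbA; congr (_ || _); rewrite orbC.
      rewrite upd_neq // row'E //; congr (_ || _).
      case: (_ =P x) => //= E; case/eqP: rx; rewrite -E index_uniq //.
    by rewrite upd_neq ?nil' //; apply: contraTneq rtg => ->; rewrite -ltnNge.
  apply: (@wpb_if _ W1 _ _ _ _ 70) => //; cbn [truth val_of]; upds; rewrite a13.
    case: (boolP (x \in tg)) => // xtg _; vcg W1; apply: (mid tg row) => //; upds => //.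
    move=> z; rewrite tgE takeS /unzip1 map_rcons mem_rcons inE /=.
    case: (z =P x) => [->|//]; rewrite hx /=.
    by move: xtg; rewrite tgE => /andP[].
  case: (boolP (x \in tg)) => // xtg _.
  have tgn1 : size tg < n.
    have ur : uniq (rcons tg x) by rewrite rcons_uniq xtg.
    by have := size_uniq_ord ur; rewrite size_rcons.
  wpb_step 15 50.
  vcg W1; first by lia.
  set s4 := State _ _.
  apply: wpb_conseq; first apply: (@ins_ok n W x0 n_gt1 W_big s4 (n * n) row (size tg) x) => //.
  - by lia.
  - exact: leqnn.
  move=> s6 fr6 [c rs6 cE]; apply: (mid (rcons tg x) (upd row (size tg) c)).
  - by rewrite rcons_uniq xtg.
  - by rewrite mem_rcons mem_head.
  - by rewrite (proj1 fr6 0 isT) /s4; upds.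
  - by rewrite (proj1 fr6 11 isT) /s4; upds.
  - by rewrite (proj1 fr6 10 isT) /s4; upds.
  - by rewrite (proj2 fr6 1 isT) /s4; upds.
  - move=> z; rewrite takeS /unzip1 map_rcons !mem_rcons !inE tgE /=.
    by case: (z =P x) => [->|]; rewrite //= hx.
  - by rewrite (proj1 fr6 27 isT) /s4; upds; rewrite size_rcons addn1.
  - move=> z; rewrite (proj2 fr6 13 isT) /s4; upds.
    rewrite upd_ord a13 mem_rcons inE -cats1 index_cat.
    case: (z =P x) => [->|/eqP zx] /=; first by rewrite (negbTE xtg) /= eqxx addn0 addn1.
    by case: ifP => // ztg.
  - exact: rs6.
  - move=> r z; rewrite size_rcons ltnS leq_eqVlt => /predU1P[->|rtg].
      rewrite upd_eq cE nil // nth_rcons ltnn eqxx /=.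
      case: (z =P x) => //= _; apply/esym/negP => /(map_f fst) /= xt.
      by move: xtg; rewrite tgE hx xt.
    by rewrite upd_neq ?(ltn_eqF rtg) // rowE // nth_rcons rtg.
  - move=> r; rewrite size_rcons => rtg; rewrite upd_neq ?nil //; first exact: ltnW.
    by rewrite gtn_eqF.
- move=> s' fr [tg [row [utg tgE r27 a13 [rs' rowE nil]]]].
  rewrite take_size in tgE rowE; clear fr; vcg W1; exists tg, row; split=> //.
  split=> //; rewrite /rstate; upds.
  apply: rstate_resize rs' => r; rewrite geq_min => /orP[nr|]; last exact: nil.
  by apply: nil; apply: leq_trans nr; have := size_uniq_ord utg; nia.
Qed.

(** Distinct first endpoints make [o'] the graph of a partial function, from which the dominator map
    of the construction can be read off. *)
Lemma dominate_ok s o (S : seq V) : gstate l s -> outrep s o -> size o + size l < W ->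
  (forall x, arrs s 14 x = 0) -> (forall x, arrs s 25 x = (x \in S)) ->
  wpb dominate s (50 * size l + 20) (fun s' => exists o',
    [/\ outrep s' (o ++ o'), uniq (unzip1 o'), size o' <= size l,
       forall a b, (a, b) \in o' ->
         [/\ regs s 3 <= size (adjl l a), a \notin S, b \in S & (a, b) \in l]
     & forall a b, (a, b) \in l -> regs s 3 <= size (adjl l a) -> a \notin S ->
         b \in S -> a \in unzip1 o']).
Proof.
move=> gs [s7 so] oW a14 aS; have [s0 s1 sa sd] := gs; have [n1 n2 n3] := ss.
rewrite /dominate; set th := regs s 3.
pose I i s' := exists o',
    [/\ outrep s' (o ++ o'), uniq (unzip1 o'),
       size o' <= i /\ (forall x, arrs s' 14 x = (x \in unzip1 o')),
       forall a b, (a, b) \in o' ->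
         [/\ th <= size (adjl l a), a \notin S, b \in S & (a, b) \in l]
     & forall a b, (a, b) \in take i l -> th <= size (adjl l a) -> a \notin S ->
         b \in S -> a \in unzip1 o'].
have szl := size_uniq_pairs l_uniq.
wpb_loop W1 (size l) 40 I.
- exists [::]; rewrite cats0 take0; split=> //; rewrite /outrep; upds => //.
- move=> i s' il fr ri [o' [[r7 oo] uo [so' a14'] sound compl]].
  have [x [y [xyl nxy ax ay]]] := arc_at gs il; have [dx _] := sd x.
  have takeS : take i.+1 l = rcons (take i l) (x, y) by rewrite (take_nth (x0, x0)) // nxy.
  rewrite size_cat in r7.
  have keep : (th <= size (adjl l x) -> x \notin S -> y \in S -> x \in unzip1 o') ->
    I i.+1 (State (upd (upd (upd (regs s') 11 x) 12 y) 10 i.+1) (arrs s')).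
    move=> new; exists o'; rewrite /outrep size_cat; upds; split=> //.
      by split=> //; apply: leqW.
    move=> a b; rewrite takeS mem_rcons inE => /predU1P[[-> ->]//|].
    exact: compl.
  vcs W1; rewrite ax ay dx !aS a14' !eqb0 !negbK; split_vc; try by lia.
  + by apply: keep; rewrite leqNgt c.
  + by apply: keep; rewrite c0.
  + by apply: keep.
  + exists (rcons o' (x, y)); rewrite /outrep -rcons_cat; upds.
    have -> : unzip1 (rcons o' (x, y)) = rcons (unzip1 o') x by rewrite /unzip1 map_rcons.
    rewrite rcons_uniq c2 uo !size_rcons size_cat addn1.
    split=> //.
    - by split=> //; rewrite -size_cat; apply: arcs_rep_rcons.
    - split=> // z; rewrite upd_ord mem_rcons inE a14'.
      by case: (z =P x).
    - move=> a b; rewrite mem_rcons inE => /predU1P[[-> ->]|]; last exact: sound.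
      by rewrite c0 c1 xyl leqNgt c.
    - move=> a b; rewrite takeS !mem_rcons !inE => /predU1P[[-> _]|ab]; first by rewrite eqxx.
      by move=> h1 h2 h3; rewrite (compl a b) ?orbT.
  + by apply: keep => _ _ yS; rewrite yS in c1.
- move=> s' fr [o' [oo uo [so' _] sound compl]]; exists o'; split=> //.
  by rewrite take_size in compl.
Qed.

End Heavy.

(** * Subtree sums and frontier nodes *)

Lemma leq_sum_sub (I : finType) (P Q : pred I) (F : I -> nat) :
  (forall i, P i -> Q i) -> \sum_(i | P i) F i <= \sum_(i | Q i) F i.
Proof.
move=> PQ; rewrite [leqRHS](bigID P) /= (eq_bigl P) ?leq_addr // => i.
by rewrite andbC; case: (boolP (P i)) => // /PQ.
Qed.

Section SubtreeSums.
Variables (V : finType) (q : seq V) (p : ptree V) (d : V -> nat) (w0 : V -> nat).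
Hypothesis dS : forall x y, p y = Some x -> d y = (d x).+1.
Hypothesis par_q : forall x y, p y = Some x -> y \in q /\ index x q < index y q.

(* What the reversed queue has gathered at y once the positions from j on have
   been passed to their parents. *)
Definition gathered j y :=
  w0 y + \sum_(c | (p c == Some y) && (j <= index c q)) subtree_weight w0 p c.

Lemma gathered0 y : gathered 0 y = subtree_weight w0 p y.
Proof.
rewrite (subtree_weight_rec dS) /gathered; congr (_ + _).
by apply: eq_bigl => c; rewrite andbT.
Qed.

(** Children stand after their parent in the queue, so all of them have been passed when the
    reversed traversal reaches [y], and the value found there is final. *)
Lemma gathered_done y : gathered (index y q).+1 y = subtree_weight w0 p y.
Proof.
rewrite (subtree_weight_rec dS) /gathered; congr (_ + _).
by apply: eq_bigl => c; case: eqP => // /par_q[_ ->].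
Qed.

Lemma gathered_init y : gathered (size q) y = w0 y.
Proof.
rewrite /gathered big_pred0 ?addn0 // => c; apply/negbTE/negP => /andP[/eqP/par_q[]].
by rewrite -index_mem ltnNge => /negP.
Qed.

Lemma gatheredS j u z : u \in q -> index u q = j ->
  gathered j z = gathered j.+1 z + (if p u == Some z then subtree_weight w0 p u else 0).
Proof.
move=> uq ju; rewrite /gathered -addnA; congr (_ + _).
case: eqP => [pu|/eqP pu].
  rewrite (bigD1 u) /= ?pu ?eqxx ?ju //= addnC; congr (_ + _); apply: eq_bigl => c.
  rewrite ltn_neqAle -andbA; congr (_ && _); rewrite andbC; congr (_ && _).
  by rewrite -ju; congr (~~ _); apply/eqP/eqP => [->//|/(index_eq uq)].
rewrite addn0; apply: eq_bigl => c; rewrite leq_eqVlt.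
case: (j =P index c q) => [jc|//] /=; rewrite -jc ltnn.
have <- : u = c by apply: (index_eq uq); rewrite ju.
by rewrite (negbTE pu).
Qed.

Lemma subtree_weight_le y : subtree_weight w0 p y <= \sum_x w0 x.
Proof. by rewrite [leqRHS](bigID (anc p y)) leq_addr. Qed.

Lemma gathered_le j y : gathered j y <= \sum_x w0 x.
Proof.
apply: leq_trans (subtree_weight_le y); rewrite -gathered0 /gathered leq_add2l.
by apply: leq_sum_sub => c /andP[->].
Qed.

Lemma subtree_weight_gt0 y :
  (0 < subtree_weight w0 p y) = [exists u, anc p y u && (0 < w0 u)].
Proof.
rewrite lt0n /subtree_weight sum_nat_eq0 negb_forall; apply: eq_existsb => u.
by rewrite negb_imply lt0n.
Qed.

End SubtreeSums.

Section Frontier.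
Variables (V : finType) (g : rel V) (w : V -> nat) (v : V) (q : seq V).
Variables (p : ptree V) (d f : V -> nat) (tp t3 : nat).
Hypothesis cert : bfs_cert g w v q p d f.
Hypothesis t3_big : 3 * tp <= t3.

(** For a fixed root [v], the vertices [u] for which [(v, u)] is a node of the side R, with integers
    in place of the real thresholds. *)
Definition frontier : pred V := fun u =>
  if p u is Some z then [&& tp < f u, f z <= tp & t3 < subtree_weight w p u] else false.

Lemma cert_f_mono x u : u \in q -> anc p x u -> f x <= f u.
Proof.
move=> uq xu; have xq := cert_anc_mem cert uq xu.
rewrite (cert_fE cert xq) (cert_fE cert uq); apply: leq_sum_sub => y yx.
exact: connect_trans yx xu.
Qed.

Lemma frontier_mem u : frontier u -> u \in q.
Proof. by rewrite /frontier; case pu: (p u) => [z|//] _; case: (cert_parE cert pu). Qed.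

(** [f] grows along a tree path and passes [tp] only once. A proper ancestor [u] of [u'] is an
    ancestor of the parent of [u'], where [f] is still at most [tp], against [tp < f u]. *)
Lemma frontier_antichain : {in frontier &, forall u u', anc p u u' -> u = u'}.
Proof.
move=> u u' fu; rewrite [in X in X -> _]unfold_in /frontier; case pu': (p u') => [z|//].
case/and3P=> _ fz _; rewrite (anc_parent _ pu') => /orP[/eqP//|uz].
have [_ _ zq _ _] := cert_parE cert pu'.
have := cert_f_mono zq uz; move: fu; rewrite unfold_in /frontier; case: (p u) => [z'|//].
by case/and3P=> fu _ _; lia.
Qed.

Lemma frontier_subtree : \sum_(u | frontier u) subtree_weight w p u <= \sum_x w x.
Proof. exact: (antichain_sum (cert_depth cert) w frontier_antichain). Qed.

(** [f u] is the value at the parent, at most [tp], plus [w u], which is part of the subtree weight;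
    and the subtree weight exceeds [3 * tp]. *)
Lemma frontier_weight u : frontier u -> f u <= 2 * subtree_weight w p u.
Proof.
rewrite /frontier; case pu: (p u) => [z|//] /and3P[_ fz st].
have [_ _ _ _ [_ -> _]] := cert_parE cert pu.
have : w u <= subtree_weight w p u.
  by rewrite /subtree_weight (bigD1 u) ?anc_refl ?leq_addr.
by lia.
Qed.

Lemma frontier_sum : \sum_(u | frontier u) f u <= 2 * \sum_x w x.
Proof.
apply: leq_trans (leq_sum _ (fun u fu => frontier_weight fu)) _.
by rewrite -big_distrr leq_mul2l /= frontier_subtree.
Qed.

Lemma frontier_count : #|[pred u | frontier u]| * t3.+1 <= \sum_x w x.
Proof.
rewrite -sum_nat_const; apply: leq_trans frontier_subtree; apply: leq_sum => u.
by rewrite inE /frontier; case: (p u) => [z|//] /and3P[].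
Qed.

Lemma cert_path_nbrs u : (forall y, w y = #|[set x | g y x]|) -> u \in q ->
  #|[set x | [exists y, anc p y u && g y x]]| <= f u.
Proof.
move=> wE uq; rewrite (cert_fE cert uq).
rewrite (eq_bigr (fun y => \sum_(x | g y x) 1)); last first.
  by move=> y _; rewrite wE sum1dep_card.
rewrite (exchange_big_dep (fun x => [exists y, anc p y u && g y x])) /=; last first.
  by move=> y x yu gyx; apply/existsP; exists y; rewrite yu.
rewrite -sum1dep_card; apply: leq_sum => x /existsP[y yx].
by rewrite sum1dep_card card_gt0; apply/set0Pn; exists y; rewrite inE.
Qed.

End Frontier.

(** * Processing the vertices of S1 and S2 *)

Definition prep : prog :=
  For 18 15 (
    Set_ 19 (Get 10 (Reg 18)) ;; Put 7 (Reg 19) (Const 0) ;;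
    Put 11 (Reg 19) (Get 5 (Reg 19)) ;; Put 12 (Reg 19) (Const 0) ;;
    If (Get 25 (Reg 19))
       (If (Reg 6 <e Get 9 (Reg 19)) Skip (Put 12 (Reg 19) (Const 1))) Skip).

Definition gather (a : nat) : prog :=
  For 18 15 (
    Set_ 19 (Get 10 (Reg 15 -e Reg 18 -e Const 1)) ;;
    If (Get 8 (Reg 19))
       (Set_ 20 (Get 8 (Reg 19) -e Const 1) ;;
        Put a (Reg 20) (Get a (Reg 20) +e Get a (Reg 19))) Skip).

(** The edge from a parent into [y] lies on a required path exactly when the subtree of [y] contains
    a target, that is, when the sum in array 12 is positive. One pass over the queue thus outputs
    the union of all paths from the root, each edge once, whatever their overlap. *)
Definition path_out : prog :=
  For 18 15 (
    Set_ 19 (Get 10 (Reg 18)) ;;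
    If (Get 8 (Reg 19))
      (If (Get 12 (Reg 19)) (emit (Get 8 (Reg 19) -e Const 1) (Reg 19)) Skip)
      Skip).

(** Register 32 holds the next vertex plus one, in the encoding of array 8, so the 0 stored at the
    root ends the climb. *)
Definition add_path : prog :=
  Set_ 32 (Reg 31 +e Const 1) ;;
  While (Reg 32)
    (Set_ 16 (Reg 32 -e Const 1) ;; add_nbrs ;; Set_ 32 (Get 8 (Reg 16))).

Definition add_rows : prog :=
  For 30 15 (
    Set_ 31 (Get 10 (Reg 30)) ;;
    If (Get 8 (Reg 31))
      (If (Reg 4 <e Get 9 (Reg 31))
        (If (Reg 4 <e Get 9 (Get 8 (Reg 31) -e Const 1)) Skip
          (If (Reg 5 <e Get 11 (Reg 31)) (add_path ;; Set_ 21 (Reg 21 +e Const 1)) Skip))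
        Skip)
      Skip).

Definition process : prog :=
  Set_ 9 (Get 24 (Reg 28)) ;; bfs ;; prep ;; gather 11 ;; gather 12 ;;
  path_out ;; add_rows.

Lemma wpb_if_true W (W1 : 1 < W) e p q s T T' (Q : state -> Prop) :
  safe W s e -> truth s e -> wpb W p s T Q -> (ecost e).+1 + T <= T' ->
  wpb W (If e p q) s T' Q.
Proof. by move=> se tr wp TT; apply: (wpb_if W1 se _ _ TT); rewrite tr. Qed.

Lemma wpb_if_false W (W1 : 1 < W) e p q s T T' (Q : state -> Prop) :
  safe W s e -> ~~ truth s e -> wpb W q s T Q -> (ecost e).+1 + T <= T' ->
  wpb W (If e p q) s T' Q.
Proof. by move=> se tr wq TT; apply: (wpb_if W1 se _ _ TT) => [|//]; rewrite (negbTE tr). Qed.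

Section PerVertex.
Variables (n W : nat) (x0 : 'I_n).
Hypotheses (n_gt1 : 1 < n) (W_big : 16 * (n * n * n) <= W).
Local Notation V := 'I_n.
Implicit Types (x y z u v : V) (o l : seq (V * V)) (row : nat -> seq V).
Implicit Types (q : seq V) (p : ptree V).
Local Notation wpb := (wpb W).
Local Notation gstate := (gstate x0).
Local Notation holds := (holds x0).
Local Notation rstate := (rstate x0).
Local Notation outrep := (outrep x0).
Let W1 := W_gt1 n_gt1 W_big.
Let ss := sizes n_gt1 W_big.

Variable l : seq (V * V).
Hypotheses (l_uniq : uniq l) (l_sym : forall x y, ((x, y) \in l) = ((y, x) \in l)).
Local Notation bfs_result := (bfs_result x0 l).
Let g : rel V := fun x y => (x, y) \in l.
Let w x := size (adjl l x).

Lemma res_frame s s' prg v q p d : frame prg s s' ->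
  (15 \notin wregs prg) && ~~ has (mem [:: 7; 8; 9; 10]) (warrs prg) ->
  bfs_result s v q p d -> bfs_result s' v q p d.
Proof.
move=> [fr fa] /andP[r15 /hasPn ap] [cert hold tail seen par size_q wt].
have a k : k \in [:: 7; 8; 9; 10] -> arrs s' k = arrs s k.
  by move=> k01; apply: fa; apply: contraL k01 => /ap.
by split; rewrite ?fr ?a.
Qed.

Lemma res_queue_lt s v q p d : bfs_result s v q p d -> size q < W.
Proof.
by move=> res; have := size_uniq_ord (cert_uniq (res_cert res)); have [] := ss; lia.
Qed.

Lemma prep_ok s v q p d (S : seq V) : gstate l s -> bfs_result s v q p d ->
  (forall x, arrs s 25 x = (x \in S)) ->
  wpb prep s (50 * size l + 10) (fun s' =>
    [/\ bfs_result s' v q p d, forall y, arrs s' 7 y = 0,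
       forall y, y \in q -> arrs s' 11 y = w y
     & forall y, y \in q -> arrs s' 12 y = (y \in S) && (arrs s 9 y <= regs s 6)]).
Proof.
move=> gs res aS; have [s0 s1 sa sd] := gs; rewrite /prep.
have qW := res_queue_lt res.
pose I i s' := [/\ forall y, y \notin drop i q -> arrs s' 7 y = 0,
       forall y, y \in take i q -> arrs s' 11 y = w y
     & forall y, y \in take i q -> arrs s' 12 y = (y \in S) && (arrs s 9 y <= regs s 6)].
wpb_loop W1 (size q) 35 I.
- exact: res_tail res.
- by rewrite /I take0 drop0; split=> //; upds; apply: res_seen res.
- move=> i s' iq fr ri [a7 a11 a12].
  pose y := nth x0 q i; have yq : y \in q by rewrite mem_nth.
  have ay : arrs s 10 i = y by apply: (res_queue res).
  have [dy _] := sd y.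
  have a7' z : z \notin drop i.+1 q -> upd (arrs s' 7) y 0 z = 0.
    rewrite upd_ord => zi; case: (z =P y) => // /eqP zy; apply: a7.
    by rewrite (drop_nth x0) // inE negb_or zy.
  have tk (c : nat -> nat) (c' : V -> nat) k : (forall z, z \in take i q -> c z = c' z) -> k = c' y ->
      forall z, z \in take i.+1 q -> upd c y k z = c' z.
    move=> cc' kE z; rewrite (take_nth x0) // mem_rcons inE upd_ord.
    by case: (z =P y) => [->//|_ /cc'].
  have upd2 (c : nat -> nat) j k z : upd (upd c y j) y k z = upd c y k z by rewrite /upd; case: eqP.
  vcs W1; rewrite ay dy aS; split_vc; rewrite /I; upds; split=> //.
  + exact: tk.
  + by apply: tk => //; rewrite c leqNgt c0.
  + exact: tk.
  + move=> z zi; rewrite upd2; apply: (tk _ (fun z => nat_of_bool ((z \in S) && (arrs s 9 z <= regs s 6))) 1 a12 _ z zi).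
    by rewrite c leqNgt c0.
  + exact: tk.
  + by apply: tk => //; rewrite (negbTE c).
- by have := res_size res; lia.
- move=> s' fr [a7 a11 a12]; rewrite take_size in a11 a12.
  have a7' y : arrs s' 7 y = 0 by apply: a7; rewrite drop_size.
  split=> //; case: res => cert hold tail seen par size_q wt.
  by split=> //; rewrite ?(proj1 fr 15 isT) ?(proj2 fr 8 isT) ?(proj2 fr 9 isT) ?(proj2 fr 10 isT).
Qed.

Lemma gather_ok a s v q p d (w0 : V -> nat) : a \in [:: 11; 12] ->
  bfs_result s v q p d -> (forall y, y \in q -> arrs s a y = w0 y) ->
  \sum_x w0 x <= n * n ->
  wpb (gather a) s (40 * size l + 10) (fun s' =>
    forall y, y \in q -> arrs s' a y = subtree_weight w0 p y).
Proof.
move=> a12 res aw sumw; rewrite /gather.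
have [n1 n2 n3] := ss; have qW := res_queue_lt res; have cert := res_cert res.
have uq := cert_uniq cert.
have par_q x y : p y = Some x -> y \in q /\ index x q < index y q.
  by case/(cert_parE cert) => yq _ _ _ [].
have dS := cert_depth cert.
pose I i s' := forall y, y \in q -> arrs s' a y = gathered q p w0 (size q - i) y.
wpb_loop W1 (size q) 30 I.
- exact: res_tail res.
- by rewrite /I => y yq /=; rewrite subn0 aw // (gathered_init w0 par_q).
- move=> i s' iq fr ri Ii.
  have jq : size q - i.+1 < size q by lia.
  pose j := size q - i.+1; pose y := nth x0 q j.
  have yq : y \in q by rewrite mem_nth.
  have jE : index y q = j by rewrite index_uniq.
  have ay : arrs s' 10 j = y.
    rewrite (proj2 fr 10); last by move: a12; rewrite !inE => /orP[]/eqP->.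
    by apply: (res_queue res).
  have py : arrs s' 8 y = if p y is Some x then x.+1 else 0.
    rewrite (proj2 fr 8); last by move: a12; rewrite !inE => /orP[]/eqP->.
    exact: (res_par res).
  have r15 : regs s' 15 = size q by rewrite (proj1 fr 15 isT) (res_tail res).
  clear fr.
  have idxE : size q - i - 1 = j by rewrite /j -subnDA addn1.
  have jS : size q - i = j.+1 by rewrite /j subnSK.
  have aty : arrs s' a y = subtree_weight w0 p y.
    by rewrite Ii // jS -jE (gathered_done w0 dS par_q).
  have yn := ltn_ord y.
  have fin z : z \in q -> arrs s' a z + (if p y == Some z then subtree_weight w0 p y else 0) =
      gathered q p w0 (size q - i.+1) z.
    by move=> zq; rewrite Ii // jS -/j (gatheredS p w0 z yq jE).
  have small z : z \in q -> gathered q p w0 (size q - i.+1) z <= n * n.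
    by move=> zq; apply: leq_trans sumw; apply: (gathered_le q w0 dS).
  case pyE: (p y) py fin => [x|] py fin.
    have [_ _ xq _ _] := cert_parE cert pyE; have xn := ltn_ord x.
    have := fin x xq; have := small x xq; rewrite eqxx => sx finx.
    vcs W1; rewrite idxE ay py subn1 /= aty; split_vc => //; try by lia.
    rewrite /I => z zq; upds; rewrite upd_eq upd_ord; case: (z =P x) => [->|/eqP zx].
      by rewrite finx.
    by rewrite -fin // eq_sym (_ : (Some z == Some x) = (z == x)) // (negbTE zx) addn0.
  vcs W1; rewrite idxE ay py; split_vc => //; try by lia.
  by rewrite /I => z zq; upds; rewrite -fin // addn0.
- by have := res_size res; lia.
- by move=> s' fr Iq y yq; rewrite Iq // subnn (gathered0 q w0 dS).
Qed.

Lemma path_out_ok s v q p d o (mk : V -> nat) : bfs_result s v q p d ->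
  outrep s o -> size o + n < W -> (forall y, y \in q -> arrs s 12 y = mk y) ->
  wpb path_out s (50 * size l + 10) (fun s' =>
    outrep s' (o ++ tree_list p [seq y <- q | 0 < mk y])).
Proof.
move=> res [s7 so] oW amk; rewrite /path_out.
have qn := size_uniq_ord (cert_uniq (res_cert res)); have qW := res_queue_lt res.
pose ll i := o ++ tree_list p [seq y <- take i q | 0 < mk y].
wpb_loop W1 (size q) 40 (fun i s' => outrep s' (ll i)).
- exact: res_tail res.
- by rewrite /outrep /ll take0 cats0; upds.
- move=> i s' iq fr ri [s'7 s'o].
  pose y := nth x0 q i; have yq : y \in q by rewrite mem_nth.
  have ay : arrs s 10 i = y by apply: (res_queue res).
  have py := res_par res yq.
  have szl : size (ll i) <= size o + i.
    rewrite size_cat leq_add2l; apply: leq_trans (size_tree_list _ _) _.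
    by apply: leq_trans (size_subseq (filter_subseq _ _)) _; rewrite size_take iq.
  have lli : ll i.+1 = ll i ++
      (if 0 < mk y then (if p y is Some x then [:: (x, y)] else [::]) else [::]).
    rewrite /ll (take_nth x0) // filter_rcons -/y; case: (0 < mk y); last by rewrite cats0.
    by rewrite -cats1 /tree_list pmap_cat catA /=; case: (p y).
  have yn := ltn_ord y.
  case pyE: (p y) py lli => [x|] py lli; last first.
    vcs W1; rewrite ay py; split_vc => //.
    by rewrite lli if_same cats0 /outrep; upds.
  have xn := ltn_ord x.
  rewrite lt0n in lli; vcs W1; rewrite ay py (amk y yq) subn1 /=; split_vc => //; try by have [] := ss; lia.
    by rewrite lli c0 cats1 /outrep; upds; apply: outrep_rcons.
  by rewrite lli c0 cats0 /outrep; upds.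
- by have := res_size res; lia.
- by move=> s' fr; rewrite /ll take_size.
Qed.

Lemma add_path_ok s v q p d u r row : gstate l s -> bfs_result s v q p d -> 0 < w v ->
  u \in q -> regs s 31 = u -> regs s 21 = r -> r < n * n -> row r = [::] ->
  rstate s (n * n) row ->
  wpb add_path s (130 * arrs s 9 u + 20) (fun s' => exists2 c,
    rstate s' (n * n) (upd row r c)
    & forall x, (x \in c) = [exists y, anc p y u && ((y, x) \in l)]).
Proof.
move=> gs res wv uq s31 s21 rn rowr rs; rewrite /add_path.
have [n1 n2 n3] := ss; have un := ltn_ord u.
have pos := cert_pos l_sym (res_cert res) wv.
wpb_step 4 (130 * arrs s 9 u + 16).
vcg W1; first by lia.
set s2 := State _ _.
have gs2 : gstate l s2 by rewrite /gstate /s2; upds.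
have res2 : bfs_result s2 v q p d by case: res => *; split.
pose code (cur : option V) := if cur is Some z then z.+1 else 0.
(* [cur] is the next vertex of the climb. Despite its name, [done_ cur] holds at the vertices still
   to be visited; the row has collected the neighbours of the path vertices at which it fails. *)
pose done_ (cur : option V) y := if cur is Some z then anc p y z else false.
(* The potential is 130 times [f] at the next vertex. Moving to the parent lowers [f] by the degree
   of the vertex left, which pays for the insertion of its neighbours. *)
pose I phi s' := exists cur c, [/\ regs s' 32 = code cur,
  phi = 130 * (if cur is Some z then arrs s 9 z else 0) + 4,
  rstate s' (n * n) (upd row r c), forall z, cur = Some z -> z \in q /\ anc p z u
  & forall x, (x \in c) = [exists y, [&& anc p y u, ~~ done_ cur y & (y, x) \in l]]].
apply: (@wpb_while _ W1 _ _ _ (130 * arrs s 9 u + 4) _ I) => //.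
- move=> phi s' fr [[z|] [c [r32 -> rs' cur cE]]] /=; rewrite r32 //= => _.
  have [zq zu] := cur _ erefl; have zn := ltn_ord z.
  have {}gs' := gstate_frame fr isT gs2; have [s0 _ _ sd] := gs'.
  have res' := res_frame fr isT res2; have cert := res_cert res'.
  have fE y : arrs s' 9 y = arrs s 9 y by rewrite (proj2 fr 9 isT).
  have r21 : regs s' 21 = r by rewrite (proj1 fr 21 isT) /s2; upds.
  have wz : 0 < w z by [apply: pos]; clear fr.
  exists (4 + ((70 * w z + 20) + 4)).
  wpb_step 4 ((70 * w z + 20) + 4).
  vcs W1; rewrite subn1 /=; split_vc; first by lia.
  set s3 := State _ _.
  have gs3 : gstate l s3 by rewrite /gstate /s3; upds.
  apply: (@wpb_seq _ _ _ _ (70 * w z + 20) 4) => //.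
  apply: wpb_conseq; first apply: (@add_nbrs_ok n W x0 n_gt1 W_big l s3 (n * n) (upd row r c) r z) => //.
  - exact: leqnn.
  move=> s4 fr4 [c' rs4 c'E].
  have r16 : regs s4 16 = z by rewrite (proj1 fr4 16 isT) /s3; upds.
  have a8 : arrs s4 8 z = code (p z) by rewrite (proj2 fr4 8 isT) (res_par res').
  clear fr4; vcs W1; rewrite a8; split_vc.
  exists (130 * (if p z is Some t then arrs s 9 t else 0) + 4); split.
    suff -> : arrs s 9 z = (if p z is Some t then arrs s 9 t else 0) + w z by lia.
    case pz: (p z) => [t|].
      have [_ _ _ _ [_ + _]] := cert_parE cert pz.
      by rewrite !fE.
    have [zv|zv] := eqVneq z v; last first.
      by have [t [pzt _ _ _ _]] := cert_par cert zq zv; rewrite pzt in pz.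
    by have [_ _ _] := cert_root cert; rewrite -zv fE.
  exists (p z), c'; split=> //; upds => //.
  + rewrite /rstate; upds; apply: (rstate_ext _ rs4) => r'.
    by rewrite /upd; case: eqP.
  + move=> t pz; have [_ _ tq _ _] := cert_parE cert pz; split=> //.
    by apply: connect_trans zu; apply: connect1; rewrite /child /= pz.
  + have notz y : done_ (p z) y -> anc p y z.
      rewrite /done_; case pz: (p z) => [t|//] yt.
      by rewrite (anc_parent _ pz) yt orbT.
    have zz : ~~ done_ (p z) z.
      rewrite /done_; case pz: (p z) => [t|//]; apply/negP => /(anc_leq (cert_depth cert)).
      by rewrite (cert_depth cert pz) ltnn.
    have back y : anc p y z -> ~~ done_ (p z) y -> y = z.
      rewrite /done_; case pz: (p z) => [t|]; last by rewrite (anc_root _ pz) => /eqP.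
      by rewrite (anc_parent _ pz) => /orP[/eqP//|->].
    move=> x; rewrite c'E upd_eq cE; apply/orP/existsP => [[/existsP[y /and3P[yu yz yx]]|zx]|[y /and3P[yu yz yx]]].
    * by exists y; rewrite yu yx andbT; apply: contra yz; apply: notz.
    * by exists z; rewrite zu zz.
    * have [yz'|yz'] := boolP (anc p y z); first by right; rewrite -(back y yz' yz).
      by left; apply/existsP; exists y; rewrite yu yx andbT.
- move=> phi s' fr [[z|] [c [r32 -> rs' cur cE]]] /=; rewrite r32 //= => _.
  by split=> //; exists c.
- exists (Some u), [::]; rewrite /s2; upds; split=> //.
  + by rewrite addn1.
  + by apply: (rstate_ext _ rs) => r'; rewrite /upd; case: eqP => [->|].
  + by move=> z [<-]; rewrite anc_refl.
  + move=> x; rewrite in_nil; apply/esym/existsP => -[y /and3P[yu]].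
    by rewrite /done_ yu.
- by lia.
Qed.

Lemma add_rows_ok s v q p d row m0 tp t3 (f : V -> nat) : gstate l s ->
  bfs_result s v q p d -> 0 < w v -> f = arrs s 9 :> (V -> nat) ->
  (forall y, y \in q -> arrs s 11 y = subtree_weight w p y) ->
  regs s 4 = tp -> regs s 5 = t3 -> 3 * tp <= t3 ->
  regs s 21 = m0 -> m0 + n <= n * n -> rstate s (n * n) row ->
  (forall r, m0 <= r -> row r = [::]) ->
  wpb add_rows s (400 * size l + 10) (fun s' => exists row',
    let us := [seq u <- q | frontier w p f tp t3 u] in
    [/\ regs s' 21 = m0 + size us, rstate s' (n * n) row',
       forall r, r < m0 -> row' r = row r,
       forall r x, r < size us ->
         (x \in row' (m0 + r)) = [exists y, anc p y (nth x0 us r) && ((y, x) \in l)]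
     & forall r, m0 + size us <= r -> row' r = [::]]).
Proof.
move=> gs res wv fE a11 s4 s5 tpt3 s21 m0n rs nil; rewrite /add_rows.
have [n1 n2 n3] := ss; have qW := res_queue_lt res; have cert := res_cert res.
have uq := cert_uniq cert.
have qn := size_uniq_ord uq.
pose fr_ := frontier w p f tp t3.
pose us i := [seq u <- take i q | fr_ u].
pose I i s' := exists row',
    [/\ regs s' 21 = m0 + size (us i), rstate s' (n * n) row',
       forall r, r < m0 -> row' r = row r,
       forall r x, r < size (us i) ->
         (x \in row' (m0 + r)) = [exists y, anc p y (nth x0 (us i) r) && ((y, x) \in l)]
     & forall r, m0 + size (us i) <= r -> row' r = [::]].
apply: (@wpb_for _ W1 _ _ _ _ (size q)
  (fun i => 40 + (if fr_ (nth x0 q i) then 130 * f (nth x0 q i) + 30 else 0)) _ I) => //.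
- exact: res_tail res.
- by exists row; rewrite /us take0 addn0; upds; split.
- move=> i s' iq fr ri [row' [r21 rs' old new nil']].
  pose u := nth x0 q i; have uq' : u \in q by rewrite mem_nth.
  have usS : us i.+1 = if fr_ u then rcons (us i) u else us i.
    by rewrite /us (take_nth x0) // filter_rcons.
  have szus : size (us i) <= i.
    by apply: leq_trans (size_subseq (filter_subseq _ _)) _; rewrite size_take iq.
  have au : arrs s' 10 i = u by rewrite (proj2 fr 10 isT); apply: (res_queue res).
  have pu : arrs s' 8 u = if p u is Some x then x.+1 else 0.
    by rewrite (proj2 fr 8 isT) (res_par res).
  have a9 y : arrs s' 9 y = f y by rewrite (proj2 fr 9 isT) fE.
  have a11' : arrs s' 11 u = subtree_weight w p u by rewrite (proj2 fr 11 isT) a11.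
  have r4 : regs s' 4 = tp by rewrite (proj1 fr 4 isT).
  have r5 : regs s' 5 = t3 by rewrite (proj1 fr 5 isT).
  have gs' : gstate l s' := gstate_frame fr isT gs.
  have res' : bfs_result s' v q p d := res_frame fr isT res.
  clear fr; rewrite -/u.
  have un := ltn_ord u.
  have keep : ~~ fr_ u -> I i.+1 (State (upd (upd (regs s') 31 u) 30 i.+1) (arrs s')).
    by move=> nfr; exists row'; rewrite usS (negbTE nfr); upds; split.
  case: (boolP (fr_ u)) keep => [fru _|nfr /(_ isT) keep]; last first.
    case pE: (p u) pu => [z|] pu; last first.
      by vcs W1; rewrite au pu; split_vc => //; exact: keep.
    have zn := ltn_ord z.
    vcs W1; rewrite au pu subn1 /= !a9 a11'; split_vc;
      first [exact: keep | by lia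
            | by case/negP: nfr; rewrite /fr_ /frontier pE c0 leqNgt c1].
  have [z pE] : exists z, p u = Some z.
    by move: fru; rewrite /fr_ /frontier; case: (p u) => // z _; exists z.
  have zn := ltn_ord z.
  have := fru; rewrite {1}/fr_ /frontier pE => /and3P[f1 f2 f3].
  rewrite pE in pu.
  wpb_step 3 (130 * f u + 67).
  vcs W1; rewrite au; split_vc; set s3 := State _ _.
  have safe8 : safe W s3 (Get 8 (Reg 31)) by [].
  apply: (@wpb_if_true _ W1 _ _ _ _ (130 * f u + 60)) => //=; last by lia.
    by rewrite /s3; upds; rewrite pu.
  apply: (@wpb_if_true _ W1 _ _ _ _ (130 * f u + 50)) => //=; last by lia.
    by rewrite /s3; upds; rewrite a9 r4.
  apply: (@wpb_if_false _ W1 _ _ _ _ (130 * f u + 40)) => //=; last by lia.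
  + by rewrite /s3; upds; rewrite pu; split=> //; split=> //; lia.
  + by rewrite /s3; upds; rewrite pu subn1 /= a9 r4 -leqNgt.
  apply: (@wpb_if_true _ W1 _ _ _ _ (130 * f u + 30)) => //=; last by lia.
    by rewrite /s3; upds; rewrite a11' r5.
  have gs3 : gstate l s3 by rewrite /gstate /s3; upds.
  have res3 : bfs_result s3 v q p d by case: res' => *; split.
  have s3u : regs s3 31 = u by rewrite /s3; upds.
  have s321 : regs s3 21 = m0 + size (us i) by rewrite /s3; upds.
  have small : m0 + size (us i) < n * n by lia.
  have rowz : row' (m0 + size (us i)) = [::] by apply: nil'.
  have rs3 : rstate s3 (n * n) row' by rewrite /rstate /s3; upds.
  have := add_path_ok gs3 res3 wv uq' s3u s321 small rowz rs3.
  have -> : arrs s3 9 u = f u by rewrite /s3; upds; rewrite a9.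
  move=> ap; wpb_step (130 * f u + 20) 4.
  apply: (wpb_conseq ap) => // s4' fr4 [c rs4 cE].
  have r21' : regs s4' 21 = m0 + size (us i) by rewrite (proj1 fr4 21 isT).
  clear fr4; vcg W1; first by lia.
  exists (upd row' (m0 + size (us i)) c); rewrite usS fru size_rcons; upds; split.
  + by rewrite addn1 addnS.
  + by rewrite /rstate; upds.
  + by move=> r rm; rewrite upd_neq ?old //; lia.
  + move=> r x; rewrite ltnS leq_eqVlt nth_rcons => /predU1P[->|ri'].
      by rewrite upd_eq cE ltnn eqxx.
    by rewrite upd_neq ?ri' ?new // eqn_add2l (ltn_eqF ri').
  + by move=> r rm; rewrite upd_neq ?nil' //; lia.
(* On the frontier [f u] exceeds [tp], hence is at least 1, so the fixed cost 30 is absorbed: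
   [130 * f u + 30 <= 160 * f u]. *)
- have fsum : \sum_(u <- q) (if fr_ u then 130 * f u + 30 else 0) <= 160 * (2 * size l).
    rewrite big_uniq //= -big_mkcondr /=.
    apply: (@leq_trans (\sum_(u | fr_ u) 160 * f u)); last first.
      rewrite -big_distrr leq_mul2l -sum_size_adjl /=.
      have cf : bfs_cert g w v q p d f by rewrite fE.
      exact: (frontier_sum cf tpt3).
    apply: leq_trans (leq_sum_sub _ _) _; first by move=> u /andP[_ fu]; exact: fu.
    apply: leq_sum => u; rewrite /fr_ /frontier; case: (p u) => [z|//] /and3P[fu _ _].
    by lia.
  have -> : \sum_(i < size q) (40 + (if fr_ (nth x0 q i) then 130 * f (nth x0 q i) + 30 else 0) + 8)
     = 48 * size q + \sum_(u <- q) (if fr_ u then 130 * f u + 30 else 0).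
    rewrite (big_nth x0) big_mkord.
    rewrite (eq_bigr (fun i : 'I_(size q) => 48 + (if fr_ (nth x0 q i) then 130 * f (nth x0 q i) + 30 else 0))); last by move=> i _; lia.
    by rewrite big_split /= sum_nat_const card_ord mulnC.
  by have := res_size res; lia.
- move=> s' fr [row' [r21 rs' old new nil']]; exists row'.
  by rewrite /us take_size in r21 new nil'; split.
Qed.

(** * The loops over S1 and S2 *)

Definition s1_loop : prog := For 28 29 process.

Definition s2_loop : prog :=
  For 28 29 (Set_ 9 (Get 24 (Reg 28)) ;; bfs ;; tree_out).

Lemma set_rcons (T : finType) (s : seq T) (x : T) : [set y in rcons s x] = x |: [set y in s].
Proof. by apply/setP => y; rewrite !inE mem_rcons inE. Qed.

Implicit Types S : seq V.

Lemma take_next S i : uniq S -> i < size S ->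
  take i.+1 S = rcons (take i S) (nth x0 S i) /\ nth x0 S i \notin take i S.
Proof.
move=> uS iS; rewrite (take_nth x0) //; split=> //.
by have := take_uniq i.+1 uS; rewrite (take_nth x0) // rcons_uniq => /andP[].
Qed.

(** A 0-1 weight in [nat], so that [subtree_weight] counts the endpoints of required paths below a
    vertex. *)
Definition target (S : seq V) q (f : V -> nat) t5 u : nat :=
  [&& u \in q, u \in S & f u <= t5].

Lemma path_edges_out S v q p d f t5 : bfs_cert g w v q p d f ->
  edge_set (tree_list p [seq y <- q | 0 < subtree_weight (target S q f t5) p y]) =
  \bigcup_(u in [set x in S] | connect g v u && (f u <= t5)) path_edges p u.
Proof.
move=> cert; apply/setP => B; rewrite mem_edge_set; apply/mapP/bigcupP.
  move=> [[x y]]; rewrite mem_tree_list mem_filter subtree_weight_gt0.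
  case/andP=> /andP[/existsP[u /andP[yu tu]] yq] pyx ->.
  move: tu; rewrite lt0b => /and3P[uq uS fu]; exists u.
    by rewrite inE uS (cert_connect cert) uq fu.
  by rewrite inE; apply/existsP; exists x; apply/existsP; exists y; rewrite /child /= pyx yu eqxx.
move=> [u]; rewrite inE (cert_connect cert) => /and3P[uS uq fu].
rewrite inE => /existsP[x /existsP[y /and3P[pyx yu /eqP->]]]; exists (x, y) => //.
rewrite mem_tree_list [_ == _]pyx andbT mem_filter (cert_anc_mem cert uq yu) andbT.
rewrite subtree_weight_gt0; apply/existsP; exists u.
by rewrite yu lt0b uq uS fu.
Qed.

Lemma process_ok S s i o row m0 tp t3 : gstate l s -> (forall y, arrs s 7 y = 0) ->
  holds (arrs s 24) S -> regs s 28 = i -> i < size S ->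
  (forall x, arrs s 25 x = (x \in S)) -> 0 < w (nth x0 S i) ->
  outrep s o -> size o + n < W -> regs s 4 = tp -> regs s 5 = t3 -> 3 * tp <= t3 ->
  regs s 21 = m0 -> m0 + n <= n * n -> rstate s (n * n) row ->
  (forall r, m0 <= r -> row r = [::]) ->
  wpb process s (710 * size l + 100) (fun s' => exists q p d f row',
    let us := [seq u <- q | frontier w p f tp t3 u] in
    [/\ bfs_cert g w (nth x0 S i) q p d f, forall y, arrs s' 7 y = 0,
      outrep s' (o ++ tree_list p
        [seq y <- q | 0 < subtree_weight (target S q f (regs s 6)) p y]),
      regs s' 21 = m0 + size us
    & [/\ rstate s' (n * n) row', forall r, r < m0 -> row' r = row r,
       forall r x, r < size us ->
         (x \in row' (m0 + r)) = [exists y, anc p y (nth x0 us r) && ((y, x) \in l)]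
     & forall r, m0 + size us <= r -> row' r = [::]]]).
Proof.
set v := nth x0 S i; move=> gs D0 hS s28 iS aS wv oo oW s4 s5 tpt3 s21 m0n rs nil.
have [n1 n2 n3] := ss; rewrite /process.
wpb_step 3 (710 * size l + 97).
vcs W1; rewrite (hS i iS) -/v; split_vc; set s2 := State _ _.
have gs2 : gstate l s2 by rewrite /gstate /s2; upds.
have r9 : regs s2 9 = v by rewrite /s2; upds.
wpb_step (130 * size l + 40) (580 * size l + 57).
apply: (wpb_conseq (bfs_ok n_gt1 W_big l_uniq l_sym gs2 D0 r9 wv)) => //.
move=> s3 fr3 [q [p [d res]]]; have cert := res_cert res.
have gs3 := gstate_frame fr3 isT gs2.
have aS3 x : arrs s3 25 x = (x \in S) by rewrite (proj2 fr3 25 isT); apply: aS.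
pose f : V -> nat := fun x => arrs s3 9 x.
wpb_step (50 * size l + 10) (530 * size l + 47).
apply: (wpb_conseq (prep_ok gs3 res aS3)) => //.
move=> s4' fr4 [res4 D04 a11 a12].
have f4 : f = arrs s4' 9 :> (V -> nat) by rewrite /f (proj2 fr4 9 isT).
wpb_step (40 * size l + 10) (490 * size l + 37).
have sumw : \sum_x w x <= n * n by rewrite sum_size_adjl; apply: size_uniq_pairs.
apply: (wpb_conseq (gather_ok (a := 11) isT res4 a11 sumw)) => //.
move=> s5' fr5 a11'.
have res5 : bfs_result s5' v q p d := res_frame fr5 isT res4.
pose t5 := regs s 6.
have r6 : regs s3 6 = t5 by rewrite (proj1 fr3 6 isT).
have a12' y : y \in q -> arrs s5' 12 y = target S q f t5 y.
  by move=> yq; rewrite (proj2 fr5 12 isT) a12 // /target yq r6.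
have sumt : \sum_x target S q f t5 x <= n * n.
  apply: leq_trans (leq_sum _ (fun x _ => leq_b1 _)) _.
  by rewrite sum_nat_const card_ord; lia.
wpb_step (40 * size l + 10) (450 * size l + 27).
apply: (wpb_conseq (gather_ok (a := 12) isT res5 a12' sumt)) => //.
move=> s6 fr6 a12''.
have res6 : bfs_result s6 v q p d := res_frame fr6 isT res5.
have oo6 : outrep s6 o.
  by apply: (outrep_frame fr6 isT); apply: (outrep_frame fr5 isT);
     apply: (outrep_frame fr4 isT); apply: (outrep_frame fr3 isT).
wpb_step (50 * size l + 10) (400 * size l + 17).
apply: (wpb_conseq (path_out_ok res6 oo6 oW a12'')) => //.
move=> s7' fr7 oo7.
have res7 : bfs_result s7' v q p d := res_frame fr7 isT res6.
have gs7 : gstate l s7'.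
  by apply: (gstate_frame fr7 isT); apply: (gstate_frame fr6 isT);
     apply: (gstate_frame fr5 isT); apply: (gstate_frame fr4 isT).
have reg k : (k \in [:: 4; 5; 21]) -> regs s7' k = regs s k.
  by rewrite !inE => /or3P[]/eqP->; rewrite (proj1 fr7) // (proj1 fr6) //
    (proj1 fr5) // (proj1 fr4) // (proj1 fr3).
have rs7 : rstate s7' (n * n) row.
  have arr a : a \in [:: 20; 21; 22; 23] -> arrs s7' a = arrs s a.
    by rewrite !inE => /or4P[]/eqP->; rewrite (proj2 fr7) // (proj2 fr6) //
      (proj2 fr5) // (proj2 fr4) // (proj2 fr3).
  by rewrite /rstate !arr.
have f7 : f = arrs s7' 9 :> (V -> nat).
  by rewrite (proj2 fr7 9 isT) (proj2 fr6 9 isT) (proj2 fr5 9 isT).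
have a117 y : y \in q -> arrs s7' 11 y = subtree_weight w p y.
  by move=> yq; rewrite (proj2 fr7 11 isT) (proj2 fr6 11 isT) a11'.
have s74 : regs s7' 4 = tp by rewrite reg.
have s75 : regs s7' 5 = t3 by rewrite reg.
have s721 : regs s7' 21 = m0 by rewrite reg.
apply: (wpb_conseq (add_rows_ok gs7 res7 wv f7 a117 s74 s75 tpt3 s721 m0n rs7 nil)).
  by lia.
move=> s8 fr8 [row' [r21 rs8 old new nil']]; exists q, p, d, f, row'.
split=> //; last by apply: (outrep_frame fr8 isT).
by move=> y; rewrite (proj2 fr8 7 isT) (proj2 fr7 7 isT) (proj2 fr6 7 isT) (proj2 fr5 7 isT).
Qed.

(** The rows of all roots are numbered consecutively, in the order of [tg]. The bounds [i * n] on
    the number of rows and on the output keep table addresses and output positions below [W]. *)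
Definition s1_inv S tp t3 t5 i (T : V -> ptree V) (f : V -> V -> nat)
    (tg : seq (V * V)) row o s : Prop :=
  [/\ forall v, v \in take i S -> exists q d, bfs_cert g w v q (T v) d (f v),
      uniq tg,
      forall v u, ((v, u) \in tg) = (v \in take i S) && frontier w (T v) (f v) tp t3 u,
      forall r x, r < size tg -> (x \in row r) =
        [exists y, anc (T (nth (x0, x0) tg r).1) y (nth (x0, x0) tg r).2 && ((y, x) \in l)]
    & [/\ forall r, size tg <= r -> row r = [::], rstate s (n * n) row, regs s 21 = size tg,
       edge_set o = \bigcup_(v in [set x in take i S])
         \bigcup_(u in [set x in S] | connect g v u && (f v u <= t5)) path_edges (T v) u
     & [/\ size o <= i * n, size tg <= i * n & forall y, arrs s 7 y = 0]]].

Lemma s1_loop_ok S s o tp t3 : gstate l s -> (forall y, arrs s 7 y = 0) ->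
  holds (arrs s 24) S -> uniq S -> regs s 29 = size S ->
  (forall x, arrs s 25 x = (x \in S)) -> (forall x, x \in S -> 0 < w x) ->
  outrep s o -> size o + n * n < W -> regs s 4 = tp -> regs s 5 = t3 -> 3 * tp <= t3 ->
  regs s 21 = 0 -> rstate s (n * n) (fun=> [::]) ->
  wpb s1_loop s ((710 * size l + 108) * size S + 8) (fun s' => exists T f tg row o',
    outrep s' (o ++ o') /\ s1_inv S tp t3 (regs s 6) (size S) T f tg row o' s').
Proof.
move=> gs D0 hS uS s29 aS wS oo oW s4 s5 tpt3 s21 rs.
have [n1 n2 n3] := ss; have Sn := size_uniq_ord uS.
pose I i s' := exists T f tg row o',
  outrep s' (o ++ o') /\ s1_inv S tp t3 (regs s 6) i T f tg row o' s'.
wpb_loop W1 (size S) (710 * size l + 100) I.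
- exists (fun=> [ffun=> None]), (fun _ _ => 0), [::], (fun=> [::]), [::].
  rewrite cats0 /s1_inv take0; upds; split=> //; split=> //; split=> //.
  by rewrite edge_set_nil set_nil big_set0.
- move=> i s' iS fr ri [T [f [tg [row [o' [oo' [certs utg tgE rowE [nil rs' r21 oE [so stg D0']]]]]]]]].
  set v := nth x0 S i; have vS : v \in S by rewrite mem_nth.
  have gs' : gstate l s' := gstate_frame fr isT gs.
  have hS' : holds (arrs s' 24) S by rewrite (proj2 fr 24 isT).
  have aS' x : arrs s' 25 x = (x \in S) by rewrite (proj2 fr 25 isT).
  have r4 : regs s' 4 = tp by rewrite (proj1 fr 4 isT).
  have r5 : regs s' 5 = t3 by rewrite (proj1 fr 5 isT).
  have iSn : i * n + n <= n * n by apply: row_le; apply: leq_trans iS Sn.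
  have oW' : size (o ++ o') + n < W by rewrite size_cat; lia.
  have tgn : size tg + n <= n * n by lia.
  have r6 : regs s' 6 = regs s 6 by rewrite (proj1 fr 6 isT).
  have := process_ok gs' D0' hS' ri iS aS' (wS v vS) oo' oW' r4 r5 tpt3 r21 tgn rs' nil.
  rewrite -/v r6 => proc; clear fr; apply: (wpb_conseq proc) => // s2 fr2.
  move=> [q [p [d [f2 [row' [cert D02 oo2 r212 [rs2 old new nil2]]]]]]].
  set us := [seq u <- q | _] in r212 new nil2.
  have uq := cert_uniq cert.
  have [takeS vNi] := take_next uS iS.
  rewrite -/v in takeS vNi.
  pose T' v' := if v' == v then p else T v'.
  pose f' v' := if v' == v then f2 else f v'.
  have T'v : T' v = p by rewrite /T' eqxx.
  have f'v : f' v = f2 by rewrite /f' eqxx.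
  have T'o v' : v' \in take i S -> T' v' = T v'.
    by move=> vi; rewrite /T'; case: eqP => // E; rewrite -E vi in vNi.
  have f'o v' : v' \in take i S -> f' v' = f v'.
    by move=> vi; rewrite /f'; case: eqP => // E; rewrite -E vi in vNi.
  pose tgv := [seq (v, u) | u <- us].
  exists T', f', (tg ++ tgv), row',
    (o' ++ tree_list p [seq y <- q | 0 < subtree_weight (target S q f2 (regs s 6)) p y]).
  rewrite catA; split; first by rewrite /outrep; upds.
  have tgi r : r < size tg -> (nth (x0, x0) tg r).1 \in take i S.
    move=> rtg; have := mem_nth (x0, x0) rtg; case: (nth _ _ _) => a b /=.
    by rewrite tgE => /andP[].
  split.
  + move=> v'; rewrite takeS mem_rcons inE => /predU1P[->|vi].
      by exists q, d; rewrite T'v f'v.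
    by rewrite T'o // f'o //; apply: certs.
  + rewrite cat_uniq utg /= map_inj_uniq ?filter_uniq // => [|a b []//].
    rewrite andbT; apply/hasPn => -[a b] /mapP[u _ [-> _]].
    by rewrite tgE (negbTE vNi).
  + move=> v' u; rewrite mem_cat tgE takeS mem_rcons inE.
    have -> : ((v', u) \in tgv) = (v' == v) && frontier w p f2 tp t3 u.
      apply/mapP/andP => [[u' + [-> ->]]|[/eqP-> fu]].
        by rewrite mem_filter eqxx => /andP[].
      by exists u => //; rewrite mem_filter fu (frontier_mem cert fu).
    case: (v' =P v) => [->|/eqP v'v] /=; first by rewrite (negbTE vNi) T'v f'v.
    by rewrite orbF; case: (boolP (v' \in take i S)) => //= vi; rewrite T'o // f'o.
  + move=> r x; rewrite size_cat size_map nth_cat; case: (ltnP r (size tg)) => [rtg _|rtg rus].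
      by rewrite old // rowE // T'o ?tgi.
    have rus' : r - size tg < size us by rewrite ltn_subLR.
    by rewrite -{1}(subnKC rtg) new // (nth_map x0) ?T'v.
  + rewrite size_cat size_map; split=> //; upds.
    * rewrite edge_set_cat oE (path_edges_out _ _ cert) takeS set_rcons.
      rewrite bigcup_setU big_set1 [RHS]setUC; congr (_ :|: _); last by rewrite f'v T'v.
      apply: eq_bigr => v'; rewrite inE => vi; rewrite T'o // f'o //.
    * split=> //.
      - rewrite size_cat mulSn addnC; apply: leq_add => //.
        apply: leq_trans (size_tree_list _ _) _.
        apply: leq_trans (size_subseq (filter_subseq _ _)) _.
        exact: size_uniq_ord.
      - rewrite mulSn addnC; apply: leq_add => //.
        apply: leq_trans (size_subseq (filter_subseq _ _)) _.
        exact: size_uniq_ord.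
Qed.

Lemma s2_loop_ok S s o : gstate l s -> (forall y, arrs s 7 y = 0) ->
  holds (arrs s 24) S -> uniq S -> regs s 29 = size S ->
  (forall x, x \in S -> 0 < w x) -> outrep s o -> size o + n * n < W ->
  wpb s2_loop s ((180 * size l + 61) * size S + 8) (fun s' => exists T o',
    [/\ outrep s' (o ++ o'),
      forall v, v \in S -> bfs_tree g v (T v)
    & edge_set o' = \bigcup_(v in [set x in S]) tree_edges (T v)]).
Proof.
move=> gs D0 hS uS s29 wS oo oW.
have [n1 n2 n3] := ss; have Sn := size_uniq_ord uS.
pose I i s' := exists T o',
    [/\ outrep s' (o ++ o'), forall v, v \in take i S -> bfs_tree g v (T v),
     edge_set o' = \bigcup_(v in [set x in take i S]) tree_edges (T v),
     size o' <= i * n & forall y, arrs s' 7 y = 0].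
wpb_loop W1 (size S) (180 * size l + 53) I.
- exists (fun=> [ffun=> None]), [::]; rewrite cats0 take0; split=> //.
  by rewrite edge_set_nil set_nil big_set0.
- move=> i s' iS fr ri [T [o' [oo' bt oE so D0']]].
  set v := nth x0 S i; have vS : v \in S by rewrite mem_nth.
  have gs' : gstate l s' := gstate_frame fr isT gs.
  have av : arrs s' 24 i = v by rewrite (proj2 fr 24 isT) hS.
  have iSn : i * n + n <= n * n by apply: row_le; apply: leq_trans iS Sn.
  have oW' : size (o ++ o') + n < W by rewrite size_cat; lia.
  clear fr; wpb_step 3 (180 * size l + 50).
  vcs W1; rewrite av; split_vc; set s2 := State _ _.
  have gs2 : gstate l s2 by rewrite /gstate /s2; upds.
  have r9 : regs s2 9 = v by rewrite /s2; upds.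
  wpb_step (130 * size l + 40) (50 * size l + 10).
  apply: (wpb_conseq (bfs_ok n_gt1 W_big l_uniq l_sym gs2 D0' r9 (wS v vS))) => //.
  move=> s3 fr3 [q [p [d res]]]; have cert := res_cert res.
  have oo3 : outrep s3 (o ++ o') by apply: (outrep_frame fr3 isT).
  apply: (wpb_conseq (tree_out_ok n_gt1 W_big res oo3 oW')) => // s4 fr4 [D04 oo4].
  have [takeS vNi] := take_next uS iS.
  rewrite -/v in takeS vNi.
  pose T' v' := if v' == v then p else T v'.
  have T'o v' : v' \in take i S -> T' v' = T v'.
    by move=> vi; rewrite /T'; case: eqP => // E; rewrite -E vi in vNi.
  exists T', (o' ++ tree_list p q); rewrite catA takeS; split=> //.
  + move=> v'; rewrite mem_rcons inE => /predU1P[->|vi]; last by rewrite T'o //; apply: bt.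
    by rewrite /T' eqxx; have [] := cert_min_bfs_tree cert.
  + rewrite edge_set_cat oE (edge_set_tree_list (cert_out cert)) set_rcons.
    rewrite bigcup_setU big_set1 [RHS]setUC; congr (_ :|: _); last by rewrite /T' eqxx.
    by apply: eq_bigr => v'; rewrite inE => vi; rewrite T'o.
  + rewrite size_cat mulSn addnC; apply: leq_add => //.
    by apply: leq_trans (size_tree_list _ _) _; apply: size_uniq_ord (cert_uniq cert).
- by move=> s' fr [T [o' [oo' bt oE so _]]]; exists T, o'; rewrite take_size in bt oE.
Qed.

End PerVertex.

(** * Real bounds *)

Section RealBounds.
Import Order.TTheory GRing.Theory Num.Theory.
Local Open Scope ring_scope.
Variable R : realType.

Lemma greedy_seq_set0 (C X : finType) (cand : {set C}) (dom : C -> {set X}) s :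
  greedy_seq cand dom set0 s -> s = [::].
Proof.
case: s => // c s gs; have [_] := greedy_seq_meets gs (mem_head c s).
by rewrite setI0 eqxx.
Qed.

(* A pick removes a share k / N of the U uncovered targets, and
   ln U - ln U' >= (U - U') / U, so that the potential N * ln U pays for it. *)
Lemma greedy_seq_size (C X : finType) (cand : {set C}) (dom : C -> {set X}) U s k :
  greedy_seq cand dom U s ->
  {in U, forall x, (k <= #|[set c in cand | x \in dom c]|)%N} -> U != set0 ->
  (size s)%:R * k%:R <= #|cand|%:R * (1 + ln #|U|%:R) :> R.
Proof.
elim=> [|{}U c {}s cC dU max gs IH] many Un0; first by rewrite eqxx in Un0.
have U1 : (1 : R) <= #|U|%:R by rewrite ler1n card_gt0.
have [y yU] := set0Pn _ Un0.
have kN : (k <= #|cand|)%N.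
  by apply: leq_trans (many _ yU) _; apply/subset_leq_card/subsetP => z; rewrite inE => /andP[].
(* The pick that empties [U] leaves no logarithm to compare with; it is paid by the summand 1, since
   [k] is at most the number of candidates. *)
have [U'0|U'n0] := eqVneq (U :\: dom c) set0.
  have -> : s = [::] by move: gs; rewrite U'0; apply: greedy_seq_set0.
  rewrite mul1r; apply: le_trans (_ : #|cand|%:R <= _); first by rewrite ler_nat.
  by rewrite ler_peMr // lerDl ln_ge0.
have U'1 : (1 : R) <= #|U :\: dom c|%:R by rewrite ler1n card_gt0.
have H : (size s)%:R * k%:R <= #|cand|%:R * (1 + ln #|U :\: dom c|%:R) :> R.
  by apply: IH => // z; rewrite inE => /andP[_ /many].
rewrite /= -[(size s).+1]addn1 natrD mulrDl mul1r.
apply: le_trans (lerD H (lexx _)) _; rewrite !mulrDr mulr1 -addrA lerD2l.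
have split_ln : ln #|U :\: dom c|%:R = ln #|U|%:R + ln (#|U :\: dom c|%:R / #|U|%:R) :> R.
  by rewrite ln_div ?posrE ?(lt_le_trans ltr01) // addrC subrK.
have share := greedy_share many max.
have cU : (#|dom c :&: U| + #|U :\: dom c| = #|U|)%N by rewrite setIC cardsID.
have Upos : (0 : R) < #|U|%:R by apply: lt_le_trans U1.
have U'pos : (0 : R) < #|U :\: dom c|%:R by apply: lt_le_trans U'1.
have ln_le : ln (#|U :\: dom c|%:R / #|U|%:R) <= - (#|dom c :&: U|%:R / #|U|%:R) :> R.
  have -> : #|U :\: dom c|%:R / #|U|%:R = 1 + - (#|dom c :&: U|%:R / #|U|%:R) :> R.
    have Un : #|U|%:R != 0 :> R by rewrite gt_eqF.
    rewrite -mulNr -[X in _ = X + _](divff Un) -mulrDl -cU natrD.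
    by rewrite addrAC subrr add0r.
  apply: le_ln1Dx; rewrite ltrN2 ltr_pdivrMr // mul1r ltr_nat -cU -addn1 leq_add2l.
  by rewrite card_gt0.
have kle : k%:R <= #|cand|%:R * (#|dom c :&: U|%:R / #|U|%:R) :> R.
  by rewrite mulrA ler_pdivlMr // -!natrM ler_nat mulnC.
rewrite split_ln mulrDr -addrA gerDl.
apply: le_trans (lerD (ler_wpM2l (ler0n _ _) ln_le) kle) _.
by rewrite mulrN addNr.
Qed.

Lemma ln_nat_mono (p q : nat) : (0 < p)%N -> (p <= q)%N -> ln p%:R <= ln q%:R :> R.
Proof.
move=> p0 pq; rewrite ler_ln ?posrE ?ltr0n ?ler_nat //.
exact: leq_trans pq.
Qed.

Lemma greedy_seq_bound (C X : finType) (cand : {set C}) (dom : C -> {set X}) U s k M N :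
  greedy_seq cand dom U s ->
  {in U, forall x, (k <= #|[set c in cand | x \in dom c]|)%N} ->
  (#|cand| <= M)%N -> (#|U| <= N)%N -> (0 < N)%N ->
  (size s)%:R * k%:R <= M%:R * (1 + ln N%:R) :> R.
Proof.
move=> gs many cM UN N0; have lnN : 0 <= ln N%:R :> R by rewrite ln_ge0 ?ler1n.
have [U0|Un0] := eqVneq U set0.
  by move: gs; rewrite U0 => /greedy_seq_set0->; rewrite mul0r mulr_ge0 ?addr_ge0.
have U1 : (0 < #|U|)%N by rewrite card_gt0.
apply: le_trans (greedy_seq_size gs many Un0) _.
apply: ler_pM; rewrite ?ler_nat ?lerD2l ?ln_nat_mono //.
by rewrite addr_ge0 // ln_ge0 // ler1n.
Qed.

Lemma peel_deg (V : finType) (E : {set {set V}}) A A' H : peel R E A A' H ->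
  {in A', forall v, (deg E A' v)%:R < t_big R #|V|}.
Proof. by elim. Qed.

Lemma ln2_gt0 : 0 < ln 2 :> R.
Proof. by apply: ln_gt0; rewrite ltr1n. Qed.

(** The greedy bound produces natural logarithms and the thresholds use binary ones; [ln 2 <= 1]
    relates the two. *)
Lemma ln_le_lg n : (0 < n)%N -> ln n%:R <= lg R n.
Proof.
move=> n0; rewrite /lg ler_pdivlMr ?ln2_gt0 // ler_piMr //.
  by apply: ln_ge0; rewrite ler1n.
by rewrite -[2]/(1 + 1)%R; apply: le_ln1Dx; rewrite (lt_trans _ ltr01) ?ltrN10.
Qed.

Lemma lg_ge1 n : (2 <= n)%N -> 1 <= lg R n.
Proof.
by move=> n2; rewrite /lg ler_pdivlMr ?ln2_gt0 // mul1r ln_nat_mono.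
Qed.

Lemma thresholds_gt0 n : (2 <= n)%N ->
  [/\ 0 < t_big R n, 0 < t_heavy R n & 0 < t_path R n].
Proof.
move=> n2; have n0 : (0 : R) < n%:R by rewrite ltr0n ltnW.
have lg0 : 0 < lg R n by apply: lt_le_trans (lg_ge1 n2).
by split; rewrite ?divr_gt0 ?mulr_gt0 ?powR_gt0.
Qed.

Lemma lg_le n : (0 < n)%N -> lg R n <= n%:R.
Proof.
move=> n0; rewrite /lg ler_pdivrMr ?ln2_gt0 // mulr_natl -lnXn ?ltr0n // -natrX.
by apply: ln_nat_mono => //; apply/ltnW/ltn_expl.
Qed.

Lemma powR_fifth (x : R) k : 0 <= x -> x `^ (k%:R / 5) = (x `^ (1 / 5)) ^+ k.
Proof.
by move=> x0; rewrite -powR_mulrn ?powR_ge0 // -powRrM; congr (_ `^ _); field.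
Qed.

(* With a = n ^ (1/5) and c = (lg n) ^ (1/5) all bounds become rational. *)
Lemma fifth_roots n : (2 <= n)%N -> exists a c : R,
  [/\ [/\ 1 <= c, c <= a, n%:R = a ^+ 5 & ln n%:R <= c ^+ 5],
    [/\ t_big R n = a ^+ 3 / c ^+ 3, t_heavy R n = a ^+ 2 * c ^+ 3
      & t_path R n = a ^+ 3 * c ^+ 2],
    forall x, x * n%:R `^ (3 / 5) * lg R n `^ (2 / 5) = x * (a ^+ 3 * c ^+ 2)
  & n%:R `^ (11 / 5) / lg R n `^ (1 / 5) = a ^+ 11 / c].
Proof.
move=> n2; have n0 : (0 < n)%N by apply: leq_trans n2.
exists (n%:R `^ (1 / 5)), (lg R n `^ (1 / 5)).
have lg1 := lg_ge1 n2; have lg0 : 0 <= lg R n by apply: le_trans lg1.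
have n0R : 0 <= n%:R :> R by [].
have f5 : 0 <= 1 / 5 :> R by lra.
split.
- split.
  + by have := ge0_ler_powR f5 ler01 lg0 lg1; rewrite powR1.
  + by apply: ge0_ler_powR; rewrite ?nnegrE ?lg_le.
  + by rewrite -powR_fifth // divff ?pnatr_eq0 ?powRr1.
  + by rewrite -powR_fifth // divff ?pnatr_eq0 ?powRr1 // ln_le_lg.
- by rewrite /t_big /t_heavy /t_path !powR_fifth.
- by move=> x; rewrite !powR_fifth // mulrA.
- by rewrite powR_fifth.
Qed.

Lemma le_ceil_absz (x : R) (d : nat) : 0 <= x ->
  (absz (Num.ceil x) <= d)%N = (x <= d%:R).
Proof.
move=> x0; have c0 : 0 <= Num.ceil x by rewrite ceil_ge0 (lt_le_trans _ x0) ?ltrN10.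
by rewrite -lez_nat gez0_abs // ceil_le_int.
Qed.

(** The two sides of the minimum come from the two bounds on [L]: times [a ^+ 3 * c ^+ 2], the first
    gives [2 * B1] and the second, [L * c ^+ 3 <= a ^+ 8], gives [a ^+ 11 / c]. For peeling, [x] is
    the number of rounds, at most [a ^+ 2 * c ^+ 3], and [a ^+ 10 <= a ^+ 11 / c] because [c <= a].
    The product [g * s2] is [O(s1 * L)], as [s2] is at most 9 times [a ^+ 3 * c ^+ 2]. The maximum
    with 1 takes up the constant work on a graph without edges. *)
Lemma time_terms (a c m L s1 s2 g p x : R) : 1 <= c -> c <= a ->
  0 <= m -> 0 <= L -> 0 <= s1 -> 0 <= s2 -> 0 <= g -> 0 <= x ->
  L <= 2 * m -> m <= a ^+ 10 -> L * c ^+ 3 <= a ^+ 8 ->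
  p <= x * (1000 * m) -> p <= 500 * a ^+ 10 -> x <= a ^+ 2 * c ^+ 3 ->
  s1 <= 2 * (a ^+ 3 * c ^+ 2) -> s2 <= 9 * (a ^+ 2 * c ^+ 3) ->
  g * (3 * (a ^+ 3 * c ^+ 2)) <= s1 * L ->
  1 + m + p + s1 * L + s2 * L + g * s2 + g + L
    <= 5000 * Num.max 1 (Num.min (m * (a ^+ 3 * c ^+ 2)) (a ^+ 11 / c)).
Proof.
move=> c1 ca m0 L0 s10 s20 g0 x0 Lm ma La pm pa xa s1a s2a ga.
set B1 := m * _; set B2 := a ^+ 11 / c.
have c0 : 0 < c by apply: lt_le_trans c1.
have a1 : 1 <= a by apply: le_trans ca.
have a0 : 0 < a by apply: lt_le_trans a1.
have e1 k : 1 <= a ^+ k by rewrite exprn_ege1.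
have c_e1 k : 1 <= c ^+ k by rewrite exprn_ege1.
have T1 : 1 <= a ^+ 3 * c ^+ 2 by rewrite mulr_ege1.
have U1 : a ^+ 2 * c ^+ 3 <= a ^+ 3 * c ^+ 2.
  rewrite (_ : a ^+ 3 * _ = a ^+ 2 * c ^+ 2 * a); last by ring.
  by rewrite (_ : _ * c ^+ 3 = a ^+ 2 * c ^+ 2 * c) ?ler_wpM2l //; [rewrite mulr_ge0 ?exprn_ge0 ?ltW|ring].
have mB1 : m <= B1 by rewrite /B1 ler_peMr.
have a10 : a ^+ 10 <= B2.
  by rewrite /B2 ler_pdivlMr // [a ^+ 11]exprSr ler_wpM2l // exprn_ge0 // ltW.
have LT : (a ^+ 3 * c ^+ 2) * L <= B2.
  rewrite /B2 ler_pdivlMr //.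
  have -> : a ^+ 3 * c ^+ 2 * L * c = a ^+ 3 * (L * c ^+ 3) by ring.
  by rewrite -[11%N]/(3 + 8)%N exprD ler_wpM2l ?exprn_ge0 ?(ltW a0).
have LT1 : (a ^+ 3 * c ^+ 2) * L <= 2 * B1.
  by rewrite /B1 mulrC mulrA ler_wpM2r // (le_trans ler01).
have L1 : L <= (a ^+ 3 * c ^+ 2) * L by rewrite ler_peMl.
have s1L : s1 * L <= 2 * ((a ^+ 3 * c ^+ 2) * L).
  by rewrite mulrA ler_wpM2r.
have s2L : s2 * L <= 9 * ((a ^+ 3 * c ^+ 2) * L).
  by rewrite mulrA ler_wpM2r // (le_trans s2a) // ler_wpM2l.
have g1 : g <= s1 * L by apply: le_trans ga; rewrite ler_peMr //; lra.
have gs : g * s2 <= 3 * (s1 * L).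
  apply: le_trans (_ : g * (9 * (a ^+ 3 * c ^+ 2)) <= _); last by lra.
  by rewrite ler_wpM2l // (le_trans s2a) // ler_wpM2l.
have pB1 : p <= 1000 * B1.
  apply: (le_trans pm); rewrite /B1 mulrC -mulrA ler_wpM2l // ler_wpM2l //.
  exact: le_trans xa U1.
set M := Num.max _ _.
have M1 : 1 <= M by rewrite /M le_max lexx.
have MB : Num.min B1 B2 <= M by rewrite /M le_max lexx orbT.
have [B12|B21] := lerP B1 B2; first by rewrite min_l // in MB; lra.
by rewrite min_r ?(ltW B21) // in MB; lra.
Qed.

(** Origin of the constants: [n * (1 + ln n)] is at most [2 * a ^+ 5 * c ^+ 5], which divided by
    [t_heavy] gives the factor 2 for [s1]. The targets of the second greedy run number at most the
    square of [n], so its logarithm is doubled; [a ^+ 5 * 3 * c ^+ 5] divided by a third of [t_path]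
    gives the factor 9 for [s2]. In both cases [1 <= c ^+ 5] absorbs the summand 1. *)
Lemma time_bound n m L s1 s2 g p x tb th k t3 : (2 <= n)%N ->
  t_big R n <= tb%:R -> t_heavy R n <= th%:R -> t_path R n <= 3 * k%:R ->
  3 * t_path R n <= t3%:R ->
  (m <= n * n)%N -> (L <= 2 * m)%N -> L%:R <= n%:R * t_big R n ->
  (p <= x * (1000 * m))%N -> (p <= 500 * (n * n))%N -> (x * tb <= n)%N ->
  s1%:R * th%:R <= n%:R * (1 + ln n%:R) :> R ->
  s2%:R * k%:R <= n%:R * (1 + 2 * ln n%:R) :> R ->
  (g * t3 <= s1 * L)%N ->
  (1 + m + p + s1 * L + s2 * L + g * s2 + g + L)%:R
    <= 5000 * Num.max 1 (Num.min (m%:R * n%:R `^ (3 / 5) * lg R n `^ (2 / 5))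
                                 (n%:R `^ (11 / 5) / lg R n `^ (1 / 5))).
Proof.
move=> n2; have [a [c [[c1 ca na lnc] [-> -> ->] -> ->]]] := fifth_roots n2.
move: lnc; rewrite na => lnc tbP thP kP t3P mn Lm Ln pm pn xn s1P s2P gP.
have c0 : 0 < c by apply: lt_le_trans c1.
have a1 : 1 <= a by apply: le_trans ca.
have a0 : 0 < a by apply: lt_le_trans a1.
have c_e1 k' : 1 <= c ^+ k' by rewrite exprn_ege1.
have pc k' : 0 < c ^+ k' by rewrite exprn_gt0.
have pa k' : 0 < a ^+ k' by rewrite exprn_gt0.
rewrite !natrD !natrM.
have nn : n%:R * n%:R = a ^+ 10 by rewrite na -exprD.
apply: (@time_terms a c m%:R L%:R s1%:R s2%:R g%:R p%:R x%:R) => //.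
- by rewrite -natrM ler_nat.
- by rewrite -nn -natrM ler_nat.
- move: Ln; rewrite mulrA ler_pdivlMr // => /le_trans -> //.
  by rewrite -exprD.
- by rewrite -!natrM ler_nat.
- by rewrite -nn -!natrM ler_nat.
- have : x%:R * (a ^+ 3 / c ^+ 3) <= a ^+ 5.
    rewrite -na; apply: le_trans (_ : x%:R * tb%:R <= _); first by rewrite ler_wpM2l.
    by rewrite -natrM ler_nat.
  rewrite mulrA ler_pdivrMr // => H; rewrite -(ler_pM2r (pa 3)); move: H.
  by rewrite -[5%N]/(2 + 3)%N exprD mulrAC.
- rewrite -(ler_pM2r (_ : 0 < a ^+ 2 * c ^+ 3)) ?mulr_gt0 //.
  apply: le_trans (_ : s1%:R * th%:R <= _); first by rewrite ler_wpM2l.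
  apply: (le_trans s1P).
  have -> : 2 * (a ^+ 3 * c ^+ 2) * (a ^+ 2 * c ^+ 3) = a ^+ 5 * (c ^+ 5 + c ^+ 5) by ring.
  by rewrite ler_wpM2l ?lerD // ltW.
- rewrite -(ler_pM2r (_ : 0 < a ^+ 3 * c ^+ 2)) ?mulr_gt0 //.
  apply: le_trans (_ : 3 * (s2%:R * k%:R) <= _).
    by rewrite [3 * _]mulrCA ler_wpM2l.
  apply: le_trans (_ : 3 * (a ^+ 5 * (1 + 2 * c ^+ 5)) <= _).
    rewrite ler_wpM2l //; apply: (le_trans s2P); rewrite ler_wpM2l ?(ltW (pa 5)) ?lerD2l //.
    by rewrite ler_wpM2l.
  have -> : 9 * (a ^+ 2 * c ^+ 3) * (a ^+ 3 * c ^+ 2) = 3 * (a ^+ 5 * (c ^+ 5 + 2 * c ^+ 5)) by ring.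
  by rewrite ler_wpM2l // ler_wpM2l ?lerD // ltW.
- apply: le_trans (_ : g%:R * t3%:R <= _); first by rewrite ler_wpM2l.
  by rewrite -!natrM ler_nat.
Qed.

End RealBounds.

(** * The complete run *)

Lemma wpb_exec W p s T Q : wpb W p s T Q ->
  exists t s', [/\ exec W p s t s', t <= T, frame p s s' & Q s'].
Proof. by case=> t [s' [ex tT Qs']]; exists t, s'; split=> //; apply: exec_frame ex. Qed.

Lemma rstate_arrs n (x0 : 'I_n) s s' m row :
  (forall a, 20 <= a <= 23 -> arrs s' a = arrs s a) ->
  rstate x0 s m row -> rstate x0 s' m row.
Proof. by move=> eqa; rewrite /rstate !eqa. Qed.

Lemma rstate_frame n (x0 : 'I_n) p s s' m row : frame p s s' ->
  ~~ has (mem [:: 20; 21; 22; 23]) (warrs p) -> rstate x0 s m row -> rstate x0 s' m row.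
Proof.
move=> fr off; apply: rstate_arrs => a a2; apply: (proj2 fr).
apply: contra off => ap; apply/hasP; exists a => //.
by move: a a2 {ap} => [|[|[|[|[|[|[|[|[|[|[|[|[|[|[|[|[|[|[|[|[|[|[|[|a]]]]]]]]]]]]]]]]]]]]]]]].
Qed.

Lemma row_sizes (X : finType) (t0 : X) (tg : seq X) (len : nat -> nat) (F : X -> nat) :
  uniq tg -> (forall r, r < size tg -> len r <= F (nth t0 tg r)) ->
  \sum_(r < size tg) len r <= \sum_(t in tg) F t.
Proof.
move=> utg lenF; rewrite -[leqRHS]big_uniq //= (big_nth t0) big_mkord.
by apply: leq_sum => r _; apply: lenF.
Qed.

Lemma uniq_unzip1 (X Y : eqType) (q : seq (X * Y)) a b b' :
  uniq (unzip1 q) -> (a, b) \in q -> (a, b') \in q -> b = b'.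
Proof.
elim: q => //= -[c e] q IH /andP[cq uq]; rewrite !inE !xpair_eqE.
have notin z : (a, z) \in q -> a == c -> False.
  by move=> aq /eqP ac; case/negP: cq; rewrite -ac; apply/mapP; exists (a, z).
case/orP=> [/andP[ac /eqP->]|aq]; case/orP=> [/andP[ac' /eqP->]|aq'] //.
- by case: (notin _ aq' ac).
- by case: (notin _ aq ac').
- exact: IH.
Qed.

(** * The stages after peeling, on the surviving graph *)

Section Stages.
Variables (n W : nat) (x0 : 'I_n).
Hypotheses (n_gt1 : 1 < n) (W_big : 16 * (n * n * n) <= W).
Local Notation V := 'I_n.
Implicit Types (x y v : V) (o : seq (V * V)) (row : nat -> seq V) (S : seq V).
Local Notation gstate := (gstate x0).
Local Notation holds := (holds x0).
Local Notation rstate := (rstate x0).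
Local Notation outrep := (outrep x0).
Variables (E : {set {set V}}) (A : {set V}) (l : seq (V * V)).
Hypothesis lE : arcs_of E A l.
Let W1 : 1 < W := W_gt1 n_gt1 W_big.

Let l_uniq : uniq l := lE.1.
Let l_sym : forall x y, ((x, y) \in l) = ((y, x) \in l) := arcs_sym lE.

Let adjC x y : adj E A x y = adj E A y x.
Proof. by rewrite -!lE.2 l_sym. Qed.

Lemma sum_deg : \sum_x deg E A x = size l.
Proof. by rewrite -(arcs_weightE lE) sum_size_adjl. Qed.

Definition selected s S : Prop :=
  [/\ holds (arrs s 24) S, regs s 24 = size S & forall x, arrs s 25 x = (x \in S)].

Lemma select_ok s o th : gstate l s -> outrep s o -> size o + n * n < W ->
  regs s 3 = th -> 0 < th ->
  (forall a x, a \in [:: 13; 14; 25] -> arrs s a x = 0) -> rstate s (n * n) (fun=> [::]) ->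
  let U := [set h | th <= deg E A h] in
  exists t s' S o' d,
    [/\ exec W (heavy_rows ;; greedy_prog ;; dominate) s t s',
      t <= 400 * (size l).+1 + 200 * (size l).+1 * (size S).+1,
      greedy_seq A (fun c => c |: nbrs E A c) U S,
      selected s' S /\ rstate s' (n * n) (fun=> [::])
    & [/\ outrep s' (o ++ o'), size o' <= size l,
        edge_set o' = [set [set h; d h] | h in U :\: [set x in S]]
      & {in U :\: [set x in S], forall h, d h \in S /\ adj E A h (d h)}]].
Proof.
move=> gs oo oW s3 th0 zero rs U.
have sl := size_uniq_pairs l_uniq.
have wE := arcs_degE lE.
have z13 x : arrs s 13 x = 0 by apply: zero.
have [t1 [s1 [ex1 tT1 fr1 [tg [row [r21 utg tgE [rs1 rowE nil]]]]]]] :=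
  wpb_exec (heavy_rows_ok n_gt1 W_big l_uniq gs z13 rs).
have tgU x : (x \in tg) = (x \in U).
  rewrite tgE inE s3 wE (arcs_mem_src lE); apply: andb_idr.
  exact: leq_trans.
have szU : [set t in tg] = U by apply/setP => x; rewrite inE tgU.
pose dom c := c |: nbrs E A c.
have stg : size tg <= n := size_uniq_ord utg.
have dom_src x t : t \in tg -> t \in dom x -> x \in unzip1 l.
  rewrite tgE !inE => /andP[_ tl] /predU1P[<-//|]; rewrite -lE.2 => xt.
  by apply/mapP; exists (x, t).
have dom_some t : t \in tg -> exists x, t \in dom x by exists t; rewrite !inE eqxx.
have gs1 : gstate l s1 := gstate_frame fr1 isT gs.
have rows : rows_for x0 dom tg [set t in tg] row.
  split=> // r x rtg; rewrite rowE // lE.2 !inE mem_nth // andbT eq_sym.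
  by rewrite adjC.
have tgnn : size tg <= n * n by apply: leq_trans stg _; rewrite leq_pmulr // ltnW.
have [S [gr /wpb_exec[t2 [s2 [ex2 tT2 fr2 [r24 hS aS rs2]]]]]] :=
  greedy_ok n_gt1 W_big utg tgnn lE dom_src dom_some gs1 r21 rows rs1.
have a25 x : arrs s2 25 x = (x \in S).
  by rewrite aS (proj2 fr1 25 isT) zero //; case: ifP.
have gs2 : gstate l s2 := gstate_frame fr2 isT gs1.
have oo2 : outrep s2 o := outrep_frame fr2 isT (outrep_frame fr1 isT oo).
have z14 x : arrs s2 14 x = 0 by rewrite (proj2 fr2 14 isT) (proj2 fr1 14 isT) zero.
have oW2 : size o + size l < W by apply: leq_trans oW; rewrite ltnS leq_add2l.
have [t3 [s3' [ex3 tT3 fr3 [o' [oo3 uo' so' sound compl]]]]] :=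
  wpb_exec (dominate_ok n_gt1 W_big l_uniq gs2 oo2 oW2 z14 a25).
have r3 : regs s2 3 = th by rewrite (proj1 fr2 3 isT) (proj1 fr1 3 isT).
rewrite r3 in sound compl.
(* The first edge listed at [h], which is its only one; vertices without an edge get the default
   [x0]. *)
pose d h := nth x0 (adjl o' h) 0.
have dE h b : (h, b) \in o' -> d h = b.
  move=> hb; rewrite /d; have := hb; rewrite -mem_adjl.
  case E1: (adjl o' h) => [//|b' q] _ /=.
  have hb' : (h, b') \in o' by rewrite -mem_adjl E1 mem_head.
  exact: uniq_unzip1 uo' hb' hb.
exists (t1 + (t2 + t3)), s3', S, o', d; split.
- exact: exec_seq ex1 (exec_seq ex2 ex3).
(* A heavy vertex has positive degree, so there are at most as many targets as arcs; a row has at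
   most degree plus one entries, so the rows have at most [size l + size l] entries in total. *)
- have tgl : \sum_(x in tg) 1 <= size l.
    rewrite -sum_deg [leqRHS](bigID (mem tg)) /=; apply: leq_trans (leq_addr _ _).
    by apply: leq_sum => x; rewrite tgU inE; apply: leq_trans.
  have Z : \sum_(r < size tg) size (row r) <= size l + size l.
    have rowF r : r < size tg -> size (row r) <= deg E A (nth x0 tg r) + 1.
      move=> rtg; have [ur _ _] := rs1.1 r.
      rewrite -wE addn1 -[_.+1]/(size (nth x0 tg r :: adjl l (nth x0 tg r))).
      by apply: uniq_leq_size => // x; rewrite rowE // inE mem_adjl.
    apply: leq_trans (row_sizes (F := fun h => deg E A h + 1) utg rowF) _.
    rewrite big_split /= leq_add // -sum_deg [leqRHS](bigID (mem tg)) /=; exact: leq_addr.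
  have stgl : size tg <= size l by move: tgl; rewrite sum1_card (card_uniqP utg).
  have : 100 * (size l + size tg + 2) * (size S).+1 <= 200 * (size l).+1 * (size S).+1.
    by rewrite leq_mul2r; lia.
  move: Z tT1 tT2 tT3; set z := \sum_(_ < _) _; set G := 100 * _ * _; set G' := 200 * _ * _.
  by move: z G G' (size l) => z G G' L; lia.
- by rewrite -szU.
- split.
    split; first by rewrite (proj2 fr3 24 isT).
      by rewrite (proj1 fr3 24 isT).
    by move=> x; rewrite (proj2 fr3 25 isT).
  by apply: rstate_frame fr3 isT _; apply: rstate_resize rs2.
have dP h : h \in U :\: [set x in S] -> (h, d h) \in o'.
  rewrite !inE => /andP[hNS hU].
  have hU' : h \in [set t in tg] by rewrite szU inE.
  have [c cS] := greedy_seq_covers gr hU'; rewrite !inE => /predU1P[E1|].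
    by rewrite E1 cS in hNS.
  rewrite adjC -lE.2 => hc.
  have := compl _ _ hc; rewrite wE => /(_ hU hNS cS)/mapP[[h' b] hb /= ->].
  by rewrite (dE _ _ hb).
split=> //; last first.
  by move=> h /dP /sound[_ _ dS hd]; rewrite -lE.2.
apply/setP=> B; rewrite mem_edge_set; apply/mapP/imsetP => [[[a b] ab ->]|[h /dP hd ->]].
  have [tha aNS bS _] := sound _ _ ab; exists a; last by rewrite (dE _ _ ab).
  by rewrite !inE aNS -wE.
by exists (h, d h).
Qed.

Definition second_phase : prog :=
  (Set_ 29 (Reg 24) ;; Set_ 21 (Const 0)) ;; s1_loop ;; greedy_prog.

Definition right_set (S : seq V) (T : V -> ptree V) f tp t3 : {set V * V} :=
  [set r | (r.1 \in S) && frontier (deg E A) (T r.1) (f r.1) tp t3 r.2].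

Lemma right_set_sum S T f tp t3 (F : V -> V -> nat) b : uniq S ->
  (forall v, v \in S -> \sum_(u | frontier (deg E A) (T v) (f v) tp t3 u) F v u <= b) ->
  \sum_(r in right_set S T f tp t3) F r.1 r.2 <= size S * b.
Proof.
move=> uS Fb; rewrite (eq_bigl _ _ (in_set _)).
rewrite -(pair_big_dep (fun v => v \in S) (fun v u => frontier (deg E A) (T v) (f v) tp t3 u)) /=.
apply: leq_trans (leq_sum _ Fb) _.
by rewrite sum_nat_const (card_uniqP uS).
Qed.

Lemma second_phase_ok s o S tp t3 : gstate l s -> outrep s o -> size o + n * n < W ->
  (forall x, arrs s 7 x = 0) -> selected s S -> uniq S -> {in S, forall x, 0 < deg E A x} ->
  regs s 4 = tp -> regs s 5 = t3 -> 3 * tp <= t3 -> rstate s (n * n) (fun=> [::]) ->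
  exists t s' (T : V -> ptree V) f o' S2,
    let U := right_set S T f tp t3 in
    [/\ exec W second_phase s t s',
      t <= 1000 * ((size S).+1 * (size l).+1)
           + 100 * ((size l + #|U| + 2) * (size S2).+1),
      {in S, forall v, min_bfs_tree (adj E A) (deg E A) v (T v) /\
                       path_weight (deg E A) v (T v) (f v)},
      greedy_seq A (left_nbrs E A T) U S2
    & [/\ {in U, forall r, (tp %/ 3).+1 <= #|[set c in A | r \in left_nbrs E A T c]|},
        #|U| * t3.+1 <= size S * size l,
        holds (arrs s' 24) S2 /\ regs s' 24 = size S2,
        (forall x, arrs s' 7 x = 0) /\ size o' <= n * n
      & outrep s' (o ++ o') /\ edge_set o' = \bigcup_(v in [set x in S])
          \bigcup_(u in [set x in S] | connect (adj E A) v u && (f v u <= regs s 6))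
            path_edges (T v) u]].
Proof.
move=> gs oo oW D0 [hS s24 aS] uS Spos s4 s5 tpt3 rs.
have sl := size_uniq_pairs l_uniq.
have relE := arcs_relE lE; have weightE := arcs_weightE lE.
have Sn := size_uniq_ord uS.
have [t1 [s1 [ex1 tT1 fr1 [gs1 hS1 r29 aS1 r21]]]] : exists t1 s1,
  [/\ exec W (Set_ 29 (Reg 24) ;; Set_ 21 (Const 0)) s t1 s1, t1 <= 4,
    frame (Set_ 29 (Reg 24) ;; Set_ 21 (Const 0)) s s1
  & [/\ gstate l s1, holds (arrs s1 24) S, regs s1 29 = size S,
      forall x, arrs s1 25 x = (x \in S) & regs s1 21 = 0]].
  by apply: wpb_exec; vcs W1; split_vc => //; upds => //; rewrite mod0n.
have D01 x : arrs s1 7 x = 0 by rewrite (proj2 fr1 7 isT).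
have oo1 : outrep s1 o := outrep_frame fr1 isT oo.
have r4 : regs s1 4 = tp by rewrite (proj1 fr1 4 isT).
have r5 : regs s1 5 = t3 by rewrite (proj1 fr1 5 isT).
have r6 : regs s1 6 = regs s 6 by rewrite (proj1 fr1 6 isT).
have rs1 : rstate s1 (n * n) (fun=> [::]) := rstate_frame fr1 isT rs.
have wS x : x \in S -> 0 < size (adjl l x) by rewrite (arcs_degE lE); apply: Spos.
have [t2 [s2 [ex2 tT2 fr2 [T [f [tg [row [o' [oo2]]]]]]]]] :=
  wpb_exec (s1_loop_ok n_gt1 W_big l_uniq l_sym gs1 D01 hS1 uS r29 aS1 wS oo1 oW r4 r5 tpt3 r21 rs1).
rewrite /s1_inv take_size relE weightE r6.
move=> [certs utg tgE rowE [nil rs2 r212 oE [so' stg D02]]].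
set U := right_set S T f tp t3.
have tgU : [set t in tg] = U.
  by apply/setP => -[v u]; rewrite !inE tgE.
have cert r : r \in U -> exists q d, [/\ bfs_cert (adj E A) (deg E A) r.1 q (T r.1) d (f r.1),
    r.2 \in q & tp < f r.1 r.2].
  rewrite inE => /andP[/certs[q [d cert]] fu]; exists q, d; split=> //.
    by have := @frontier_mem _ _ _ _ _ _ _ _ tp t3 cert r.2 fu.
  by move: fu; rewrite /frontier; case: (T r.1 r.2) => // z /and3P[].
have degE y : deg E A y = #|[set x | adj E A y x]| by [].
have nbrsE r : [set x | [exists y, anc (T r.1) y r.2 && adj E A y x]]
    = [set c in A | r \in left_nbrs E A T c].
  case: r => v u; apply/setP => x; rewrite !inE /=.
  apply/existsP/andP => [[y /andP[yu yx]]|[_ /existsP[y yu]]]; last first.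
    by exists y; rewrite adjC.
  split; last by apply/existsP; exists y; rewrite yu adjC.
  by case/and3P: yx.
(* On a node of R the path weight exceeds [tp], and it is at most three times the number of
   neighbours of the path. *)
have many : {in U, forall r, (tp %/ 3).+1 <= #|[set c in A | r \in left_nbrs E A T c]|}.
  move=> r /cert[q [d [ct rq tpf]]]; rewrite -nbrsE.
  have := cert_dominators ct adjC degE rq; rewrite ltn_divLR // mulnC.
  exact: leq_trans.
have tgi r : r < size tg -> nth (x0, x0) tg r \in U by move=> rtg; rewrite -tgU inE mem_nth.
have dom_src x t : t \in tg -> t \in left_nbrs E A T x -> x \in unzip1 l.
  case: t => v u _; rewrite inE => /existsP[y /andP[_]]; rewrite -lE.2 => xy.
  by apply/mapP; exists (x, y).
have dom_some t : t \in tg -> exists x, t \in left_nbrs E A T x.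
  move=> ttg; have tU : t \in U by rewrite -tgU inE.
  have /card_gt0P[x] : 0 < #|[set c in A | t \in left_nbrs E A T c]|.
    by apply: leq_trans (many _ tU).
  by rewrite inE => /andP[_ tx]; exists x.
have gs2 : gstate l s2 := gstate_frame fr2 isT gs1.
have rows : rows_for (x0, x0) (left_nbrs E A T) tg [set t in tg] row.
  split=> // r x rtg; rewrite rowE // inE mem_nth // andbT.
  case: (nth _ _ _) => v u; rewrite inE /=; apply: eq_existsb => y.
  by rewrite lE.2 adjC.
have tgnn : size tg <= n * n by apply: leq_trans stg _; rewrite leq_pmul2r // ltnW.
have rs2' : rstate s2 (size tg) row.
  by apply: rstate_resize rs2 => r; rewrite (minn_idPr tgnn); apply: nil.
have [S2 [gr /wpb_exec[t3' [s3 [ex3 tT3 fr3 [r24 hS2 _ _]]]]]] :=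
  greedy_ok n_gt1 W_big utg tgnn lE dom_src dom_some gs2 r212 rows rs2'.
have szU : size tg = #|U| by rewrite -tgU cardsE (card_uniqP utg).
exists (t1 + (t2 + t3')), s3, T, f, o', S2; split.
- exact: exec_seq ex1 (exec_seq ex2 ex3).
- have rowF r : r < size tg -> size (row r) <= f (nth (x0, x0) tg r).1 (nth (x0, x0) tg r).2.
    move=> rtg; have [ur _ _] := rs2.1 r; have [q [d [ct rq _]]] := cert _ (tgi _ rtg).
    apply: leq_trans (cert_path_nbrs ct degE rq).
    rewrite -(card_uniqP ur); apply/subset_leq_card/subsetP => x; rewrite rowE // inE.
    by case/existsP=> y yx; apply/existsP; exists y; rewrite -lE.2.
  have Z : \sum_(r < size tg) size (row r) <= size S * (2 * size l).
    apply: leq_trans (row_sizes (F := fun t => f t.1 t.2) utg rowF) _.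
    rewrite (eq_bigl (fun t => t \in U)) => [|t]; last by rewrite -tgU inE.
    apply: right_set_sum => // v /certs[q [d ct]].
    by rewrite -sum_deg; apply: frontier_sum ct tpt3.
  rewrite -szU; move: Z tT1 tT2 tT3; rewrite -[100 * _ * _]mulnA.
  set z := \sum_(_ < _) _; set G := _ * (size S2).+1.
  clearbody z G; move: (size l) (size S) => L k.
  have -> : (710 * L + 108) * k = 710 * (k * L) + 108 * k by ring.
  have -> : k * (2 * L) = 2 * (k * L) by ring.
  have -> : k.+1 * L.+1 = k * L + k + L + 1 by ring.
  by move: (k * L) => kL; lia.
- by move=> v /certs[q [d ct]]; split; [apply: cert_min_bfs_tree ct|apply: cert_path_weight ct].
- by rewrite -/U -tgU.
split=> //.
- rewrite -sum1_card big_distrl /=; apply: leq_trans (right_set_sum (F := fun _ _ => 1 * t3.+1) uS _) _ => //.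
  move=> v /certs[q [d ct]]; rewrite -sum_deg; apply: leq_trans (frontier_count ct tpt3).
  by rewrite -sum1_card big_distrl.
- split=> [x|]; first by rewrite (proj2 fr3 7 isT).
  by apply: leq_trans so' _; rewrite leq_pmul2r // ltnW.
- by split=> //; apply: outrep_frame fr3 isT oo2.
Qed.
End Stages.

(** * Assembling the program and adding up its cost *)

Definition init_prog : prog :=
  For 10 1 (Put 0 (Reg 1 +e Reg 10) (Get 1 (Reg 10)) ;;
            Put 1 (Reg 1 +e Reg 10) (Get 0 (Reg 10))) ;;
  Set_ 1 (Reg 1 +e Reg 1).

(** Register 0 holds [n], the row length of all tables, up to the very last instruction, which
    replaces it by the length of the output. *)
Definition third_phase : prog :=
  Set_ 29 (Reg 24) ;; s2_loop ;; Set_ 0 (Reg 7).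

Definition main_prog : prog :=
  init_prog ;; peel_prog ;; light_out ;; (heavy_rows ;; greedy_prog ;; dominate) ;;
  second_phase ;; third_phase.

Section Output.
Variables (n W : nat) (x0 : 'I_n).
Hypotheses (n_gt1 : 1 < n) (W_big : 16 * (n * n * n) <= W).
Local Notation V := 'I_n.
Variables (R : realType) (E : {set {set V}}) (A : {set V}) (l : seq (V * V)).
Hypothesis lE : arcs_of E A l.
Let W1 : 1 < W := W_gt1 n_gt1 W_big.

Lemma outputs_arcs s (o : seq (V * V)) : regs s 0 = size o ->
  arcs_rep x0 (arrs s 2) (arrs s 3) o -> outputs s (edge_set o).
Proof.
move=> s0 so; exists o; split=> // i q oi.
have io : i < size o by rewrite -onthTE oi.
by have [-> ->] := so i io; rewrite (@onth_nth _ (x0, x0) _ _ _ oi).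
Qed.

Lemma third_phase_ok s o S : gstate x0 l s -> (forall x : V, arrs s 7 x = 0) ->
  holds x0 (arrs s 24) S -> regs s 24 = size S -> uniq S ->
  {in S, forall x, 0 < deg E A x} -> outrep x0 s o -> size o + n * n < W ->
  wpb W third_phase s ((180 * size l + 61) * size S + 12) (fun s' => exists T o',
    [/\ outputs s' (edge_set (o ++ o')),
      {in S, forall v, bfs_tree (adj E A) v (T v)}
    & edge_set o' = \bigcup_(v in [set x in S]) tree_edges (T v)]).
Proof.
move=> gs D0 hS s24 uS Spos oo oW.
apply: (@wpb_seq _ _ _ _ 2 ((180 * size l + 61) * size S + 10)); last by rewrite addnCA.
vcs W1; split_vc; set s1 := State _ _.
have gs1 : gstate x0 l s1 by exact: gs.
have wS x : x \in S -> 0 < size (adjl l x) by rewrite (arcs_degE lE); apply: Spos.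
apply: (@wpb_seq _ _ _ _ ((180 * size l + 61) * size S + 8) 2); last by rewrite -addnA.
have r29 : regs s1 29 = size S by [].
apply: (wpb_conseq (s2_loop_ok n_gt1 W_big lE.1 (arcs_sym lE) gs1 D0 hS uS r29 wS oo oW)) => //.
move=> s2 fr [T [o' [oo2 bt oE]]]; rewrite (arcs_relE lE) in bt; clear fr.
vcs W1; split_vc; exists T, o'; split=> //.
by apply: outputs_arcs; [rewrite /=; exact: oo2.1|exact: oo2.2].
Qed.

Lemma light_edgesE th : (forall d : nat, (t_heavy R n <= d%:R)%R = (th <= d)) ->
  edge_set [seq q <- l | size (adjl l q.1) < th] = light_edges R E A.
Proof.
move=> thE; have lightE d : (d%:R < t_heavy R n)%R = (d < th).
  by rewrite Order.TotalTheory.ltNge thE -ltnNge.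
apply/setP=> B; rewrite mem_edge_set inE; apply/mapP/existsP => [[[x y]]|[x]].
  rewrite mem_filter (arcs_degE lE) lE.2 => /= /andP[dx xy] ->; exists x.
  rewrite inE card_ord lightE dx andbT; apply/andP; split; first by case/andP: xy.
  by apply/existsP; exists y; rewrite xy eqxx.
rewrite inE card_ord lightE => /andP[/andP[_ dx]] /existsP[y /andP[xy /eqP->]].
by exists (x, y) => //; rewrite mem_filter (arcs_degE lE) lE.2 dx.
Qed.

Lemma heavyE th : (forall d : nat, (t_heavy R n <= d%:R)%R = (th <= d)) -> 0 < th ->
  heavy R E A = [set h | th <= deg E A h].
Proof.
move=> thE th0; apply/setP=> h; rewrite !inE card_ord thE andb_idl // => /(leq_trans th0).
by case/card_gt0P=> x; rewrite inE => /andP[].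
Qed.

Lemma right_nodesE S (T : V -> ptree V) f tp t3 :
  (forall d : nat, (t_path R n < d%:R)%R = (tp < d)) ->
  (forall d : nat, (3 * t_path R n < d%:R)%R = (t3 < d)) ->
  {in S, forall v, bfs_tree (adj E A) v (T v)} ->
  right_nodes R E A [set x in S] T f = right_set E A S T f tp t3.
Proof.
move=> tpE t3E bt; apply/setP=> -[v u]; rewrite !inE /= card_ord tpE t3E.
case: (boolP (v \in S)) => //= vS; rewrite /frontier; case Tu: (T v u) => [z|]; last first.
  by rewrite /= !andbF.
have -> /= : u \in A.
  by have [_ /(_ z u)] := bt v vS; rewrite /child /= Tu eqxx => /(_ isT)/and3P[].
by congr (_ && (_ && _)); rewrite Order.TotalTheory.leNgt tpE -leqNgt.
Qed.

End Output.

Lemma uniq_map_inj (X Y : eqType) (f : X -> Y) (s : seq X) :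
  uniq (map f s) -> {in s &, injective f}.
Proof.
move=> us x y xs ys fxy; pose q := [seq (f z, z) | z <- s].
have uq : uniq (unzip1 q) by rewrite /unzip1 -map_comp.
apply: (uniq_unzip1 uq (a := f x)); first exact: map_f.
by rewrite fxy; apply: map_f.
Qed.

Lemma set2_eq (V : finType) (a b x y : V) : [set a; b] = [set x; y] ->
  (a, b) = (x, y) \/ (a, b) = (y, x).
Proof.
move=> E; have aE : a \in [set x; y] by rewrite -E set21.
have bE : b \in [set x; y] by rewrite -E set22.
have xE : x \in [set a; b] by rewrite E set21.
have yE : y \in [set a; b] by rewrite E set22.
move: aE bE xE yE; rewrite !inE.
do 4![case/orP=> /eqP ?]; subst; auto.
Qed.

(** Once expanded, the products are generalised to atoms and the rest is linear. The hypotheses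
    [s1 <= s1 * L] and [s2 <= s2 * L] express that a nonempty selection forces an arc. *)
Lemma total_time m p L g s1 s2 t0 t1 t2 t4 t7 t8 :
  t0 <= 20 * m + 12 -> t1 <= p + 90 * (2 * m) + 100 -> t2 <= 40 * L + 10 ->
  t4 <= 400 * L.+1 + 200 * L.+1 * s1.+1 ->
  t7 <= 1000 * (s1.+1 * L.+1) + 100 * ((L + g + 2) * s2.+1) ->
  t8 <= (180 * L + 61) * s2 + 12 -> s1 <= s1 * L -> s2 <= s2 * L ->
  t0 + (t1 + (t2 + (t4 + (t7 + t8))))
    <= 5000 * (1 + m + p + s1 * L + s2 * L + g * s2 + g + L).
Proof.
rewrite -[200 * _ * _]mulnA.
have -> : (L + g + 2) * s2.+1 = s2 * L + g * s2 + 2 * s2 + L + g + 2 by ring.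
have -> : (180 * L + 61) * s2 = 180 * (s2 * L) + 61 * s2 by ring.
have -> : s1.+1 * L.+1 = s1 * L + s1 + L + 1 by ring.
have -> : L.+1 * s1.+1 = s1 * L + s1 + L + 1 by ring.
by move: (s1 * L) (s2 * L) (g * s2) => x y z; lia.
Qed.

Section Run.
Variables (n W : nat) (x0 : 'I_n).
Hypotheses (n_gt1 : 1 < n) (W_big : 16 * (n * n * n) <= W).
Local Notation V := 'I_n.
Variables (R : realType) (E : {set {set V}}) (es : seq (V * V)).
Hypotheses (E_simple : simple_graph E) (es_E : edge_list E es).
Let W1 : 1 < W := W_gt1 n_gt1 W_big.

Definition both_arcs : seq (V * V) := es ++ [seq (q.2, q.1) | q <- es].

Lemma mem_edges q : q \in es -> [set q.1; q.2] \in E.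
Proof. by move=> qes; rewrite -es_E.2 inE; apply/mapP; exists q. Qed.

(** Edges have two distinct endpoints, so an arc never equals its own reversal; and the reversal of
    a listed arc is not listed itself, the same edge being listed once. *)
Lemma both_arcs_of : arcs_of E [set: V] both_arcs.
Proof.
have ues := es_E.1; split=> [|x y].
  have swap : injective (fun q : V * V => (q.2, q.1)) by move=> [a b] [c d] [-> ->].
  rewrite cat_uniq (map_inj_uniq swap) (map_uniq ues) andbT /=.
  apply/hasPn => _ /mapP[[a b] ab ->] /=; apply/negP => ba.
  have := uniq_map_inj ues ab ba; rewrite /= setUC => /(_ erefl) [abE _].
  have := E_simple (mem_edges ab); rewrite /= abE setUid cards1.
  by [].
rewrite /adj /= !inE mem_cat; apply/orP/idP => [[/mem_edges//|/mapP[[a b] ab [-> ->]]]|].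
  by rewrite setUC; apply: (mem_edges ab).
rewrite -es_E.2 inE => /mapP[[a b] ab /set2_eq[]] [xa yb]; rewrite {}xa {}yb; first by left.
by right; apply/mapP; exists (a, b).
Qed.

Lemma size_both_arcs : size both_arcs = 2 * size es.
Proof. by rewrite size_cat size_map mul2n addnn. Qed.

Lemma card_edges : #|E| = size es.
Proof. by rewrite -es_E.2 cardsE (card_uniqP es_E.1) size_map. Qed.

Lemma init_ok : wpb W init_prog (init_state R es) (20 * size es + 12) (fun s =>
  regs s 1 = size both_arcs /\ arcs_rep x0 (arrs s 0) (arrs s 1) both_arcs).
Proof.
have [n1 n2 n3] := sizes n_gt1 W_big.
have sz : 2 * size es <= n * n by rewrite -size_both_arcs; apply: size_uniq_pairs both_arcs_of.1.
set m := size es; set s0 := init_state R es.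
pose I i s := forall j, j < m ->
  [/\ arrs s 0 j = (nth (x0, x0) es j).1, arrs s 1 j = (nth (x0, x0) es j).2
    & j < i -> arrs s 0 (m + j) = (nth (x0, x0) es j).2 /\
               arrs s 1 (m + j) = (nth (x0, x0) es j).1].
wpb_step (20 * m + 8) 4.
wpb_loop W1 m 12 I.
- by move=> j jm; split=> //=; rewrite (nth_map (x0, x0)).
- move=> i s im fr ri Is; vcs W1.
  have r1 : regs s0 1 = m by [].
  rewrite r1; split_vc; try by lia.
  have [ai bi _] := Is _ im.
  move=> j jm; have [aj bj cj] := Is _ jm; upds; rewrite /upd ai bi.
  rewrite eqn_add2l (ltn_eqF (ltn_addr i im)) (ltn_eqF (ltn_addr i jm)).
  split=> //; rewrite ltnS leq_eqVlt; case: eqP => [->|_ /= ji] //.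
  exact: cj.
move=> s fr Is; vcs W1.
have r1 : regs s0 1 = m by [].
rewrite !r1 addnn -mul2n size_both_arcs; split_vc => //; first by lia.
move=> j; rewrite size_both_arcs -/m nth_cat -/m => jm; upds.
case: ltnP => [jlt|mj]; first by have [-> ->] := Is _ jlt.
have jm' : j - m < m by lia.
have [_ _ []] := Is _ jm' => //; rewrite subnKC // => -> ->.
by rewrite (nth_map (x0, x0)).
Qed.

Import Order.TTheory GRing.Theory Num.Theory.

Lemma rstate_zero s m : (forall a i, a \in [:: 20; 21; 22; 23] -> arrs s a i = 0) ->
  rstate x0 s m (fun=> [::]).
Proof.
move=> z; split; last split.
- by move=> r; split=> //=; rewrite z.
- by move=> r x; rewrite z.
- by move=> x; rewrite z // big1.
Qed.

Lemma size_arcs_le A l : arcs_of E A l ->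
  {in A, forall v, (deg E A v)%:R < t_big R n}%R -> (0 < t_big R n)%R ->
  ((size l)%:R <= n%:R * t_big R n)%R.
Proof.
move=> lE small t0; rewrite -(sum_deg lE) natr_sum.
apply: le_trans (_ : \sum_(x : V) t_big R n <= _)%R; last first.
  by rewrite sumr_const card_ord mulr_natl.
apply: ler_sum => x _.
have [xA|xNA] := boolP (x \in A); first exact/ltW/small.
rewrite (_ : deg E A x = 0) ?ltW //.
by apply/eqP; rewrite cards_eq0; apply/eqP/setP=> y; rewrite !inE /adj /= (negbTE xNA).
Qed.

Lemma card_heavy_cover A (h : V) :
  deg E A h <= #|[set c in A | h \in c |: nbrs E A c]|.
Proof.
apply/subset_leq_card/subsetP => x; rewrite !inE => /and3P[hA xA hx].
by rewrite xA /adj /= xA hA setUC hx orbT.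
Qed.

Lemma size_le_mul A l (S : seq V) : arcs_of E A l -> {in S, forall x, 0 < deg E A x} ->
  size S <= size S * size l.
Proof.
case: S => // x S lE pos; rewrite leq_pmulr // -(sum_deg lE) (bigD1 x) //= ltn_addr //.
by apply: pos; rewrite mem_head.
Qed.

Lemma main_prog_ok : exists t s H,
  [/\ exec W main_prog (init_state R es) t s, outputs s H, construction R E H
    & (t%:R <= 5000 * 5000 * Num.max 1
         (Num.min (#|E|%:R * n%:R `^ (3 / 5) * lg R n `^ (2 / 5))
                  (n%:R `^ (11 / 5) / lg R n `^ (1 / 5))))%R].
Proof.
have [tb0 th0 tp0] := thresholds_gt0 R n_gt1.
set s := init_state R es.
have tbE (d : nat) : (t_big R n <= d%:R)%R = (regs s 2 <= d).
  by rewrite -le_ceil_absz // ltW.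
have thE (d : nat) : (t_heavy R n <= d%:R)%R = (regs s 3 <= d).
  by rewrite -le_ceil_absz // ltW.
have tpE (d : nat) : (t_path R n < d%:R)%R = (regs s 4 < d).
  by rewrite -truncn_lt_nat // ltW.
have t3E (d : nat) : (3 * t_path R n < d%:R)%R = (regs s 5 < d).
  by rewrite -truncn_lt_nat // mulr_ge0 // ltW.
have t5E (d : nat) : (d%:R <= 5 * t_path R n)%R = (d <= regs s 6).
  by rewrite -truncn_ge_nat // mulr_ge0 // ltW.
have s0 : regs s 0 = n by [].
(* From here on the rounded thresholds are plain numbers, known through their comparisons with
   integers. *)
have [tb r2] : exists tb, regs s 2 = tb by exists (regs s 2).
have [th r3] : exists th, regs s 3 = th by exists (regs s 3).
have [tp r4] : exists tp, regs s 4 = tp by exists (regs s 4).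
have [t3 r5] : exists t3, regs s 5 = t3 by exists (regs s 5).
have [t5 r6] : exists t5, regs s 6 = t5 by exists (regs s 6).
rewrite r2 in tbE; rewrite r3 in thE; rewrite r4 in tpE; rewrite r5 in t3E; rewrite r6 in t5E.
have tb_gt0 : 0 < tb by rewrite ltnNge -tbE -ltNge.
have th_gt0 : 0 < th by rewrite ltnNge -thE -ltNge.
have tpt3 : 3 * tp <= t3.
  rewrite leqNgt -t3E -leNgt natrM ler_wpM2l //.
  by rewrite leNgt tpE ltnn.
have lE0 := both_arcs_of.
set m := size es; have sz0 : size both_arcs = 2 * m by apply: size_both_arcs.
have sznn := size_uniq_pairs lE0.1.
have [t0 [u0 [ex0 tT0 fr0 [r1 a01]]]] := wpb_exec (init_ok).
have regs0 k : k \in [:: 0; 2; 3; 4; 5; 6; 7] -> regs u0 k = regs s k.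
  by move=> kin; apply: (proj1 fr0); move: kin; rewrite !inE; do 6![case/orP=> [/eqP->//|]] => /eqP->.
have arrs0 a x : 2 <= a -> arrs u0 a x = 0.
  by case: a => [|[|a]] // _; rewrite (proj2 fr0).
have oo0 : outrep x0 u0 [::] by split=> //; rewrite regs0.
have r20 : regs u0 2 = tb by rewrite regs0.
have := @peel_ok _ _ x0 n_gt1 W_big R E _ u0 lE0 _ r1 a01 _ _ _ oo0.
rewrite r20 sz0 regs0 // => /(_ s0 _ _ _ tb_gt0 tbE) peel0.
have /wpb_exec[t1 [u1 [ex1 tT1 fr1 [A [H1 [l [o1 [peelA gs lE sl [D0 oo eo so]]]]]]]]] := 
  peel0 (fun x => arrs0 4 x isT) (fun x => arrs0 5 x isT) (fun x => arrs0 7 x isT).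
have slnn := leq_trans sl; rewrite -sz0 in slnn; have {}slnn := slnn _ sznn.
have [n1 n2 n3] := sizes n_gt1 W_big.
have oW1 : size o1 + size l < W by lia.
have [t2 [u2 [ex2 tT2 fr2 oo2]]] := wpb_exec (light_ok n_gt1 W_big lE.1 gs oo oW1).
have r31 : regs u1 3 = th by rewrite (proj1 fr1 3 isT) regs0.
rewrite r31 in oo2; set o2 := [seq q <- l | _] in oo2.
have so2 : size o2 <= size l := size_subseq (filter_subseq _ _).
have gs2 : gstate x0 l u2 := gstate_frame fr2 isT gs.
have zero2 a x : a \in [:: 13; 14; 20; 21; 22; 23; 25] -> arrs u2 a x = 0.
  move=> ain; rewrite (proj2 fr2 a) ?(proj2 fr1 a) ?arrs0 //;
  by move: ain; rewrite !inE; do 6![case/orP=> [/eqP->//|]] => /eqP->.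
have rs2 : rstate x0 u2 (n * n) (fun=> [::]).
  by apply: rstate_zero => a i ain; apply: zero2; move: ain; rewrite !inE => /or4P[]/eqP->.
have r32 : regs u2 3 = th by rewrite (proj1 fr2 3 isT).
have oW2 : size (o1 ++ o2) + n * n < W by rewrite size_cat; lia.
have zero2' a x : a \in [:: 13; 14; 25] -> arrs u2 a x = 0.
  by move=> ain; apply: zero2; move: ain; rewrite !inE => /or3P[]/eqP->.
have [t4 [u4 [S1 [o4 [d [ex4 tT4 gr1 [sel4 rs4] [oo4 so4 eo4 dP]]]]]]] :=
  select_ok n_gt1 W_big lE gs2 oo2 oW2 r32 th_gt0 zero2' rs2.
have fr4 := exec_frame ex4.
have gs4 : gstate x0 l u4 := gstate_frame fr4 isT gs2.
have deg_pos c x : adj E A c x -> 0 < deg E A c.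
  by move=> cx; apply/card_gt0P; exists x; rewrite inE.
have S1pos : {in S1, forall x, 0 < deg E A x}.
  move=> c /(greedy_seq_meets gr1)[_ /set0Pn[x]]; rewrite !inE => /andP[/predU1P[->|cx] thx].
    exact: leq_trans th_gt0 thx.
  exact: deg_pos cx.
have uS1 := greedy_seq_uniq gr1.
have r44 : regs u4 4 = tp.
  by rewrite (proj1 fr4 4 isT) (proj1 fr2 4 isT) (proj1 fr1 4 isT) regs0.
have r54 : regs u4 5 = t3.
  by rewrite (proj1 fr4 5 isT) (proj1 fr2 5 isT) (proj1 fr1 5 isT) regs0.
have r64 : regs u4 6 = t5.
  by rewrite (proj1 fr4 6 isT) (proj1 fr2 6 isT) (proj1 fr1 6 isT) regs0.
have D04 (x : V) : arrs u4 7 x = 0 by rewrite (proj2 fr4 7 isT) (proj2 fr2 7 isT).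
have oW4 : size ((o1 ++ o2) ++ o4) + n * n < W by rewrite !size_cat; lia.
have [t7 [u7 [T [f [o7 [S2 []]]]]]] :=
  second_phase_ok n_gt1 W_big lE gs4 oo4 oW4 D04 sel4 uS1 S1pos r44 r54 tpt3 rs4.
rewrite r64; set U := right_set E A S1 T f tp t3.
move=> ex7 tT7 trees gr2 [many gU [hS2 r24] [D07 so7] [oo7 eo7]].
have fr7 := exec_frame ex7.
have gs7 : gstate x0 l u7 := gstate_frame fr7 isT gs4.
have S2pos : {in S2, forall x, 0 < deg E A x}.
  move=> c /(greedy_seq_meets gr2)[_ /set0Pn[[v u]]]; rewrite !inE => /andP[/existsP[x /andP[_ cx]] _].
  exact: deg_pos cx.
have uS2 := greedy_seq_uniq gr2.
have oW7 : size (((o1 ++ o2) ++ o4) ++ o7) + n * n < W by rewrite !size_cat; lia.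
have [t8 [u8 [ex8 tT8 fr8 [T2 [o8 [out8 bt2 eo8]]]]]] :=
  wpb_exec (third_phase_ok n_gt1 W_big lE gs7 D07 hS2 r24 uS2 S2pos oo7 oW7).
have bt1 : {in S1, forall v, bfs_tree (adj E A) v (T v)} by move=> v /trees[[]].
exists (t0 + (t1 + (t2 + (t4 + (t7 + t8))))), u8.
exists (H1 :|: light_edges R E A :|: [set [set h; d h] | h in heavy R E A :\: [set c in S1]]
  :|: \bigcup_(x in [set c in S2]) tree_edges (T2 x)
  :|: \bigcup_(v in [set c in S1]) \bigcup_(u in [set c in S1] | connect (adj E A) v u &&
        ((f v u)%:R <= 5 * t_path R #|V|)%R) path_edges (T v) u).
have hE := heavyE E A thE th_gt0.
split.
- exact: exec_seq ex0 (exec_seq ex1 (exec_seq ex2 (exec_seq ex4 (exec_seq ex7 ex8)))).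
(* [setUAC] reorders the union: the program outputs the paths of step 7 before the trees of step
   6. *)
- move: out8; rewrite !edge_set_cat eo eo4 eo7 eo8 (light_edgesE lE thE) hE setUAC.
  congr (outputs _ (_ :|: _)); apply: eq_bigr => v _; apply: eq_bigl => u.
  by rewrite card_ord t5E.
- exists A, H1, [set c in S1], d, T, f, [set c in S2], T2; split=> //.
  + rewrite hE; split; first exact: greedy_seq_greedy.
    by move=> h /dP[dS hd]; rewrite inE.
  + by move=> v; rewrite inE => /trees.
  + rewrite (right_nodesE f tpE t3E bt1); split; first exact: greedy_seq_greedy.
    by move=> x; rewrite inE => /bt2.
pose g := #|U|; pose L := size l; pose p := minn (n %/ tb * (500 * (2 * m))) (500 * (n * n)).
apply: le_trans
  (_ : (5000 * (1 + m + p + size S1 * L + size S2 * L + g * size S2 + g + L))%:R <= _)%R.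
  rewrite ler_nat.
  have k1 := size_le_mul lE S1pos; have k2 := size_le_mul lE S2pos.
  by apply: total_time tT0 tT1 tT2 tT4 tT7 tT8 k1 k2.
rewrite natrM -mulrA ler_wpM2l // card_edges.
have card_A : #|A| <= n by rewrite -[leqRHS]card_ord max_card.
(* The targets of the second greedy run are pairs of vertices, hence the doubled logarithm. *)
have lnn : ln (n * n)%:R = (2 * ln n%:R)%R :> R.
  rewrite natrM lnM ?posrE ?ltr0n ?(ltnW n_gt1) //.
  by rewrite mulr_natl.
(* [(tp %/ 3).+1] dominators and subtree weight [t3.+1] are what every node of R is sure to have;
   the successors turn the strict inequalities between integers into bounds by the real
   thresholds. *)
apply: (@time_bound R n m L (size S1) (size S2) g p (n %/ tb) tb th (tp %/ 3).+1 t3.+1) => //.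
- by rewrite tbE.
- by rewrite thE.
- rewrite -natrM ltW // tpE; lia.
- by rewrite ltW // t3E.
- by lia.
- apply: size_arcs_le lE _ tb0 => v vA.
  by have := peel_deg peelA vA; rewrite card_ord.
- by apply: leq_trans (geq_minl _ _) _; rewrite leq_mul2l; lia.
- exact: geq_minr.
- exact: leq_divM.
- apply: (greedy_seq_bound _ gr1) => //; last exact: ltnW.
  + by move=> h; rewrite inE => /leq_trans; apply; apply: card_heavy_cover.
  + by rewrite -[leqRHS]card_ord max_card.
- rewrite -lnn; apply: (greedy_seq_bound _ gr2) => //; last by rewrite muln_gt0 ltnW.
  by rewrite -[X in X * _]card_ord -[X in _ * X]card_ord -card_prod max_card.
Qed.
End Run.

(** A power [b] of two above [n] is at least 3, so [b ^ 3] exceeds 16 and another factor [b ^ 3]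
    exceeds the cube of [n]: six times the bits of [n] suffice. *)
Lemma word_modulus_big n : 1 < n -> 16 * (n * n * n) <= word_modulus 6 n.
Proof.
move=> n1; rewrite /word_modulus [6 * _]mulnC expnM; set b := 2 ^ _.
have nb : n < b := trunc_log_ltn n (isT : 1 < 2).
have b3 : 3 <= b by apply: leq_trans nb.
rewrite -[6]/(3 + 3) expnD; apply: leq_mul.
  by apply: leq_trans (_ : 3 ^ 3 <= _) => //; rewrite leq_exp2r.
by rewrite -mulnA -[n * (n * n)]/(n ^ 3) leq_exp2r // ltnW.
Qed.

Local Open Scope ring_scope.

Theorem theorem4 (R : realType) :
  exists (p : prog) (k : nat) (C : R),
    forall (n : nat) (E : {set {set 'I_n}}) (es : seq ('I_n * 'I_n)),
      (2 <= n)%N -> simple_graph E -> edge_list E es ->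
      exists (t : nat) (s : state) (H : {set {set 'I_n}}),
        [/\ exec (word_modulus k n) p (init_state R es) t s,
            outputs s H,
            construction R E H
          & t%:R <= C * Num.max 1
              (Num.min (#|E|%:R * n%:R `^ (3 / 5) * lg R n `^ (2 / 5))
                       (n%:R `^ (11 / 5) / lg R n `^ (1 / 5)))].
Proof.
(* One factor 5000 comes from counting machine steps against the combinatorial terms, the other from
   bounding these terms by the real expression. *)
exists main_prog, 6%N, (5000 * 5000) => n E es n2 E_simple es_E.
by have := main_prog_ok (Ordinal (ltnW n2)) n2 (word_modulus_big n2) R E_simple es_E.
Qed.
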